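(* Let $G_n$ be a graph chosen uniformly at random among all unlabeled outerplanar graphs on $n$ vertices. Then the probability that the chromatic number of $G_n$ is different from $3$ tends to zero exponentially fast as $n\to\infty$.
   Context: An outerplanar graph is a graph that can be embedded in the plane with all vertices on the outer face. Unlabeled graphs are counted up to isomorphism (so the uniform distribution is over isomorphism classes). *)

(* Defs.v *)
From HB Require Import structures.
From mathcomp Require Import all_boot all_order all_fingroup all_algebra.
From mathcomp Require Import all_classical all_reals all_analysis.

Set Implicit Arguments.
Unset Strict Implicit.
Unset Printing Implicit Defensive.

Import Order.TTheory GRing.Theory Num.Theory.
Import numFieldNormedType.Exports.

Local Open Scope ring_scope.

Record sgraph (n : nat) := SGraph {
  edges : {set {set 'I_n}};
  edges_card2 : [forall e in edges, #|e| == 2]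
}.

HB.instance Definition _ n := [isSub for @edges n].
HB.instance Definition _ n := [Finite of sgraph n by <:].

Section Graphs.
Variable n : nat.
Implicit Types G H : sgraph n.

Definition adj G : rel 'I_n := fun u v => ([set u; v] \in edges G)%SET.

Definition isomorphic G H : bool :=
  [exists s : {perm 'I_n}, edges H == [set (s @: e)%SET | e : {set 'I_n} in edges G]%SET].

Definition colorable G (k : nat) : bool :=
  [exists c : {ffun 'I_n -> 'I_k},
    [forall u, forall v, adj G u v ==> (c u != c v)]].

Lemma colorable_order G : exists k, colorable G k.
Proof.
exists n; apply/existsP; exists [ffun v => v].
apply/forallP => u; apply/forallP => v; apply/implyP => uv; rewrite !ffunE.
have /forallP/(_ [set u; v]%SET) := edges_card2 G.
by move=> /implyP/(_ uv); rewrite cards2; case: (u != v).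
Qed.

Definition chromatic_number G : nat := ex_minn (colorable_order G).

End Graphs.

Section Drawings.
Variables (R : realType) (n : nat).
Local Notation plane := (R * R)%type.
Local Open Scope classical_set_scope.

Definition is_arc (A : set plane) (x y : plane) : Prop :=
  exists gamma : R -> plane,
    [/\ {within `[0, 1], continuous gamma},
        {in `[0, 1] &, injective gamma},
        gamma 0 = x, gamma 1 = y &
        A = gamma @` `[0, 1]].

(* The vertex v is drawn as the point p v and the edge e as the set A e. *)
Definition is_drawing (G : sgraph n) (p : 'I_n -> plane)
    (A : {set 'I_n} -> set plane) : Prop :=
  [/\ injective p,
      forall u v, adj G u v -> is_arc (A [set u; v]%SET) (p u) (p v),
      forall e v, e \in edges G -> A e (p v) -> v \in e &
      forall e f, e \in edges G -> f \in edges G -> e != f ->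
        A e `&` A f `<=` range p].

Definition drawing_support (G : sgraph n) (p : 'I_n -> plane)
    (A : {set 'I_n} -> set plane) : set plane :=
  range p `|` \bigcup_(e in [set e | e \in edges G]) A e.

(* Faces are the connected components of the complement; when D is compact,
   as the support of a drawing is, exactly one of them is unbounded. *)
Definition is_outer_face (D F : set plane) : Prop :=
  (exists2 x, (~` D) x & F = connected_component (~` D) x) /\
  ~ bounded_set F.

(* A vertex is on a face when it is on its boundary; faces contain no vertex
   and are open, so the closure can be used instead of the boundary. *)
Definition outerplanar (G : sgraph n) : Prop :=
  exists (p : 'I_n -> plane) (A : {set 'I_n} -> set plane),
    is_drawing G p A /\
    exists2 F, is_outer_face (drawing_support G p A) F &
      forall v, closure F (p v).

End Drawings.

(* An unlabeled graph is an isomorphism class of graphs on {0, ..., n-1}. *)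
Definition unlabeled_outerplanar (R : realType) (n : nat) :
    {set {set sgraph n}} :=
  equivalence_partition (@isomorphic n)
    [set G : sgraph n | `[< outerplanar R G >]]%SET.

(* Probability that a uniformly random unlabeled outerplanar graph satisfies E.
   E is meant to be invariant under isomorphism, so that it holds for one
   member of a class if and only if it holds for all of them. *)
Definition prob_outerplanar (R : realType) (n : nat) (E : pred (sgraph n)) : R :=
  #|[set C in unlabeled_outerplanar R n | [exists G in C, E G]]%SET|%:R
  / #|unlabeled_outerplanar R n|%:R.

(* Main.v *)
(* A bipartite outerplanar graph has fewer degrees of freedom than a general one.

   Join the vertices of an outerplanar drawing to a point of the outer face: were
   there a K4 or K2,3 minor, this would draw K5 or K3,3 with no two independent
   edges meeting. Replacing the edges by fine polygonal chains in general position
   and straightening them one corner at a time preserves the parity of the number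
   of crossings of independent edges, and that parity is odd for K5 and K3,3. The
   two excluded minors give a vertex of degree at most 2, hence a colouring with 3
   colours and a linear order of the vertices in which no two edges cross. So a
   graph of chromatic number other than 3 is bipartite.

   Number the vertices of a bipartite outerplanar graph breadth-first. Every vertex
   then has at most two lower neighbours, which are consecutive and move monotonely,
   so the graph is determined by a sequence of child counts, subject to a
   Lukasiewicz condition, and one bit per vertex: there are at most f(n) such
   graphs, f(n) being the number of codes of length n.

   Conversely each code of length k gives a set of noncrossing chords of a cycle of
   length k + 3, and a pendant vertex may be attached to any of the cycle vertices.
   An isomorphism between two of these graphs is determined by the images of two
   vertices, so there are at least f(k) C(k + 3, n - k - 3) / n^2 outerplanar graphs
   on n vertices. As f(k) f(m) <= f(k + m) and f(n) <= 8^n, f(n) grows at a definite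
   exponential rate. For n - k - 3 = d = n / 32 the binomial coefficient is at least
   31^d, while f(n) / f(k) is at most 12^d up to a constant factor. *)

From HB Require Import structures.
Require Import Defs.
From mathcomp Require Import all_boot all_order all_fingroup all_algebra.
From mathcomp Require Import ring lra zify.

Set Implicit Arguments.
Unset Strict Implicit.
Unset Printing Implicit Defensive.

(** * Minors *)

(** No Jordan curve theorem enters. Drawn edges are used only as compact connected sets: disjoint
    ones lie at a positive distance, so they can be traced by chains of small steps and perturbed
    into general position. The parity argument then concerns finitely many points, and its only
    geometry is the sign of the determinant of three of them.

    Neither count is computed asymptotically. The number f of codes bounds the bipartite graphs from
    above and the outerplanar graphs from below, so only ratios of values of f matter. Once the
    growth rate of f is enclosed up to 1 percent, passing from n to k = n - 3 - d costs at most 8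
    for each of the d + 3 lost positions, and (100/99)^32 < 3/2 for each block of 32 vertices; hence
    12 = 8 * 3/2. The 31 comes from choosing d carriers of pendant vertices among the n - d >= 31 d
    cycle vertices. Longer blocks would enlarge 31 but need a sharper enclosure of the growth
    rate. *)

Section Minors.
Variable T : finType.
Implicit Types (e : rel T) (A B : {set T}).

Definition rest e A : rel T := [rel x y | [&& e x y, x \in A & y \in A]].
Definition conn_set e A := {in A &, forall x y, connect (rest e A) x y}.
Definition touch e A B := exists x y, [/\ x \in A, y \in B & e x y].

Definition minor (J : eqType) (h : rel J) e := exists B : J -> {set T},
  [/\ forall i, B i != set0, forall i, conn_set e (B i),
      forall i j, i != j -> [disjoint B i & B j] &
      forall i j, h i j -> touch e (B i) (B j)].

Lemma rest_sub e e' A A' : subrel e e' -> A \subset A' ->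
  subrel (connect (rest e A)) (connect (rest e' A')).
Proof.
move=> ee /fintype.subsetP AA; apply: connect_sub => x y /and3P[exy xA yA].
by apply: connect1; rewrite /rest /= ee // !AA.
Qed.

Lemma rest_sym e A : symmetric e -> connect_sym (rest e A).
Proof.
by move=> es; apply: sym_connect_sym => x y; rewrite /rest /= es (andbC (x \in A)).
Qed.

Lemma minor_sub (J : eqType) (h : rel J) e e' : subrel e e' -> minor h e -> minor h e'.
Proof.
move=> ee [B [B0 cB dB tB]]; exists B; split => //.
- by move=> i x y xB yB; apply: rest_sub (cB i x y xB yB).
- by move=> i j /tB [x [y [xB yB exy]]]; exists x, y; split => //; apply: ee.
Qed.

Lemma conn_setU e A B : symmetric e -> conn_set e A -> conn_set e B -> touch e A B ->
  conn_set e (A :|: B).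
Proof.
move=> es cA cB [a [b [aA bB eab]]].
have sA : A \subset A :|: B by exact: subsetUl.
have sB : B \subset A :|: B by exact: subsetUr.
have cs := rest_sym (A :|: B) es.
have AA x y : x \in A -> y \in A -> connect (rest e (A :|: B)) x y.
  by move=> xA yA; apply: rest_sub sA _ _ (cA x y xA yA).
have BB x y : x \in B -> y \in B -> connect (rest e (A :|: B)) x y.
  by move=> xA yA; apply: rest_sub sB _ _ (cB x y xA yA).
have ab : connect (rest e (A :|: B)) a b.
  by apply: connect1; rewrite /rest /= eab (fintype.subsetP sA) // (fintype.subsetP sB).
have AB x y : x \in A -> y \in B -> connect (rest e (A :|: B)) x y.
  by move=> xA yB; apply: connect_trans (AA x a xA aA) (connect_trans ab (BB b y bB yB)).
move=> x y; rewrite !inE => /orP[xA|xB] /orP[yA|yB]; [exact: AA|exact: AB| |exact: BB].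
by rewrite cs; apply: AB.
Qed.

Lemma conn_set1 e x : conn_set e [set x].
Proof. by move=> y z; rewrite !inE => /eqP-> /eqP->; apply: connect0. Qed.
End Minors.

Definition K4 : rel 'I_4 := fun i j => i != j.
(** Each edge is listed in one direction only, since [minor] asks for one [touch] per related
    pair. *)
Definition K23 : rel 'I_5 := fun i j => (i < 2) && (2 <= j).

(** * Graphs without a K4 minor *)

Section LowDegree.
Variable T : finType.
Implicit Types (e : rel T) (A B S : {set T}).

Lemma sorted_conn e s : symmetric e -> sorted e s -> conn_set e [set z in s].
Proof.
move=> es; elim: s => [|x s IH]; first by move=> _ z w; rewrite inE.
move=> /= ps; have -> : [set z in x :: s] = [set x] :|: [set z in s].
  by apply/setP => z; rewrite !inE.
case: s IH ps => [|y s] IH /= => [_|/andP[exy ps]].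
  have -> : [set x] :|: [set z in [::]] = [set x] by apply/setP => z; rewrite !inE orbF.
  exact: conn_set1.
apply: (conn_setU es (@conn_set1 _ e x) (IH ps)).
by exists x, y; split; rewrite ?inE ?eqxx.
Qed.

Lemma K4_intro e (B0 B1 B2 B3 : {set T}) : symmetric e ->
  all (fun B : {set T} => B != set0) [:: B0; B1; B2; B3] ->
  (forall B, B \in [:: B0; B1; B2; B3] -> conn_set e B) ->
  pairwise (fun B B' : {set T} => [disjoint B & B']) [:: B0; B1; B2; B3] ->
  [/\ touch e B0 B1, touch e B0 B2, touch e B0 B3 & touch e B1 B2] ->
  touch e B1 B3 -> touch e B2 B3 -> minor K4 e.
Proof.
move=> es n0 cB dB [t01 t02 t03 t12] t13 t23.
have ts A B : touch e A B -> touch e B A.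
  by move=> [x [y [xA yB xy]]]; exists y, x; rewrite es.
exists (fun i : 'I_4 => nth set0 [:: B0; B1; B2; B3] i); split.
- by move=> i; apply: (all_nthP set0 n0).
- by move=> i; apply: cB; apply: mem_nth.
- move=> i j; rewrite -val_eqE /= neq_ltn.
  have H := elimT (pairwiseP set0) dB.
  case/orP=> ij; last rewrite disjoint_sym;
  by apply: H ij; rewrite inE /= ltn_ord.
- move=> i j; rewrite /K4 -val_eqE.
  by case: i => [[|[|[|[|i]]]] //= _]; case: j => [[|[|[|[|j]]]] //= _] _; auto.
Qed.

Lemma K23_intro e (A0 A1 B0 B1 B2 : {set T}) :
  all (fun B : {set T} => B != set0) [:: A0; A1; B0; B1; B2] ->
  (forall B, B \in [:: A0; A1; B0; B1; B2] -> conn_set e B) ->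
  pairwise (fun B B' : {set T} => [disjoint B & B']) [:: A0; A1; B0; B1; B2] ->
  (forall B, B \in [:: B0; B1; B2] -> touch e A0 B /\ touch e A1 B) -> minor K23 e.
Proof.
move=> n0 cB dB tB.
exists (fun i : 'I_5 => nth set0 [:: A0; A1; B0; B1; B2] i); split.
- by move=> i; apply: (all_nthP set0 n0).
- by move=> i; apply: cB; apply: mem_nth.
- move=> i j; rewrite -val_eqE /= neq_ltn.
  have H := elimT (pairwiseP set0) dB.
  case/orP=> ij; last rewrite disjoint_sym;
  by apply: H ij; rewrite inE /= ltn_ord.
- move=> [i i5] [j j5] /andP[/= i2 j2].
  have jB : nth set0 [:: A0; A1; B0; B1; B2] j \in [:: B0; B1; B2].
    case: j j2 j5 => [|[|j]] //= _ j5; apply: (mem_nth set0 (s := [:: B0; B1; B2])).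
    by rewrite /=; lia.
  have [t0 t1] := tB _ jB.
  by case: i i2 i5 => [|[|i]].
Qed.

(* Posa rotations. In a longest path [s], all neighbours of the head lie on [s].
   Let [i] be the least position past 1 of such a neighbour, minimised over all
   longest paths: reversing the first [i] vertices gives another longest path,
   so the new head has a neighbour beyond [i], which completes a K4. *)
Lemma low_degree e S : symmetric e -> irreflexive e ->
  (forall x y, e x y -> (x \in S) && (y \in S)) -> S != set0 -> ~ minor K4 e ->
  exists2 v, v \in S & #|[set w | e v w]| <= 2.
Proof.
move=> es ei eS S0 nK4.
case: (boolP [exists v in S, #|[set w | e v w]| <= 2]).
  by case/exists_inP=> v; exists v.
rewrite negb_exists_in => /forall_inP deg; exfalso.
have {}deg v : v \in S -> 2 < #|[set w | e v w]|.
  by move=> /deg; rewrite -ltnNge.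
have [x0 x0S] := set0Pn _ S0.
pose valid s := [&& sorted e s, uniq s, s != [::] & all (mem S) s].
have [M [[s0 vs0 sM] Mmax]] : exists M, (exists2 s, valid s & size s = M) /\
    forall s, valid s -> size s <= M.
  pose Q M := [exists t : M.-tuple T, valid t].
  have Q1 : exists M, Q M.
    by exists 1; apply/existsP; exists [tuple x0]; rewrite /valid /= x0S.
  have Qb M : Q M -> M <= #|T|.
    case/existsP => t /and4P[_ ut _ _]; rewrite -(size_tuple t).
    by rewrite -(card_uniqP ut) max_card.
  exists (ex_maxn Q1 Qb); case: ex_maxnP => M /existsP[t vt] Mm; split.
    by exists t; rewrite ?size_tuple.
  by move=> s vs; apply: Mm; apply/existsP; exists (in_tuple s).
pose f s := (find (e (head x0 s)) (drop 2 s)).+2.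
suff : forall i s, valid s -> size s = M -> f s = i -> False by move/(_ (f s0) s0 vs0 sM erefl).
have nbr s w : valid s -> size s = M -> e (head x0 s) w -> exists t,
    [/\ 0 < t, t < M, w = nth x0 s t & 2 <= t -> f s <= t].
  move=> vs sM' ew.
  have ws : w \in s.
    apply: contraT => ws; have : size (w :: s) <= M.
      apply: Mmax; case: s vs ew ws {sM'} => // y s /and4P[/= ps us _ aS] ew ws.
      apply/and4P; split => //; first by rewrite /= es ew.
        by rewrite cons_uniq ws.
      by have /andP[_ wS] := eS _ _ ew; apply/andP.
    by rewrite /= sM' ltnn.
  exists (index w s); rewrite nth_index // -sM' index_mem; split => //.
    by rewrite lt0n; apply: contraTneq ew => w0; rewrite -(nth_index x0 ws) w0 nth0 ei.
  move=> t2; rewrite /f; set i := index w s in t2 *.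
  rewrite leqNgt ltnS; apply/negP => lt.
  have := @before_find _ x0 (e (head x0 s)) (drop 2 s) (i - 2).
  rewrite nth_drop subnKC // nth_index // ew => H.
  by have : true = false by apply: H; lia.
(* With at least three neighbours, the head has one that avoids both the second vertex of the path
   and a prescribed [u]. *)
have two s u : valid s -> size s = M -> exists2 w, e (head x0 s) w & (w != nth x0 s 1) && (w != u).
  move=> vs _; have hS : head x0 s \in S.
    by case/and4P: vs => _ _; case: (s) => //= y t _ /andP[].
  have : 0 < #|[set w | e (head x0 s) w] :\: [set nth x0 s 1; u]|.
    rewrite cardsD subn_gt0; apply: leq_trans (deg _ hS).
    rewrite ltnS; apply: leq_trans (subset_leq_card (subsetIr _ _)) _.
    by rewrite cards2; case: (_ != _).
  case/card_gt0P => w; rewrite !inE negb_or => /andP[n ew].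
  by exists w.
elim/ltn_ind => i IH s vs sM' fi.
have si t : t.+1 < M -> e (nth x0 s t) (nth x0 s t.+1).
  by case/and4P: vs => /(sortedP x0) H _ _ _; rewrite -sM'; apply: H.
have us : uniq s by case/and4P: vs.
have [w1 ew1 /andP[w11 _]] := two s x0 vs sM'.
have [t1 [t10 t1M w1E t1f]] := nbr s w1 vs sM' ew1.
have t12 : 2 <= t1.
  by case: t1 t10 w1E {t1M t1f} => [|[|t]] // _ w1E; rewrite w1E eqxx in w11.
have iM : i < M by rewrite -fi; apply: leq_ltn_trans (t1f t12) _.
have i2 : 2 <= i by rewrite -fi.
have ei0 : e (head x0 s) (nth x0 s i).
  have hd : has (e (head x0 s)) (drop 2 s).
    apply/(has_nthP x0); exists (t1 - 2); first by rewrite size_drop; lia.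
    by rewrite nth_drop subnKC // -w1E.
  by have := nth_find x0 hd; rewrite nth_drop -fi /f addnC addn2.
have [w2 ew2 /andP[w21 w2i]] := two s (nth x0 s i) vs sM'.
have [j [j0 jM w2E jf]] := nbr s w2 vs sM' ew2.
have ij : i < j.
  have j2 : 2 <= j by case: j j0 w2E {jM jf} => [|[|t]] // _ E; rewrite E eqxx in w21.
  rewrite ltn_neqAle -fi jf // andbT fi; apply: contraNneq w2i => ->; by rewrite w2E.
(* The new head is the old vertex [i.-1], and positions from [i] on are unchanged. By the induction
   hypothesis [f s'] cannot be below [i]. *)
pose s' := rev (take i s) ++ drop i s.
have st : size (take i s) = i by rewrite size_takel // sM' ltnW.
have ns' t : nth x0 s' t = if t < i then nth x0 s (i - t.+1) else nth x0 s t.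
  rewrite nth_cat size_rev st; case: ltnP => ti.
    by rewrite nth_rev ?st // nth_take //; clear -ti i2; lia.
  by rewrite nth_drop subnKC.
have ps' : perm_eq s' s.
  by rewrite /s' -[X in perm_eq _ X](cat_take_drop i s) perm_cat2r perm_rev.
have ss' : size s' = M by rewrite (perm_size ps').
have vs' : valid s'.
  apply/and4P; split.
  - apply/(sortedP x0) => t; rewrite ss' !ns' => tM.
    case: (ltngtP t.+1 i) => ti.
    + rewrite es (_ : i - t.+1 = (i - t.+2).+1); last by clear -ti; lia.
      by apply: si; clear -ti iM; lia.
    + exact: si.
    + by rewrite ti subnn nth0.
  - by rewrite (perm_uniq ps').
  - by rewrite -size_eq0 ss' -lt0n (leq_ltn_trans _ iM).
  - by rewrite (perm_all _ ps'); case/and4P: vs.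
have hs' : head x0 s' = nth x0 s i.-1 by rewrite -nth0 ns' (leq_trans _ i2) // subn1.
have fi' : i <= f s' by rewrite leqNgt; apply/negP => /IH /(_ s' vs' ss' erefl).
have [w3 ew3 /andP[w31 w3i]] := two s' (nth x0 s i) vs' ss'.
have [m [m0 mM w3E mf]] := nbr s' w3 vs' ss' ew3.
have m2 : 2 <= m by case: m m0 w3E {mM mf} => [|[|t]] // _ E; rewrite E eqxx in w31.
have im : i < m.
  rewrite ltn_neqAle (leq_trans fi' (mf m2)) andbT.
  by apply: contraNneq w3i => im; rewrite w3E ns' -im ltnn.
rewrite w3E ns' ltnNge (ltnW im) /= hs' in ew3.
rewrite w2E -nth0 in ew2; rewrite -nth0 in ei0.
have mtake z : reflect (exists2 t, t < i.-1 & z = nth x0 s t) (z \in take i.-1 s).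
  have sz : size (take i.-1 s) = i.-1.
    by rewrite size_takel // sM'; clear -iM i2; lia.
  apply: (iffP (nthP x0)) => [[t]|[t ti ->]]; rewrite ?sz.
    by move=> ti <-; exists t; rewrite // nth_take.
  by exists t; rewrite ?nth_take.
have mdrop z : reflect (exists2 t, i < t < M & z = nth x0 s t) (z \in drop i.+1 s).
  apply: (iffP (nthP x0)) => [[t]|[t ti ->]]; rewrite size_drop sM'.
    move=> ti <-; exists (i.+1 + t); rewrite ?nth_drop //.
    by clear -ti; lia.
  exists (t - i.+1); rewrite ?nth_drop; first by clear -ti; lia.
  by rewrite subnKC //; clear -ti; lia.
have inj a b : a < M -> b < M -> nth x0 s a = nth x0 s b -> a = b.
  by move=> aM bM /eqP; rewrite nth_uniq ?sM' // => /eqP.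
have [i1M ii1 i10] : [/\ i.-1 < M, i.-1 < i & 0 < i.-1] by clear -iM i2; split; lia.
have drop_j t : i < t -> t < M -> nth x0 s t \in [set z in drop i.+1 s].
  by move=> it tM; rewrite inE; apply/mdrop; exists t => //; rewrite it.
have take_0 : nth x0 s 0 \in [set z in take i.-1 s].
  by rewrite inE; apply/mtake; exists 0.
have ss : sorted e s by case/and4P: vs.
have sti : e (nth x0 s i.-1) (nth x0 s i).
  by have := si i.-1; rewrite prednK ?(ltnW i2) //; apply.
(* The branch sets are the path before [i.-1], the two single vertices, and the path after [i]. Path
   edges give three of the touches; the chords from the head to [i] and to [j] and from [i.-1] to
   [m] give the others. *)
apply: nK4; apply: (K4_intro (B0 := [set z in take i.-1 s]) (B1 := [set nth x0 s i.-1])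
  (B2 := [set nth x0 s i]) (B3 := [set z in drop i.+1 s]) es).
- rewrite /= andbT; apply/and4P; split; apply/set0Pn.
  + by exists (nth x0 s 0).
  + by exists (nth x0 s i.-1); rewrite inE.
  + by exists (nth x0 s i); rewrite inE.
  + by exists (nth x0 s j); apply: drop_j.
- move=> B; rewrite !inE => /or4P[]/eqP->; try exact: conn_set1.
  + exact/(sorted_conn es)/take_sorted.
  + exact/(sorted_conn es)/drop_sorted.
- rewrite /= !andbT -!setI_eq0; apply/and3P; split; [apply/and3P; split|apply/andP; split|];
    apply/eqP/setP => z; rewrite !inE; apply/negbTE/negP => /andP[].
  + move=> /mtake[t ti ->] /eqP /inj E; move: (ti); rewrite E ?ltnn //.
    exact: ltn_trans i1M.
  + move=> /mtake[t ti ->] /eqP /inj E; move: (ti); rewrite E //.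
      by rewrite ltnNge (ltnW ii1).
    exact: ltn_trans i1M.
  + move=> /mtake[t ti ->] /mdrop[t' /andP[it' t'M]] /inj E.
    have := ltn_trans (ltn_trans ti ii1) it'; rewrite E ?ltnn //.
    exact: ltn_trans i1M.
  + by move=> /eqP -> /eqP /inj E; move: ii1; rewrite E // ltnn.
  + move=> /eqP -> /mdrop[t' /andP[it' t'M]] /inj E.
    by move: (ltn_trans ii1 it'); rewrite E // ltnn.
  + by move=> /eqP -> /mdrop[t' /andP[it' t'M]] /inj E; move: it'; rewrite E // ltnn.
- split.
  + have im1 : i.-2 < i.-1 by clear -i2; lia.
    exists (nth x0 s i.-2), (nth x0 s i.-1); split; rewrite ?inE //.
      by apply/mtake; exists i.-2.
    by have := si i.-2; rewrite prednK // => /(_ i1M).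
  + by exists (nth x0 s 0), (nth x0 s i); split; rewrite // inE.
  + by exists (nth x0 s 0), (nth x0 s j); split => //; apply: drop_j.
  + by exists (nth x0 s i.-1), (nth x0 s i); split; rewrite // inE.
- by exists (nth x0 s i.-1), (nth x0 s m); split => //; [rewrite inE|apply: drop_j].
- have jM' : i.+1 < M by apply: leq_ltn_trans jM.
  exists (nth x0 s i), (nth x0 s i.+1); split; [by rewrite inE|exact: drop_j|exact: si].
Qed.

(** By [low_degree] one can repeatedly remove a vertex with at most two neighbours; greedy colouring
    in the reverse order needs three colours. The induction is on vertex sets, with [rest] for the
    subgraphs, so that the type stays fixed. *)
Lemma three_colorable e : symmetric e -> irreflexive e -> ~ minor K4 e ->
  exists c : T -> 'I_3, forall x y, e x y -> c x != c y.
Proof.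
move=> es ei nK4.
have K S : exists c : T -> 'I_3, {in S &, forall x y, e x y -> c x != c y}.
  move: {2}#|S| (leqnn #|S|) => m; elim: m S => [|m IH] S.
    by rewrite leqn0 cards_eq0 => /eqP ->; exists (fun=> ord0) => x y; rewrite inE.
  move=> Sm; have [->|S0] := eqVneq S set0.
    by exists (fun=> ord0) => x y; rewrite inE.
  have [||||v vS dv] := @low_degree (rest e S) S _ _ _ S0.
  - by move=> x y; rewrite /rest /= es (andbC (x \in S)).
  - by move=> x; rewrite /rest /= ei.
  - by move=> x y /and3P[_ -> ->].
  - by move/(minor_sub (e' := e)) => H; apply: nK4; apply: H => x y /and3P[].
  have [|c Hc] := IH (S :\ v); first by rewrite -ltnS (leq_trans _ Sm) // [X in _ < X](cardsD1 v) vS.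
  have [k kN] : exists k, k \notin [set c w | w in [set w | rest e S v w]].
    apply/existsP; rewrite -negb_forall; apply/negP => /forallP H.
    have : #|[set c w | w in [set w | rest e S v w]]| <= 2.
      exact: leq_trans (leq_imset_card _ _) dv.
    rewrite (_ : [set c w | w in _] = setT) ?cardsT ?card_ord //.
    by apply/setP => k; rewrite inE; apply: H.
  have kv y : y \in S -> e v y -> k != c y.
    move=> yS vy; apply: contraNneq kN => ->; apply: imset_f.
    by rewrite inE /rest /= vy vS.
  exists (fun x => if x == v then k else c x) => x y xS yS exy.
  have [xv|xv] := eqVneq x v; have [yv|yv] := eqVneq y v.
  - by move: exy; rewrite xv yv ei.
  - by apply: kv => //; rewrite -xv.
  - by rewrite eq_sym; apply: kv => //; rewrite es -yv.
  - by apply: Hc; rewrite // !inE ?xv ?yv.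
by have [c Hc] := K setT; exists c => x y; apply: Hc; rewrite inE.
Qed.
End LowDegree.

(** * Noncrossing orders *)

Section NonCrossing.
Variable T : finType.
Implicit Types (e : rel T) (A B S : {set T}) (pos : T -> nat).

Definition noncrossing e pos := forall x y z w, e x y -> e z w ->
  pos x < pos z -> pos z < pos y -> pos y < pos w -> False.

(** The relation suppresses [v]: it is deleted and [a], [b] are joined. A minor is lifted by adding
    [v] to the branch set that contains [a], so that the path through [v] replaces the new edge. As
    [h] has no isolated vertex, [v], isolated in the new relation, lies in no branch set
    beforehand. *)
Lemma bypass_minor (J : eqType) (h : rel J) e v a b : symmetric e -> irreflexive e ->
  (forall i, exists j, h i j || h j i) -> e v a -> e v b ->
  minor h [rel x y | [&& x != v, y != v & e x y] || [|| (x == a) && (y == b) | (x == b) && (y == a)]] ->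
  minor h e.
Proof.
move=> es ei hh va vb [B [B0 cB dB tB]].
set e' : rel T := [rel x y | _] in cB tB.
have av : a != v by apply: contraTneq va => ->; rewrite ei.
have bv : b != v by apply: contraTneq vb => ->; rewrite ei.
have nv x : ~~ e' x v.
  rewrite /e' /= eqxx andbF /= (eq_sym v b) (eq_sym v a) (negbTE av) (negbTE bv).
  by rewrite !andbF.
have e's : symmetric e'.
  by move=> x y; rewrite /e' /= es [(x != v) && _]andbCA orbC [RHS]orbC; congr (_ || _);
    rewrite orbC andbC [(x == a) && _]andbC.
have vB i : v \notin B i.
  apply/negP => vi.
  have [u ui uv] : exists2 u, u \in B i & u != v.
    have [j /orP[/tB|/tB] [x [y [xi yi xy]]]] := hh i.
      exists x => //; apply: contraTneq xy => ->; rewrite e's; exact: nv.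
    by exists y => //; apply: contraTneq xy => ->; exact: nv.
  have /connectP[p] := cB i u v ui vi; case/lastP: p => [_ /= E|p w].
    by rewrite E eqxx in uv.
  rewrite rcons_path last_rcons => /andP[_ /and3P[ew _ _]] E.
  by move: ew; rewrite -E (negbTE (nv _)).
pose B' i := if a \in B i then v |: B i else B i.
have BB' i : B i \subset B' i by rewrite /B'; case: ifP => // _; exact: subsetUr.
have av' i : a \in B i -> v \in B' i by rewrite /B' => ->; rewrite !inE eqxx.
have cs i := rest_sym (B' i) es.
have step i x y : rest e' (B i) x y -> connect (rest e (B' i)) x y.
  case/and3P=> + xi yi; have xi' := fintype.subsetP (BB' i) _ xi.
  have yi' := fintype.subsetP (BB' i) _ yi.
  case/orP => [/and3P[_ _ exy]|]; first by apply: connect1; apply/and3P.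
  have bridge : a \in B i -> b \in B i -> connect (rest e (B' i)) a b.
    move=> ai bi; apply: (@connect_trans _ _ v); apply: connect1; apply/and3P; split => //.
    - by rewrite es.
    - exact: (fintype.subsetP (BB' i)).
    - exact: av'.
    - exact: av'.
    - exact: (fintype.subsetP (BB' i)).
  case/orP=> /andP[/eqP xa /eqP yb]; subst x y; first exact: bridge.
  by rewrite cs; apply: bridge.
exists B'; split.
- move=> i; have /set0Pn[x xi] := B0 i; apply/set0Pn; exists x.
  exact: (fintype.subsetP (BB' i)).
- move=> i.
  have K x y : x \in B i -> y \in B i -> connect (rest e (B' i)) x y.
    by move=> xi yi; exact: (connect_sub (@step i)) (cB i x y xi yi).
  rewrite /B'; case: ifP => ai; last by move=> x y xi yi; have := K x y xi yi; rewrite /B' ai.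
  have va' : connect (rest e (v |: B i)) v a.
    by apply: connect1; apply/and3P; split; rewrite // !inE ?eqxx // ai orbT.
  have K' x : x \in v |: B i -> connect (rest e (v |: B i)) x a.
    rewrite inE => /orP[/set1P -> //|xi].
    by have := K x a xi ai; rewrite /B' ai.
  move=> x y xi yi; apply: connect_trans (K' x xi) _.
  by rewrite (rest_sym _ es); apply: K'.
- move=> i j ij; have dij := dB i j ij.
  rewrite /B'; case: ifP => ai; case: ifP => aj //.
  + by move: (disjointFr dij ai); rewrite aj.
  + by rewrite -setI_eq0 setIUl setU_eq0 !setI_eq0 dij disjoints1 vB.
  + by rewrite disjoint_sym -setI_eq0 setIUl setU_eq0 !setI_eq0 disjoints1 vB disjoint_sym.
- move=> i j /tB[x [y [xi yj]]].
  have xi' := fintype.subsetP (BB' i) _ xi.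
  have yj' := fintype.subsetP (BB' j) _ yj.
  case/orP => [/and3P[_ _ exy]|]; first by exists x, y.
  case/orP=> /andP[/eqP xa /eqP yb]; subst x y.
    by exists v, b; rewrite av'.
  by exists b, v; rewrite av' // es.
Qed.

(** Crossing depends only on the cyclic order; here the vertices before position [c] move behind all
    others. The four instances of [nc] are the rotations of a crossing quadruple. *)
Lemma noncrossing_rot e pos c : symmetric e -> noncrossing e pos ->
  noncrossing e (fun x => if c <= pos x then pos x else pos x + (\max_y pos y).+1).
Proof.
move=> es nc x y z w exy ezw.
have M t : pos t <= \max_y pos y by apply: leq_bigmax.
move: (M x) (M y) (M z) (M w).
have n1 := nc x y z w exy ezw.
have n2 := nc z w y x ezw (etrans (es y x) exy).
have n3 := nc y x w z (etrans (es y x) exy) (etrans (es w z) ezw).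
have n4 := nc w z x y (etrans (es w z) ezw) exy.
move: n1 n2 n3 n4; clear.
case: (leqP c (pos x)); case: (leqP c (pos y)); case: (leqP c (pos z));
  case: (leqP c (pos w)) => *; lia.
Qed.

Lemma noncrossing_rot_inj pos c : injective pos ->
  injective (fun x => if c <= pos x then pos x else pos x + (\max_y pos y).+1).
Proof.
move=> pI x y.
have M t : pos t <= \max_y pos y by apply: leq_bigmax.
by have := M x; have := M y; case: ifP; case: ifP => *; apply: pI; lia.
Qed.

(* The slot comes just after the last vertex between [a] and [b] that is linked
   to [a] inside [I]; a new vertex adjacent to [a] and [b] fits there. *)
Lemma noncrossing_slot e pos a b (I : {set T}) : symmetric e -> injective pos -> noncrossing e pos ->
  e a b -> pos a < pos b ->
  I = [set x | pos a < pos x < pos b] ->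
  (forall y x, y \in I -> e a y -> connect (rest e I) y x -> ~~ e b x) ->
  exists2 tau, pos a <= tau < pos b & forall x y, e x y ->
    pos x <= tau < pos y -> (pos x <= pos a) && (pos b <= pos y).
Proof.
move=> es pI nc eab ab IE unlinked.
have II x : (x \in I) = (pos a < pos x < pos b) by rewrite IE inE.
pose K := [set x in I | [exists y in I, e a y && connect (rest e I) y x]].
have Kp x : reflect (x \in I /\ exists y, [/\ y \in I, e a y & connect (rest e I) y x]) (x \in K).
  rewrite inE; apply: (iffP andP) => -[xI].
    by move/exists_inP => [y yI /andP[ay yx]]; split => //; exists y.
  by move=> [y [yI ay yx]]; split => //; apply/exists_inP; exists y; rewrite // ay.
have KI x : x \in K -> pos a < pos x < pos b by move/Kp => [+ _]; rewrite II.
have Kadd x y : x \in K -> e x y -> y \in I -> y \in K.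
  move=> /Kp[xI [z [zI az zx]]] xy yI; apply/Kp; split => //; exists z; split => //.
  by apply: connect_trans zx _; apply: connect1; apply/and3P.
have [t tK tmax] : exists2 t, t \in a |: K & forall x, x \in a |: K -> pos x <= pos t.
  by case: (@arg_maxnP T a (mem (a |: K)) pos); [exact: setU11|move=> t tK H; exists t].
have tab : pos a <= pos t < pos b.
  by case/setU1P: tK => [->|/KI/andP[/ltnW -> ->]] //; rewrite leqnn.
exists (pos t) => // x y exy /andP[xt ty].
have [xb tb] : pos x < pos b /\ pos t < pos b.
  by case/andP: tab => _ tb; split => //; apply: leq_ltn_trans xt tb.
have yb_of : pos a < pos x -> pos y <= pos b.
  move=> ax; rewrite leqNgt; apply/negP => by_.
  exact: (nc a b x y eab exy ax xb by_).
case: (leqP (pos x) (pos a)) => [xa|ax] /=.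
  rewrite leqNgt; apply/negP => yb.
  have ay : pos a < pos y by case/andP: tab => at_ _; apply: leq_ltn_trans at_ ty.
  have [xEa|xNa] := eqVneq x a; last first.
    apply: (nc x y a b exy eab _ ay yb).
    by rewrite ltn_neqAle xa andbT; apply: contra xNa => /eqP /pI ->.
  have yI : y \in I by rewrite II ay yb.
  have yK : y \in K.
    by apply/Kp; split => //; exists y; split => //; rewrite -xEa.
  by have := tmax y; rewrite in_setU1 yK orbT leqNgt ty => /(_ isT).
exfalso.
have xI : x \in I by rewrite II ax xb.
have yb := yb_of ax.
have [xK|xK] := boolP (x \in K).
  have [yEb|yNb] := eqVneq y b.
    have /Kp[_ [z [zI az zx]]] := xK.
    by have := unlinked z x zI az zx; rewrite -yEb es exy.
  have yI : y \in I.
    rewrite II (leq_ltn_trans _ ty); last by case/andP: tab.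
    by rewrite ltn_neqAle yb andbT; apply: contra yNb => /eqP /pI ->.
  by have := tmax y; rewrite in_setU1 (Kadd _ _ xK exy yI) orbT leqNgt ty => /(_ isT).
have tK' : t \in K.
  by case/setU1P: tK => // ta; move: xt ax; rewrite ta; lia.
have xt' : pos x < pos t.
  by rewrite ltn_neqAle xt andbT; apply: contraNneq xK => /pI ->.
have /Kp[tI [z [zI az /connectP[p pz lt]]]] := tK'.
have zK : z \in K by apply/Kp; split => //; exists z; split.
have zy : pos z < pos y.
  by apply: leq_ltn_trans ty; apply: tmax; rewrite in_setU1 zK orbT.
have zx : pos z < pos x.
  rewrite ltnNge; apply/negP => xz.
  have [xEz|xNz] := eqVneq x z; first by rewrite xEz zK in xK.
  apply: (nc a z x y az exy ax _ zy).
  by rewrite ltn_neqAle xz andbT; apply: contra xNz => /eqP /pI ->.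
(* A path inside [K] leads from [z], before [x], to [t], after [x], and stays before [y] because [t]
   is last in [K]. The step that passes over [x] crosses the edge [x y]. *)
elim: p z zK zx pz lt {az zI zy} => [|w p IH] z zK zx /=.
  by move=> _ tz; move: xt'; rewrite tz; lia.
case/andP => /and3P[zw _ wI] pw lt.
have wK := Kadd _ _ zK zw wI.
have wy : pos w < pos y.
  by apply: leq_ltn_trans ty; apply: tmax; rewrite in_setU1 wK orbT.
case: (ltngtP (pos w) (pos x)) => [wx|xw|/pI wx].
- exact: IH wx pw lt.
- exact: (nc z w x y zw exy zx xw wy).
- by rewrite -wx wK in xK.
Qed.

Lemma component_conn e I y : symmetric e ->
  conn_set e [set z | connect (rest e I) y z].
Proof.
move=> es; set C := [set z | _].
have K z : z \in C -> connect (rest e C) y z.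
  rewrite inE => /connectP[p]; elim/last_ind: p z => [|p w IH] z.
    by move=> _ ->.
  rewrite rcons_path last_rcons => /andP[pp lw] ->.
  apply: connect_trans (IH _ pp erefl) (connect1 _).
  have lC : last y p \in C by rewrite inE; apply/connectP; exists p.
  case/and3P: (lw) => ew _ _; rewrite /rest /= ew lC /=.
  move: lC; rewrite !inE => lC; apply: connect_trans lC (connect1 _); exact: lw.
move=> z w zC wC; apply: connect_trans (K w wC).
by rewrite (rest_sym _ es); apply: K.
Qed.

Lemma component_sub e (I : {set T}) y z : y \in I -> connect (rest e I) y z -> z \in I.
Proof.
move=> yI /connectP[p pp ->]; elim: p y yI pp => //= x p IH y yI.
by case/andP => /and3P[_ _ xI]; apply: IH.
Qed.

Lemma connect_last (r : rel T) y z : connect r y z -> z = y \/ exists u, r u z.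
Proof.
case/connectP => p; case/lastP: p => [_ ->|p w]; first by left.
by rewrite rcons_path last_rcons => /andP[_ lw] ->; right; exists (last y p).
Qed.

(** Induction by removing a vertex [v] of degree at most 2. With one neighbour, [v] goes right after
    it. With two, [v] is suppressed, the rest is ordered, and [v] is inserted on one of the two
    sides of the edge that replaced it; if both sides are blocked, there is a K2,3 minor. *)
Theorem noncrossing_order e : symmetric e -> irreflexive e ->
  ~ minor K4 e -> ~ minor K23 e ->
  exists2 pos, injective pos & noncrossing e pos.
Proof.
move=> es ei.
pose S := [set: T]; have eS x y : e x y -> (x \in S) && (y \in S) by rewrite !inE.
move: {2}#|S| (leqnn #|S|) => m.
elim: m e es ei S eS => [|m IH] e es ei S eS Sm nK4 nK23.
  have S0 : S = set0 by apply/eqP; rewrite -cards_eq0 -leqn0.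
  exists (fun x => nat_of_ord (enum_rank x)); first by move=> x y /ord_inj/enum_rank_inj.
  by move=> x y z w /eS; rewrite S0 inE.
have [S0|S0] := eqVneq S set0.
  exists (fun x => nat_of_ord (enum_rank x)); first by move=> x y /ord_inj/enum_rank_inj.
  by move=> x y z w /eS; rewrite S0 inE.
have [v vS dv] := low_degree es ei eS S0 nK4.
have Sv : #|S :\ v| <= m by rewrite -ltnS (leq_trans _ Sm) // [X in _ < X](cardsD1 v) vS.
(* Doubling all positions frees the odd ones; [v] is placed between [tau] and [tau.+1]. *)
have shift_inj pos tau : injective pos ->
    injective (fun x => if x == v then (tau.*2).+1 else (pos x).*2).
  move=> pI x y; case: eqP => [->|_]; case: eqP => [->|_] //; try lia.
  by move=> H; apply: pI; lia.
have [[a Na]|[a [b [va vb ab Nab]]]] :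
    (exists a, forall w, e v w -> w = a) \/
    (exists a b, [/\ e v a, e v b, a != b & forall w, e v w -> w = a \/ w = b]).
  have [N0|N0] := eqVneq [set w | e v w] set0.
    by left; exists v => w vw; have := in_set0 w; rewrite -N0 inE vw.
  have [a] := set0Pn _ N0; rewrite inE => va.
  have [N1|N1] := eqVneq ([set w | e v w] :\ a) set0.
    left; exists a => w vw; apply/eqP; apply: contraFT (in_set0 w) => wa.
    by rewrite -N1 !inE wa.
  have [b] := set0Pn _ N1; rewrite !inE => /andP[ba vb].
  right; exists a, b; split => //; rewrite 1?eq_sym // => w vw; have [->|wa] := eqVneq w a; first by left.
  right; apply/eqP; apply: contraT => wb.
  move: dv; rewrite (cardsD1 a) (cardsD1 b) (cardsD1 w) !inE va vb vw ba wa wb.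
  by [].
- pose e' := [rel x y | [&& x != v, y != v & e x y]].
  have se : subrel e' e by move=> x y /and3P[].
  have [||||||pos pI nc] := IH e' _ _ (S :\ v).
  + by move=> x y; rewrite /e' /= es andbCA.
  + by move=> x; rewrite /e' /= ei !andbF.
  + by move=> x y /and3P[xv yv /eS /andP[xS yS]]; rewrite !inE xv yv xS.
  + exact: Sv.
  + by move/(minor_sub se).
  + by move/(minor_sub se).
  exists (fun x => if x == v then (pos a).*2.+1 else (pos x).*2); first exact: shift_inj.
  move=> x y z w exy ezw.
  have [xv|xv] := eqVneq x v; have [yv|yv] := eqVneq y v;
    have [zv|zv] := eqVneq z v; have [wv|wv] := eqVneq w v; subst; try lia.
  all: rewrite ?(Na _ exy) ?(Na _ ezw) ?(Na x (etrans (es _ _) exy))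
         ?(Na z (etrans (es _ _) ezw)); try lia.
  by rewrite !ltn_double; apply: (nc x y z w); rewrite /e' /= ?xv ?yv ?zv ?wv.
pose e' : rel T := [rel x y | [&& x != v, y != v & e x y] || [|| (x == a) && (y == b) | (x == b) && (y == a)]].
have av : a != v by apply: contraTneq va => ->; rewrite ei.
have bv : b != v by apply: contraTneq vb => ->; rewrite ei.
have e'v x y : e' x y -> x != v /\ y != v.
  by case/orP => [/and3P[]|/orP[] /andP[/eqP-> /eqP->]].
have e'e x y : e' x y -> e x y \/ ((x = a /\ y = b) \/ (x = b /\ y = a)).
  by case/orP => [/and3P[]|/orP[] /andP[/eqP-> /eqP->]]; auto.
have e'r x y : x != v -> y != v -> e x y -> e' x y by rewrite /e' /= => -> -> ->.
have e's : symmetric e'.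
  move=> x y; rewrite /e' /= es [in RHS]andbCA; congr (_ || _).
  by rewrite orbC andbC [(x == a) && _]andbC.
have e'i : irreflexive e'.
  move=> x; rewrite /e' /= ei !andbF /=; apply/negbTE; rewrite negb_or.
  apply/andP; split; apply/negP => /andP[/eqP-> E]; first by rewrite E in ab.
  by rewrite eq_sym E in ab.
have hh4 i : exists j, K4 i j || K4 j i.
  exists (if i == ord0 then ord_max else ord0); rewrite /K4.
  by case: ifP => [/eqP ->|/negbT ->].
have hh5 i : exists j, K23 i j || K23 j i.
  rewrite /K23; exists (if i < 2 then ord_max else ord0).
  by case: (ltnP i 2) => i2; rewrite /= ?orbT.
have [||||pos pI nc] := IH e' e's e'i (S :\ v).
- move=> x y xy; have [xv yv] := e'v x y xy; rewrite !inE xv yv /=.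
  have [aS bS] : a \in S /\ b \in S by case/andP: (eS _ _ va) (eS _ _ vb) => _ -> /andP[].
  by case: (e'e x y xy) => [/eS //|[] [-> ->]]; rewrite aS bS.
- exact: Sv.
- by move/(bypass_minor es ei hh4 va vb).
- by move/(bypass_minor es ei hh5 va vb).
have e'ab : e' a b by rewrite /e' /= !eqxx orbT.
clearbody e'.
(* The slot [tau] lies under the edge [c d], and every edge over [tau] spans both [c] and [d], so
   the two edges at [v] cross nothing. *)
have finish q c d tau : injective q -> noncrossing e' q -> e' c d -> q c < q d ->
    (forall w, e v w -> w = c \/ w = d) -> q c <= tau < q d ->
    (forall x y, e' x y -> q x <= tau < q y -> (q x <= q c) && (q d <= q y)) ->
    exists2 pos, injective pos & noncrossing e pos.
  move=> qI qnc cd qcd Ncd tauP sep.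
  pose f x := if x == v then tau.*2.+1 else (q x).*2.
  exists f; first exact: shift_inj.
  have [cv dv'] := e'v _ _ cd.
  have fv : f v = tau.*2.+1 by rewrite /f eqxx.
  have fn x : x != v -> f x = (q x).*2 by rewrite /f => /negbTE ->.
  have neq x y : f x < f y -> x != y.
    by move=> xy; apply: contraTneq xy => ->; rewrite ltnn.
  move=> x y z w exy ezw h1 h2 h3.
  have n1 := neq _ _ h1; have n2 := neq _ _ h2; have n3 := neq _ _ h3.
  have n4 := neq _ _ (ltn_trans h1 h2); have n5 := neq _ _ (ltn_trans h2 h3).
  have n6 := neq _ _ (ltn_trans h1 (ltn_trans h2 h3)).
  have [xv|xv] := eqVneq x v.
    rewrite xv in exy h1 n1 n4 n6.
    rewrite eq_sym in n1; rewrite eq_sym in n4; rewrite eq_sym in n6.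
    have sp := qnc _ _ _ _ cd (e'r _ _ n1 n6 ezw).
    rewrite fv fn // in h1; rewrite !fn // in h2; rewrite !fn // in h3.
    case: (Ncd _ exy) => yE; subst y; first by clear -tauP h1 h2; lia.
    by apply: sp; clear -tauP h1 h2 h3; lia.
  have [yv|yv] := eqVneq y v.
    rewrite yv in exy h2 h3 n2 n3; rewrite eq_sym in n3.
    have sp := sep _ _ (e'r _ _ n2 n3 ezw); rewrite es in exy.
    rewrite !fn // in h1; rewrite fv fn // in h2; rewrite fv fn // in h3.
    case: (Ncd _ exy) => yE; subst x; last by clear -tauP h1 h2; lia.
    have /sp : q z <= tau < q w by clear -h2 h3; lia.
    by clear -h1; lia.
  have sp1 := sep _ _ (e'r _ _ xv yv exy).
  have sp2 := qnc _ _ _ _ (e'r _ _ xv yv exy) cd.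
  have [zv|zv] := eqVneq z v.
    rewrite zv in ezw h1 h2; have wv : w != v by rewrite -zv eq_sym.
    rewrite fv fn // in h1; rewrite fv fn // in h2; rewrite !fn // in h3.
    case: (Ncd _ ezw) => wE; subst w; first by clear -tauP h2 h3; lia.
    have /sp1 : q x <= tau < q y by clear -h1 h2; lia.
    by clear -h3; lia.
  have [wv|wv] := eqVneq w v.
    rewrite wv es in ezw; rewrite wv in h3.
    rewrite !fn // in h1; rewrite !fn // in h2; rewrite fv fn // in h3.
    case: (Ncd _ ezw) => zE; subst z; last by clear -tauP h2 h3; lia.
    by apply: sp2; clear -tauP h1 h2 h3; lia.
  rewrite !fn // in h1; rewrite !fn // in h2; rewrite !fn // in h3.
  apply: (qnc x y z w (e'r _ _ xv yv exy) (e'r _ _ zv wv ezw)).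
  - by clear -h1; lia.
  - by clear -h2; lia.
  - by clear -h3; lia.
have key c d : e' c d -> pos c < pos d -> e v c -> e v d ->
    (forall w, e v w -> w = c \/ w = d) -> exists2 pos, injective pos & noncrossing e pos.
  move=> cd pcd vc vd Ncd.
  pose I := [set x | pos c < pos x < pos d].
  case: (boolP [exists y in I, exists x in I, [&& e' c y, connect (rest e' I) y x & e' d x]]); last first.
    rewrite negb_exists_in => /forall_inP nl.
    have [|tau tP sep] := noncrossing_slot (I := I) e's pI nc cd pcd erefl.
      move=> y x yI cy yx; apply/negP => dx; have := nl y yI; rewrite negb_exists_in.
      have xI := component_sub yI yx.
      by move/forall_inP => /(_ x xI); rewrite cy yx dx.
    exact: (finish pos c d tau).
  case/exists_inP => y1 y1I /exists_inP[x1 x1I /and3P[cy1 yx1 dx1]].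
  (* The inner side of [c d] is blocked. Rotating the order so that it starts at [d] turns the outer
     side into the interval from [d] to [c], where a slot is sought in the same way. *)
  pose q x := if pos d <= pos x then pos x else pos x + (\max_y pos y).+1.
  have qI : injective q by exact: noncrossing_rot_inj.
  have qnc : noncrossing e' q by exact: noncrossing_rot.
  have M t : pos t <= \max_y pos y by apply: leq_bigmax.
  have qd : q d = pos d by rewrite /q leqnn.
  have qc : q c = pos c + (\max_y pos y).+1 by rewrite /q ifN // -ltnNge.
  have qdc : q d < q c.
    by rewrite qd qc; have := M d; clear; lia.
  pose I' := [set x | q d < q x < q c].
  have dc : e' d c by rewrite e's.
  case: (boolP [exists y in I', exists x in I', [&& e' d y, connect (rest e' I') y x & e' c x]]); last first.
    rewrite negb_exists_in => /forall_inP nl.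
    have [|tau tP sep] := noncrossing_slot (I := I') e's qI qnc dc qdc erefl.
      move=> y x yI cy yx; apply/negP => dx; have := nl y yI; rewrite negb_exists_in.
      have xI := component_sub yI yx.
      by move/forall_inP => /(_ x xI); rewrite cy yx dx.
    by apply: (finish q d c tau) => // w /Ncd[]; [right|left].
  case/exists_inP => y2 y2I /exists_inP[x2 x2I /and3P[dy2 yx2 cx2]].
  (* Each side of [c d] contains a component touching both [c] and [d]. Together with [v] these are
     the three branch sets opposite to [c] and [d]. *)
  exfalso; apply: nK23.
  pose C1 := [set z | connect (rest e' I) y1 z].
  pose C2 := [set z | connect (rest e' I') y2 z].
  have II x : (x \in I) = (pos c < pos x < pos d) by rewrite inE.
  have II' x : x \in I' -> pos x < pos c \/ pos d < pos x.
    by rewrite inE qd qc /q; have := M d; have := M x; clear; case: (leqP (pos d) (pos x)); lia.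
  have [vcn vdn] := e'v _ _ cd.
  have cdn : c != d by apply: contraTneq pcd => ->; rewrite ltnn.
  have loc (J : {set T}) : c \notin J -> d \notin J ->
      {in J &, forall x y, e' x y -> e x y}.
    move=> cJ dJ x y xJ yJ /e'e[//|] [] [xE yE]; subst x y.
      by case: (Ncd _ va) => aE; move: cJ dJ; rewrite -aE xJ.
    by case: (Ncd _ va) => aE; move: cJ dJ; rewrite -aE yJ.
  have [cI dI] : c \notin I /\ d \notin I by rewrite !II !ltnn andbF.
  have [cI' dI'] : c \notin I' /\ d \notin I'.
    by split; apply/negP => /II'; clear -pcd; lia.
  have CJ (J : {set T}) y : y \in J -> e' c y \/ e' d y -> c \notin J -> d \notin J ->
      let C := [set z | connect (rest e' J) y z] in
      [/\ y \in C, C \subset J, v \notin C & conn_set e C].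
    move=> yJ ey cJ dJ C; split.
    - by rewrite inE.
    - by apply/fintype.subsetP => z; rewrite inE; apply: component_sub.
    - rewrite inE; apply/negP => /connect_last[vy|[u /and3P[uv _ _]]].
        by case: ey => /e'v[_]; rewrite -vy eqxx.
      by have [_] := e'v _ _ uv; rewrite eqxx.
    - have CJ : {subset C <= J} by move=> z; rewrite inE; apply: component_sub.
      have sub : subrel (rest e' C) (connect (rest e C)).
        move=> x z /and3P[xz xC zC]; apply: connect1; apply/and3P; split => //.
        by apply: (loc J) => //; apply: CJ.
      move=> x z xC zC; apply: (connect_sub sub).
      exact: (component_conn e's xC zC).
  have [y1C C1I vC1 cC1] := CJ _ _ y1I (or_introl cy1) cI dI.
  have [y2C C2I vC2 cC2] := CJ _ _ y2I (or_intror dy2) cI' dI'.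
  rewrite -/C1 -/C2 in y1C C1I vC1 cC1 y2C C2I vC2 cC2.
  have y1x1 : x1 \in C1 by rewrite inE.
  have y2x2 : x2 \in C2 by rewrite inE.
  clearbody C1 C2.
  have eI (J : {set T}) u y : u = c \/ u = d -> y \in J -> c \notin J -> d \notin J -> e' u y -> e u y.
    move=> ucd yJ cJ dJ uy; case: (e'e _ _ uy) => // -[] [_ yE]; subst y.
      by case: (Ncd _ vb) => bE; move: cJ dJ; rewrite -bE yJ.
    by case: (Ncd _ va) => bE; move: cJ dJ; rewrite -bE yJ.
  have nin (J C : {set T}) u : C \subset J -> u \notin J -> u \notin C.
    by move=> CJ'; apply: contra; apply: (fintype.subsetP CJ').
  have II'0 : [disjoint C1 & C2].
    rewrite -setI_eq0; apply/eqP/setP => z; rewrite in_set0 in_setI; apply/negbTE/negP.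
    case/andP => /(fintype.subsetP C1I) zI /(fintype.subsetP C2I) /II'.
    by move: zI; rewrite II; clear; lia.
  have cv' : c != v by []; have dv' : d != v by [].
  apply: (K23_intro (A0 := [set c]) (A1 := [set d]) (B0 := [set v]) (B1 := C1) (B2 := C2)).
  - rewrite /= andbT; apply/and5P; split; apply/set0Pn; [exists c|exists d|exists v|by exists y1|by exists y2];
    by rewrite inE.
  - move=> B; rewrite !in_cons orbF.
    by case/or4P=> [/eqP->|/eqP->|/eqP->|/orP[]/eqP->] //; exact: conn_set1.
  - rewrite /= !andbT !disjoints1 !inE (nin _ _ _ C1I cI) (nin _ _ _ C2I cI') (nin _ _ _ C1I dI)
      (nin _ _ _ C2I dI') vC1 vC2 II'0 cdn cv' dv'.
    by [].
  - move=> B; rewrite !in_cons orbF => /or3P[]/eqP->; split.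
    + by exists c, v; rewrite !inE es.
    + by exists d, v; rewrite !inE es.
    + by exists c, y1; split; rewrite ?inE //; apply: (eI I) => //; left.
    + exists d, x1; split; rewrite ?inE //.
      by apply: (eI I) => //; right.
    + exists c, x2; split; rewrite ?inE //.
      by apply: (eI I') => //; left.
    + by exists d, y2; split; rewrite ?inE //; apply: (eI I') => //; right.
case: (ltngtP (pos a) (pos b)) => [pab|pba|/pI abE]; last by rewrite abE eqxx in ab.
- exact: key e'ab pab va vb Nab.
- by apply: (key b a) => //; [rewrite e's|move=> w /Nab[]; [right|left]].
Qed.
End NonCrossing.

(** * Breadth-first numbering of bipartite noncrossing graphs *)

(* Vertices are numbered from 1. The lower neighbours of [x] are [p x] and, when
   [link x] holds, also [(p x).+1]; [p x = 0] stands for no lower neighbour. *)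
Definition staircase (T : finType) (e : rel T) (num p : T -> nat) (link : T -> bool) :=
  [/\ injective num, forall x, 0 < num x <= #|T|, forall x, p x < num x,
      forall x y, num x < num y -> p x + link x <= p y &
      forall x y, num y < num x ->
        e x y = (num y == p x) || link x && (num y == (p x).+1)].

Section Levels.
Variables (T : finType) (e : rel T) (pos : T -> nat) (col : T -> bool).
Hypotheses (es : symmetric e) (ei : irreflexive e) (posI : injective pos)
  (nc : noncrossing e pos) (col_e : forall x y, e x y -> col x != col y).

(* Each component is rooted at its first vertex; [lev] is the distance to it. *)
Definition rep x := [arg min_(y < x | connect e x y) pos y].

Let cs : connect_sym e. Proof. exact: sym_connect_sym. Qed.

Lemma repP x : connect e x (rep x) /\ forall y, connect e x y -> pos (rep x) <= pos y.
Proof. by rewrite /rep; case: arg_minnP. Qed.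

Lemma rep_connect x y : connect e x y -> rep x = rep y.
Proof.
move=> xy; have [xr mx] := repP x; have [yr my] := repP y; apply: posI.
apply/eqP; rewrite eqn_leq mx ?my //; last exact: connect_trans xy yr.
by apply: connect_trans xr; rewrite cs.
Qed.

Definition walk n x := [exists p : n.-tuple T, path e (rep x) p && (last (rep x) p == x)].

Lemma walkP n x : reflect (exists p, [/\ size p = n, path e (rep x) p & last (rep x) p = x]) (walk n x).
Proof.
apply: (iffP existsP) => [[p /andP[pp /eqP lp]]|[p [sp pp lp]]].
  by exists p; rewrite size_tuple.
by exists (tcast sp (in_tuple p)); rewrite val_tcast /= pp lp eqxx.
Qed.

Lemma walk_ex x : exists n, walk n x.
Proof.
have [+ _] := repP x; rewrite cs => /connectP[p pp lp].
by exists (size p); apply/walkP; exists p.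
Qed.

Definition lev x := ex_minn (walk_ex x).

Lemma lev_walk x : walk (lev x) x. Proof. by rewrite /lev; case: ex_minnP. Qed.
Lemma lev_min n x : walk n x -> lev x <= n.
Proof. by rewrite /lev; case: ex_minnP => m _; apply. Qed.

Lemma lev_edge x y : e x y -> lev y <= (lev x).+1.
Proof.
move=> xy; apply: lev_min; apply/walkP; have /walkP[p [sp pp lp]] := lev_walk x.
exists (rcons p y); rewrite size_rcons sp rcons_path last_rcons.
by rewrite -(rep_connect (connect1 xy)) pp lp xy.
Qed.

Lemma lev_parent x : 0 < lev x -> exists2 y, e x y & lev x = (lev y).+1.
Proof.
have /walkP[p [sp pp lp]] := lev_walk x.
case/lastP: p sp pp lp => [<- //|p z].
rewrite size_rcons rcons_path last_rcons => sp /andP[pp lz] zx _; rewrite zx in lz.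
have xl : e x (last (rep x) p) by rewrite es.
exists (last (rep x) p) => //.
apply/eqP; rewrite eqn_leq (lev_edge lz) /= -sp ltnS.
apply: lev_min; apply/walkP; exists p; split => //;
  by rewrite -(rep_connect (connect1 xl)).
Qed.

Lemma lev0 x : lev x = 0 -> x = rep x.
Proof.
by have /walkP[p [sp pp lp]] := lev_walk x => l0; case: p {pp} sp lp; rewrite l0.
Qed.

Lemma lev_col x : col x = col (rep x) (+) odd (lev x).
Proof.
move E : (lev x) => n; elim: n x E => [|n IH] x E.
  by rewrite [in LHS](lev0 E) addbF.
have [|y xy] := @lev_parent x; first by rewrite E.
rewrite E => -[/esym/IH]; rewrite -(rep_connect (connect1 xy)) /=.
by have := col_e xy; case: (col x); case: (col y); case: (col (rep x)); case: (odd n).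
Qed.

(** Bipartiteness excludes equal levels: within a component the colour is given by the parity of the
    level. *)
Lemma lev_adj x y : e x y -> lev x = (lev y).+1 \/ lev y = (lev x).+1.
Proof.
move=> xy; have h1 := lev_edge xy.
have h2 : lev x <= (lev y).+1 by apply: lev_edge; rewrite es.
case: (ltngtP (lev x) (lev y)) => h; [right; lia|left; lia|].
have := col_e xy; rewrite (lev_col x) (lev_col y) h.
by rewrite (rep_connect (connect1 xy)) eqxx.
Qed.

(** Climb from [z] towards the root. The root is the first vertex of its component, so it is not
    strictly inside the span of [x y]; as edges do not cross, the climb leaves this span through [x]
    or [y], which is therefore on a smaller level. *)
Lemma enclosed x y z : e x y -> rep z = rep x -> pos x < pos z < pos y ->
  minn (lev x) (lev y) < lev z.
Proof.
move=> exy; move E : (lev z) => n; elim: n z E => [|n IH] z E rz /andP[xz zy].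
  have [_ /(_ x)] := repP z; rewrite -(lev0 E) => H.
  suff /H : connect e z x by lia.
  have [zr _] := repP z; apply: connect_trans zr _.
  by rewrite rz cs; have [] := repP x.
have [|w zw] := @lev_parent z; first by rewrite E.
rewrite E => -[lw]; have rw : rep w = rep x by rewrite -rz (rep_connect (connect1 zw)).
case: (ltngtP (pos w) (pos x)) => [wx|xw|/posI wx].
- by exfalso; apply: (nc (x := w) (y := z) (z := x) (w := y)); rewrite // es.
- case: (ltngtP (pos w) (pos y)) => [wy|yw|/posI wy].
  + by have := IH w (esym lw) rw; rewrite xw wy => /(_ isT); lia.
  + by exfalso; apply: (nc (x := x) (y := y) (z := z) (w := w)).
  + by rewrite wy in lw; lia.
- by rewrite wx in lw; lia.
Qed.

(* Encodes the lexicographic order on (level, component, position). *)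
Definition base := (\max_y pos y).+1.
Definition key x := (lev x * base + pos (rep x)) * base + pos x.

Lemma keyP x y : reflect [\/ lev x < lev y, lev x = lev y /\ pos (rep x) < pos (rep y) |
    [/\ lev x = lev y, rep x = rep y & pos x < pos y]] (key x < key y).
Proof.
have M t : pos t < base by rewrite ltnS leq_bigmax.
have lex (a b c d : nat) : b < base -> d < base ->
    (a * base + b < c * base + d) = (a < c) || (a == c) && (b < d).
  move: base => B bb db; case: (ltngtP a c) => ac /=.
  - by nia.
  - by apply/negbTE; rewrite -leqNgt; nia.
  - by rewrite ac ltn_add2l.
have M2 t : lev t * base + pos (rep t) < (lev t).+1 * base by rewrite mulSnr ltn_add2l.
have lex2 : (key x < key y) = (lev x * base + pos (rep x) < lev y * base + pos (rep y)) ||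
   (lev x * base + pos (rep x) == lev y * base + pos (rep y)) && (pos x < pos y).
  by rewrite /key lex.
have eq2 : (lev x * base + pos (rep x) == lev y * base + pos (rep y)) =
   (lev x == lev y) && (pos (rep x) == pos (rep y)).
  apply/eqP/andP => [H|[/eqP -> /eqP ->] //].
  have h1 := lex (lev x) (pos (rep x)) (lev y) (pos (rep y)) (M _) (M _).
  have h2 := lex (lev y) (pos (rep y)) (lev x) (pos (rep x)) (M _) (M _).
  by rewrite H ltnn in h1 h2; lia.
rewrite lex2 eq2 lex //; apply: (iffP idP) => [/orP[/orP[h|/andP[/eqP h1 h2]]|]|].
- exact: Or31.
- exact: Or32.
- by case/andP=> /andP[/eqP h1 /eqP/posI h2] h3; apply: Or33.
- by case=> [->//|[-> ->]|[-> -> ->]]; rewrite ?eqxx ?orbT.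
Qed.

Lemma keyI : injective key.
Proof.
move=> x y kxy; apply: posI; have := keyP x y; have := keyP y x; rewrite kxy ltnn.
move=> /elimF H1 /elimF H2; have {}H1 := H1 erefl; have {}H2 := H2 erefl.
have l : lev x = lev y.
  by case: (ltngtP (lev x) (lev y)) => // h; [case: H2|case: H1]; apply: Or31.
have r : rep x = rep y.
  apply: posI.
  by case: (ltngtP (pos (rep x)) (pos (rep y))) => // h; [case: H2|case: H1]; apply: Or32.
by case: (ltngtP (pos x) (pos y)) => // h; [case: H2|case: H1]; apply: Or33.
Qed.

Definition low y x := e x y && (lev y < lev x).

Lemma lowP y x : low y x -> [/\ e x y, lev x = (lev y).+1 & rep y = rep x].
Proof.
case/andP => xy l; split => //; last by rewrite (rep_connect (connect1 xy)).
by case: (lev_adj xy) l => -> //; rewrite ltnNge leqnSn.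
Qed.

Lemma low_key y x : low y x -> key y < key x.
Proof. by case/lowP => _ l _; apply/keyP; apply: Or31; rewrite l. Qed.

Lemma edge_low y x : e x y -> key y < key x -> low y x.
Proof.
move=> xy k; rewrite /low xy /=; case/lev_adj: (xy) => l; first by rewrite l.
have /low_key : low x y by rewrite /low es xy l ltnSn.
by rewrite ltnNge (ltnW k).
Qed.

(** In the one case not settled by levels and components, [enclosed] keeps [v] and [v'], the ends on
    the smaller level, out of the span of the other edge. If [v'] came before [v], this would leave
    the order [v'], [u], [u'], [v], which is a crossing. *)
Lemma low_mono u u' v v' : low v u -> low v' u' -> key u < key u' -> key v <= key v'.
Proof.
move=> /lowP[uv luv ruv] /lowP[u'v' luv' ruv'] /keyP k.
rewrite leqNgt; apply/negP => /keyP k'.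
case: k k' => [l|[l r]|[l r p]]; rewrite ?luv ?luv' in l; case => [l'|[l' r']|[l' r' p']]; try lia.
- by rewrite ruv ruv' in r'; lia.
- by rewrite r' ruv in ruv'; rewrite -ruv' in r; lia.
- by rewrite ruv ruv' r in r'; lia.
have rv : rep v = rep u by []; have rv' : rep v' = rep u by rewrite ruv' r.
have nuv := enclosed (z := v') uv; have nvu := enclosed (x := v) (y := u) (z := v').
have nuv' := enclosed (z := v) u'v'; have nvu' := enclosed (x := v') (y := u') (z := v).
rewrite es uv in nvu; rewrite es u'v' in nvu'.
rewrite rv rv' -?r in nuv nvu nuv' nvu'.
have {}nuv := nuv erefl; have {}nvu := nvu isT erefl.
have {}nuv' := nuv' erefl; have {}nvu' := nvu' isT erefl.
have cr := nc (x := v') (y := u') (z := u) (w := v).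
rewrite es u'v' uv in cr; have {}cr := cr isT isT.
have d1 : pos v != pos u' by apply/eqP => /posI E; rewrite E in l; lia.
have d2 : pos v' != pos u by apply/eqP => /posI E; rewrite E in l luv'; lia.
lia.
Qed.

(** Wherever [u] lies, [w] is inside the span of [u v] or of [u v'], so [enclosed] puts it on a
    deeper level. Since [w] may itself be a lower neighbour of [u], this also shows that there are
    at most two of them. *)
Lemma low_consecutive u v v' w : low v u -> low v' u -> key v < key w -> key w < key v' -> False.
Proof.
move=> /lowP[uv luv ruv] /lowP[uv' luv' ruv'] /keyP k /keyP k'.
have l : lev v = lev v' by lia.
case: k k' => [h|[h r]|[h r p]]; case => [h'|[h' r']|[h' r' p']]; try lia.
- by move: r r'; rewrite ruv ruv'; lia.
- by move: r; rewrite r' ruv ruv' ltnn.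
- by move: r'; rewrite -r ruv ruv' ltnn.
have nuv := enclosed (z := w) uv; have nvu := enclosed (x := v) (y := u) (z := w).
have nuv' := enclosed (z := w) uv'; have nvu' := enclosed (x := v') (y := u) (z := w).
rewrite es uv in nvu; rewrite es uv' in nvu'.
rewrite -r ruv ?ruv' in nuv nvu nuv' nvu'.
have {}nuv := nuv erefl; have {}nvu := nvu isT erefl.
have {}nuv' := nuv' erefl; have {}nvu' := nvu' isT erefl.
have d : pos w != pos u by apply/eqP => /posI E; rewrite E in h h'; lia.
lia.
Qed.

Definition num x := #|[set y | key y <= key x]|.

Lemma num_lt x y : (num x < num y) = (key x < key y).
Proof.
have S a b : key a <= key b -> num a <= num b.
  move=> ab; apply: subset_leq_card; apply/fintype.subsetP => z; rewrite !inE => /leq_trans; exact.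
apply/idP/idP; first by apply: contraLR; rewrite -!leqNgt; apply: S.
move=> xy; apply: proper_card; apply/properP; split.
  by apply/fintype.subsetP => z; rewrite !inE => /leq_trans; apply; apply: ltnW.
by exists y; rewrite !inE // -ltnNge.
Qed.

Lemma numI : injective num.
Proof.
by move=> x y xy; apply: keyI; case: (ltngtP (key x) (key y)) => //; rewrite -num_lt xy ltnn.
Qed.

Lemma num_succ x y : key x < key y -> (forall z, key x < key z -> key z < key y -> False) ->
  num y = (num x).+1.
Proof.
move=> xy nz; rewrite /num (cardsD1 y) inE leqnn add1n; congr _.+1.
apply: eq_card => z; rewrite !inE; apply/andP/idP => [[zy kz]|kz].
  rewrite leqNgt; apply/negP => xz; apply: (nz z xz).
  by rewrite ltn_neqAle kz andbT; apply: contra zy => /eqP/keyI ->.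
split; last by apply: ltnW; apply: leq_ltn_trans kz xy.
by apply: contraTneq kz => ->; rewrite -ltnNge.
Qed.

Definition par x := if [pick y | low y x] is Some y0
  then num [arg min_(y < y0 | low y x) key y] else 0.
Definition link x := [exists y, [exists z, [&& low y x, low z x & y != z]]].

Lemma parP x : (par x = 0 /\ forall y, ~~ low y x) \/
  (exists m, [/\ low m x, par x = num m & forall y, low y x -> key m <= key y]).
Proof.
rewrite /par; case: pickP => [y0 ly|nl]; last by left; split => // y; rewrite nl.
by right; case: arg_minnP => // m lm mm; exists m.
Qed.

Theorem bipartite_staircase : staircase e num par link.
Proof.
have num0 x : 0 < num x by apply/card_gt0P; exists x; rewrite inE.
have lk x y z : low y x -> low z x -> key y < key z -> num z = (num y).+1.
  move=> ly lz yz; apply: num_succ => // w; exact: low_consecutive ly lz.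
have lowE x y : low y x = (num y == par x) || link x && (num y == (par x).+1).
  case: (parP x) => [[-> nl]|[m [lm -> mm]]].
    rewrite (negbTE (nl y)) eqn0Ngt num0 /=; apply/esym/negbTE/negP => /andP[].
    by case/existsP => z /existsP[t /and3P[lz _ _]] _; have := nl z; rewrite lz.
  apply/idP/idP => [ly|].
    have := mm _ ly; rewrite leq_eqVlt => /predU1P[/keyI -> |my]; first by rewrite eqxx.
    rewrite (lk _ _ _ lm ly my) eqxx andbT; apply/orP; right.
    apply/existsP; exists m; apply/existsP; exists y; rewrite lm ly /=.
    by apply: contraTneq my => ->; rewrite ltnn.
  case/orP => [/eqP/numI -> //|/andP[/existsP[a /existsP[b /and3P[la lb ab]]] /eqP ny]].
  have [d [ld dm]] : exists d, low d x /\ d != m.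
    have [am|am] := eqVneq a m; last by exists a.
    by exists b; rewrite lb eq_sym -am.
  suff -> : y = d by [].
  apply: numI; rewrite ny (lk _ _ _ lm ld) //.
  by rewrite ltn_neqAle mm // andbT; apply: contra dm => /eqP/keyI ->.
split.
- exact: numI.
- by move=> x; rewrite num0 max_card.
- move=> x; case: (parP x) => [[-> _]|[m [lm -> _]]]; first exact: num0.
  by rewrite num_lt; apply: low_key.
- move=> x y; rewrite num_lt => xy.
  case: (parP x) => [[-> nl]|[m [lm pm mm]]].
    suff -> : link x = false by [].
    apply/negbTE/negP => /existsP[z /existsP[t /and3P[lz _ _]]].
    by have := nl z; rewrite lz.
  have [y' ly'] : exists y', low y' y.
    have [|w yw lw] := @lev_parent y.
      have [_ lx _] := lowP lm; case/keyP: xy => [|[<- _]|[<- _ _]]; lia.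
    by exists w; rewrite /low yw lw ltnSn.
  case: (parP y) => [[_ nl]|[m' [lm' pm' mm']]]; first by have := nl y'; rewrite ly'.
  (* [d] is the last lower neighbour of [x]; [low_mono] compares it with the first lower neighbour
     of [y]. *)
  have [d [ld dE]] : exists d, low d x /\ num d = par x + link x.
    case E : (link x); last by exists m; rewrite addn0.
    case/existsP : (E) => a /existsP[b /and3P[la lb ab]].
    have [am|am] := eqVneq a m.
      exists b; split => //; rewrite addn1 pm; apply: (lk x) => //.
      by rewrite ltn_neqAle mm // andbT; apply: contra ab => /eqP/keyI <-; rewrite am.
    exists a; split => //; rewrite addn1 pm; apply: (lk x) => //.
    by rewrite ltn_neqAle mm // andbT; apply: contra am => /eqP/keyI <-.
  by rewrite -dE pm' leqNgt num_lt -leqNgt; apply: (low_mono ld lm' xy).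
- move=> x y; rewrite num_lt => yx; rewrite -lowE.
  by apply/idP/idP => [xy|/andP[]//]; apply: edge_low.
Qed.
End Levels.

From mathcomp Require Import all_classical all_reals all_analysis.
Import Order.TTheory GRing.Theory Num.Theory.
Import numFieldNormedType.Exports.

(** * Parity of crossings *)

Local Open Scope ring_scope.

Section Orientation.
Variable R : realFieldType.
Implicit Types a b c d v p q : R * R.

Definition det3 a b c : R :=
  (b.1 - a.1) * (c.2 - a.2) - (b.2 - a.2) * (c.1 - a.1).
Definition ccw a b c : bool := 0 < det3 a b c.

Definition crosses a b c d : bool :=
  (ccw a b c (+) ccw a b d) && (ccw c d a (+) ccw c d b).
Definition inside v a b c : bool :=
  (ccw v a b == ccw v b c) && (ccw v b c == ccw v c a).

Lemma det3_rot a b c : det3 b c a = det3 a b c.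
Proof. by rewrite /det3; ring. Qed.
Lemma det3_swap a b c : det3 b a c = - det3 a b c.
Proof. by rewrite /det3; ring. Qed.

Lemma ccw_rot a b c : ccw b c a = ccw a b c.
Proof. by rewrite /ccw det3_rot. Qed.
Lemma ccw_swap a b c : det3 a b c != 0 -> ccw b a c = ~~ ccw a b c.
Proof. by rewrite /ccw det3_swap; case: ltrgt0P => //; lra. Qed.

(** The signed areas satisfy [bcd + abd = acd + abc], so the two sides cannot consist of terms of
    opposite signs. *)
Lemma ccw_affine a b c d : det3 a b c != 0 -> det3 a b d != 0 ->
  det3 a c d != 0 -> det3 b c d != 0 ->
  ~~ [&& ccw b c d == ccw a b d, ccw a c d == ccw a b c
       & ccw b c d != ccw a c d].
Proof.
have E : det3 b c d - det3 a c d + det3 a b d - det3 a b c = 0.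
  by rewrite /det3; ring.
rewrite /ccw.
by case: (ltrgt0P (det3 a b c)); case: (ltrgt0P (det3 a b d));
   case: (ltrgt0P (det3 a c d)); case: (ltrgt0P (det3 b c d)) => //=; lra.
Qed.

(** The sign form of the three-term Grassmann-Pluecker relation: if the products [vab * vcd] and
    [vad * vbc] have the same sign, then [vac * vbd], being their sum, has it too. *)
Lemma ccw_plucker v a b c d : det3 v a b != 0 -> det3 v a c != 0 ->
  det3 v a d != 0 -> det3 v b c != 0 -> det3 v b d != 0 -> det3 v c d != 0 ->
  ~~ [&& (ccw v a b == ccw v c d) == (ccw v a d == ccw v b c)
       & (ccw v a b == ccw v c d) != (ccw v a c == ccw v b d)].
Proof.
have E : det3 v a b * det3 v c d - det3 v a c * det3 v b d
       + det3 v a d * det3 v b c = 0 by rewrite /det3; ring.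
move: E; rewrite /ccw.
move: (det3 v a b) (det3 v c d) (det3 v a c) (det3 v b d) (det3 v a d)
  (det3 v b c) => x1 x2 y1 y2 z1 z2 E.
have pos (s t : R) : s != 0 -> t != 0 ->
    ((0 < s) == (0 < t)) = (0 < s * t) /\ s * t != 0.
  move=> s0 t0; split; last by rewrite mulf_neq0.
  case: (ltrgt0P s) s0 => // hs _; case: (ltrgt0P t) t0 => // ht _; symmetry.
  - by rewrite mulr_gt0.
  - by apply/negbTE; rewrite -leNgt; nra.
  - by apply/negbTE; rewrite -leNgt; nra.
  - by rewrite -mulrNN mulr_gt0 ?oppr_gt0.
move=> n1 n2 n3 n4 n5 n6.
have [-> m1] := pos _ _ n1 n6; have [-> m2] := pos _ _ n2 n5.
have [-> m3] := pos _ _ n3 n4.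
move: m1 m2 m3 E.
move: (x1 * x2) (y1 * y2) (z1 * z2) => x y z.
by case: (ltrgt0P x); case: (ltrgt0P y); case: (ltrgt0P z) => //=; lra.
Qed.
End Orientation.

(** Quantification over [bool] as a computation, so that a single [vm_compute] checks all 2^10 sign
    patterns below. *)
Definition both (P : pred bool) := P true && P false.
Lemma bothP (P : pred bool) : both P -> forall b, P b.
Proof. by case/andP=> Pt Pf []. Qed.

Ltac destruct_uniq u :=
  move: (u); rewrite /= ?inE ?negb_or ?andbT;
  repeat match goal with
  | |- is_true (_ && _) -> _ => case/andP
  | |- is_true _ -> is_true _ -> _ => let h := fresh "u" in move=> h
  | |- is_true _ -> _ => let h := fresh "u" in move=> h
  end.

Ltac solve_uniq :=
  match goal with |- is_true (uniq _) => idtac | |- is_true (_ && _) => idtac end;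
  rewrite /= ?inE ?negb_or ?andbT;
  repeat match goal with |- is_true (_ && _) => apply/andP; split end;
  solve [assumption | rewrite eq_sym; assumption].

Lemma big_addb_odd (T : Type) (r : seq T) (F : T -> bool) :
  \big[addb/false]_(u <- r) F u = odd (\sum_(u <- r) F u)%N.
Proof. by elim: r => [|x r IH]; rewrite ?big_nil // !big_cons IH oddD oddb. Qed.

(** [H] says that a sum of bits is even. Naming its half turns this and the parity relations in the
    context into linear equations over the integers, which [lia] refutes. *)
Ltac parity H :=
  have := even_halfK (negbT H); rewrite ?addbF; clear H;
  repeat match goal with |- context[nat_of_bool ?b] =>
    let x := fresh "x" in move: (nat_of_bool b) => x end;
  match goal with |- context[half ?b] => move: (half b) end;
  repeat match goal with x := _ |- _ => clear x | x : is_true _ |- _ => clear x end; intros; exfalso; lia.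

Section Generic.
Variables (R : realFieldType) (I : eqType) (f : I -> R * R).

Definition generic := forall i j k : I, uniq [:: i; j; k] ->
  det3 (f i) (f j) (f k) != 0.

Hypothesis Hf : generic.

Local Notation o i j k := (ccw (f i) (f j) (f k)).

Definition cr (i j k l : I) : bool := crosses (f i) (f j) (f k) (f l).
Definition inn (v i j k : I) : bool := inside (f v) (f i) (f j) (f k).

Lemma cr_sym i j k l : cr i j k l = cr k l i j.
Proof. by rewrite /cr /crosses andbC. Qed.

Let o_swap i j k : uniq [:: i; j; k] -> o j i k = ~~ o i j k.
Proof. by move=> u; apply: ccw_swap; apply: Hf. Qed.

Let affine a b c d : uniq [:: a; b; c; d] ->
  ~~ [&& o b c d == o a b d, o a c d == o a b c & o b c d != o a c d].
Proof. by move=> u; destruct_uniq u; apply: ccw_affine; apply: Hf; solve_uniq. Qed.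

Let plucker v a b c d : uniq [:: v; a; b; c; d] ->
  ~~ [&& (o v a b == o v c d) == (o v a d == o v b c)
       & (o v a b == o v c d) != (o v a c == o v b d)].
Proof. by move=> u; destruct_uniq u; apply: ccw_plucker; apply: Hf; solve_uniq. Qed.

Let o_swapr i j k : uniq [:: i; j; k] -> o i k j = ~~ o i j k.
Proof.
move=> w; rewrite -(ccw_rot (f i) (f k)) o_swap ?(ccw_rot (f i)) //.
by rewrite (rot_uniq 1 [:: i; j; k]).
Qed.

(** A segment crosses the boundary of a triangle an odd number of times exactly when one of its ends
    is inside. The conditions [affine] and [plucker] on the signs are all that is needed of the
    plane; the rest is a check of all patterns of the ten orientations. *)
Lemma cr_triangle a b c p q : uniq [:: a; b; c; p; q] ->
  cr a b p q (+) cr b c p q (+) cr a c p q = inn p a b c (+) inn q a b c.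
Proof.
move=> u; destruct_uniq u.
have A1 : uniq [:: a; b; c; p] by solve_uniq.
have A2 : uniq [:: a; b; c; q] by solve_uniq.
have A3 : uniq [:: a; b; p; q] by solve_uniq.
have A4 : uniq [:: a; c; p; q] by solve_uniq.
have A5 : uniq [:: b; c; p; q] by solve_uniq.
have P1 := plucker u.
have P2 : uniq [:: b; a; c; p; q] by solve_uniq.
have P3 : uniq [:: c; a; b; p; q] by solve_uniq.
have P4 : uniq [:: p; a; b; c; q] by solve_uniq.
have P5 : uniq [:: q; a; b; c; p] by solve_uniq.
move: (affine A1) (affine A2) (affine A3) (affine A4) (affine A5) P1
  (plucker P2) (plucker P3) (plucker P4) (plucker P5).
have E i j k : o j k i = o i j k by apply: ccw_rot.
rewrite /cr /inn /crosses /inside.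
rewrite ?(E a b p) ?(E a b q) ?(E a p q) ?(E b p q) ?(E c p q).
rewrite -?(E p a b) -?(E q a b) -?(E p b c) -?(E q b c) -?(E p c a) -?(E q c a).
rewrite -?(E p a q) -?(E p b q) -?(E p c q) -?(E q a p) -?(E q b p) -?(E q c p).
rewrite -?(E c a b) -?(E c a p) -?(E c a q) ?(E a b c) -?(E p a c) -?(E q a c).
rewrite ?(@o_swap a b c) ?(@o_swap a b p) ?(@o_swap a b q); try solve_uniq.
rewrite ?(@o_swap a c p) ?(@o_swap a c q) ?(@o_swap b c p) ?(@o_swap b c q); try solve_uniq.
rewrite ?(@o_swapr a c p) ?(@o_swapr a c q) ?(@o_swapr a p q) ?(@o_swapr b p q) ?(@o_swapr c p q); try solve_uniq.
move: (o a b c) (o a b p) (o a b q) (o a c p) (o a c q) (o b c p) (o b c q)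
  (o a p q) (o b p q) (o c p q) => x0 x1 x2 x3 x4 x5 x6 x7 x8 x9 y0 y1 y2 y3
  y4 y5 y6 y7 y8 y9.
apply/eqP; move: y9; apply/implyP; move: y8; apply/implyP.
move: y7; apply/implyP; move: y6; apply/implyP; move: y5; apply/implyP.
move: y4; apply/implyP; move: y3; apply/implyP; move: y2; apply/implyP.
move: y1; apply/implyP; move: y0; apply/implyP.
move: x9; apply: bothP; move: x8; apply: bothP; move: x7; apply: bothP.
move: x6; apply: bothP; move: x5; apply: bothP; move: x4; apply: bothP.
move: x3; apply: bothP; move: x2; apply: bothP; move: x1; apply: bothP.
by move: x0; apply: bothP; vm_compute.
Qed.

(** The four triangles are the shadow of the faces of a tetrahedron, and a point of the plane is
    covered by an even number of them. *)
Lemma inn_tetrahedron v a b c d : uniq [:: v; a; b; c; d] ->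
  inn v a b c (+) inn v a b d (+) inn v a c d (+) inn v b c d = false.
Proof.
move=> u; destruct_uniq u; move: (plucker u); rewrite /inn /inside.
rewrite (@o_swapr v a c) ?(@o_swapr v a d) ?(@o_swapr v b d); try solve_uniq.
by case: (o v a b); case: (o v a c); case: (o v a d); case: (o v b c);
  case: (o v b d); case: (o v c d).
Qed.

(** Four points are either in convex position, with one crossing, or one of them lies in the
    triangle of the others, with no crossing. *)
Lemma cr_inn_quadruple a b c d : uniq [:: a; b; c; d] ->
  cr a b c d (+) cr a c b d (+) cr a d b c (+)
  (inn a b c d (+) inn b a c d (+) inn c a b d (+) inn d a b c).
Proof.
move=> u; destruct_uniq u; move: (affine u).
have E i j k : o j k i = o i j k by apply: ccw_rot.
have e1 : o c a b = o a b c by rewrite -(E c a b).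
have e2 : o d a b = o a b d by rewrite -(E d a b).
have e3 : o d b c = o b c d by rewrite -(E d b c).
have e4 : o a c b = ~~ o a b c by apply: o_swapr; solve_uniq.
have e5 : o b d c = ~~ o b c d by apply: o_swapr; solve_uniq.
have e6 : o a d b = ~~ o a b d by apply: o_swapr; solve_uniq.
have e7 : o a d c = ~~ o a c d by apply: o_swapr; solve_uniq.
have e8 : o b a c = ~~ o a b c by apply: o_swap; solve_uniq.
have e9 : o c b d = ~~ o b c d by apply: o_swap; solve_uniq.
have e0 : o d c a = ~~ o a c d by rewrite -e7 (E a d c).
rewrite /cr /inn /crosses /inside (E a c d) (E b c d) (E a b d) (E a b c).
rewrite e1 e2 e3 e4 e5 e6 e7 e8 e9 e0.
by case: (o a b c); case: (o a b d); case: (o a c d); case: (o b c d).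
Qed.

(** [crp] is the parity of the crossings of a segment with a polygonal chain, [crpp] that of two
    chains; a chain is given by its first vertex and the sequence of the others. *)
Fixpoint crp i j k (t : seq I) :=
  if t is l :: t' then cr i j k l (+) crp i j l t' else false.
Fixpoint crpp i (s : seq I) k (t : seq I) :=
  if s is j :: s' then crp i j k t (+) crpp j s' k t else false.

Lemma crpp_nil i s k : crpp i s k [::] = false.
Proof. by elim: s i => //= j s IH i; rewrite IH. Qed.

Lemma crpp_cons i s k l t : crpp i s k (l :: t) = crp k l i s (+) crpp i s l t.
Proof.
elim: s i => [|j s IH] i //=; rewrite IH (cr_sym k l i j).
by case: (cr i j k l); case: (crp i j l t); case: (crp k l j s); case: (crpp j s l t).
Qed.

Lemma crpp_sym i s k t : crpp i s k t = crpp k t i s.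
Proof.
elim: s i => [|j s IH] i /=; first by rewrite crpp_nil.
by rewrite IH crpp_cons.
Qed.

Lemma crp_triangle a b c k t : uniq (k :: t) -> uniq [:: a; b; c] ->
  ~~ has (mem [:: a; b; c]) (k :: t) ->
  crp a b k t (+) crp b c k t (+) crp a c k t
  = inn k a b c (+) inn (last k t) a b c.
Proof.
move=> ut u; elim: t k ut => [|l t IH] k; first by rewrite /= addbb.
move=> /[dup] ukl /= /andP[_ utl] /norP[nk nlt].
move: (IH l utl nlt) => {}IH.
have {}ukl : uniq [:: a; b; c; k; l].
  move: nk nlt ukl => /=; rewrite !inE !negb_or => /and3P[k1 k2 k3].
  move=> /andP[/and3P[l1 l2 l3] _] /andP[/andP[kl _] _].
  by destruct_uniq u; solve_uniq.
have := cr_triangle ukl; move: IH => /=.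
move: (inn k a b c) (inn l a b c) (inn (last l t) a b c) => x y z.
case: (cr a b k l); case: (cr b c k l); case: (cr a c k l); case: (crp a b l t);
  case: (crp b c l t); case: (crp a c l t); case: x; case: y; by case: z.
Qed.

(* Cutting the corner [x] off a chain changes its crossings with the chain [u] by
   those of [u] with a triangle: the parity is that of the ends of [u] inside the
   triangle, and these cancel out over [F]. *)
Lemma crpp_straighten (F : seq (I * seq I)) a s b :
  (forall h : I -> bool, \big[addb/false]_(u <- F) (h u.1 (+) h (last u.1 u.2)) = false) ->
  uniq (a :: rcons s b) ->
  all (fun u => uniq (u.1 :: u.2) && ~~ has (mem (a :: rcons s b)) (u.1 :: u.2)) F ->
  \big[addb/false]_(u <- F) crpp a (rcons s b) u.1 u.2 =
  \big[addb/false]_(u <- F) crpp a [:: b] u.1 u.2.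
Proof.
move=> bal; elim: s => [|x s IH] //= us aF.
rewrite -IH; last 2 first.
- by move: us; rewrite /= inE negb_or -andbA => /and4P[_ -> _ ->].
- apply: sub_all aF => u /andP[uu nu]; apply/andP; split=> //; apply: contra nu => /=.
  case/orP => [H|/hasP[z zu H]]; apply/orP; [left|right].
    by move: H; rewrite !inE => /orP[->|->] //; rewrite !orbT.
  by apply/hasP; exists z => //; move: H; rewrite !inE => /orP[->|->] //; rewrite !orbT.
case E : (rcons s b) => [|y s2]; first by case: (s) E.
rewrite E /= in us aF *.
apply/(can_inj (addbK (\big[addb/false]_(u <- F) (crp a y u.1 u.2 (+) crpp y s2 u.1 u.2)))).
rewrite addbb -big_split -[RHS](bal (fun k => inn k a x y)) /=.
apply: eq_big_seq => u /(allP aF) /andP[uu nu].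
rewrite -crp_triangle //.
- by case: (crp a x u.1 u.2); case: (crp x y u.1 u.2); case: (crp a y u.1 u.2);
    case: (crpp y s2 u.1 u.2).
- by move: us; rewrite /= !inE !negb_or => /and3P[/and3P[-> -> _] /andP[-> _] _].
- have {}nu : ~~ has (mem [:: a, x, y & s2]) (u.1 :: u.2) by [].
  apply: contra nu => /hasP[z zu H]; apply/hasP; exists z => //.
  by move: H; rewrite !inE => /or3P[->|->|->] //; rewrite !orbT.
Qed.

Section Invariance.
Variables (E : eqType) (P : seq (E * E)) (src tgt : E -> I).

Definition incident e := [seq if u.1 == e then u.2 else u.1 | u <- P & (u.1 == e) || (u.2 == e)].

Definition total (s : E -> seq I) :=
  \big[addb/false]_(u <- P) crpp (src u.1) (rcons (s u.1) (tgt u.1))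
    (src u.2) (rcons (s u.2) (tgt u.2)).

Let step (s s' : E -> seq I) e :
  (forall f, f != e -> s' f = s f) ->
  \big[addb/false]_(f <- incident e) crpp (src e) (rcons (s e) (tgt e))
    (src f) (rcons (s f) (tgt f)) =
  \big[addb/false]_(f <- incident e) crpp (src e) (rcons (s' e) (tgt e))
    (src f) (rcons (s f) (tgt f)) ->
  all (fun u => u.1 != u.2) P -> total s = total s'.
Proof.
move=> s'E H irr; rewrite /total [LHS](bigID (fun u => (u.1 == e) || (u.2 == e))).
rewrite [RHS](bigID (fun u => (u.1 == e) || (u.2 == e))) /=; congr addb; last first.
  by apply: eq_bigr => u; rewrite negb_or => /andP[n1 n2]; rewrite (s'E _ n1) (s'E _ n2).
move: H; rewrite /incident !big_map !big_filter => H.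
rewrite -[LHS]big_filter -[RHS]big_filter.
rewrite -[in LHS]big_filter -[in RHS]big_filter in H.
transitivity (\big[addb/false]_(u <- [seq u <- P | (u.1 == e) || (u.2 == e)])
   (let f := if u.1 == e then u.2 else u.1 in
     crpp (src e) (rcons (s e) (tgt e)) (src f) (rcons (s f) (tgt f)))).
  apply: eq_big_seq => u; rewrite mem_filter => /andP[ue uP] /=.
  by case: eqP ue => [->|_ /= /eqP ->] //; rewrite crpp_sym.
rewrite H; apply: eq_big_seq => u; rewrite mem_filter => /andP[ue uP] /=.
have := allP irr _ uP; case: eqP ue => [ue1 _ n|_ /= /eqP ue2 n].
  by rewrite (s'E u.2) ?ue1 // -ue1 eq_sym.
by rewrite ue2 crpp_sym (s'E u.1) // -ue2.
Qed.

Hypothesis irr : all (fun u => u.1 != u.2) P.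
Hypothesis bal : forall e (h : I -> bool), e \in unzip1 P ++ unzip2 P ->
  \big[addb/false]_(f <- incident e) (h (src f) (+) h (tgt f)) = false.

(** The chains are straightened one edge at a time, each time with [crpp_straighten]. The balance
    hypothesis suits K5 and K3,3, where the edges independent of a given one form a triangle or a
    4-cycle. *)
Theorem total_straight (s : E -> seq I) :
  (forall e, e \in unzip1 P ++ unzip2 P -> uniq (src e :: rcons (s e) (tgt e))) ->
  (forall u, u \in P -> ~~ has (mem (src u.1 :: rcons (s u.1) (tgt u.1)))
     (src u.2 :: rcons (s u.2) (tgt u.2))) ->
  total s = total (fun=> [::]).
Proof.
move=> Hu Hd.
have [l Hl] : exists l, l = unzip1 P ++ unzip2 P by eexists.
(* [l'] lists the edges that are already straight. *)
have K (l' : seq E) : {subset l' <= l} -> total s = total (fun g => if g \in l' then [::] else s g).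
  elim: l' => [|e l' IH] sub //.
  rewrite IH; last by move=> g fl; apply: sub; rewrite inE fl orbT.
  have el : e \in l by apply: sub; rewrite mem_head.
  apply: (step (e := e)) => //; first by move=> g fe; rewrite inE (negbTE fe).
  rewrite inE eqxx /=.
  case: ifP => // el'.
  have inc g : g \in incident e -> g \in l /\
      ~~ has (mem (src e :: rcons (s e) (tgt e))) (src g :: rcons (s g) (tgt g)).
    case/mapP=> u; rewrite mem_filter => /andP[ue uP].
    move: ue; case: eqP => [<- _ ->|_]; last rewrite orFb => /eqP <- ->.
      by rewrite Hl mem_cat map_f ?orbT // Hd.
    rewrite Hl mem_cat map_f //; split=> //.
    by rewrite has_sym; apply: Hd.
  pose cut g := if g \in l' then [::] else s g.
  have subI g : g \in l -> uniq (src g :: rcons (cut g) (tgt g)).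
    move=> fl; have := Hu g; rewrite -Hl => /(_ fl).
    rewrite /cut; case: ifP => //= _; rewrite !mem_rcons rcons_uniq !inE negb_or.
    by case/andP => /andP[-> _].
  have subM g z : z \in src g :: rcons (cut g) (tgt g) -> z \in src g :: rcons (s g) (tgt g).
    rewrite /cut; case: ifP => // _; rewrite !inE mem_rcons !inE.
    by case/orP => ->; rewrite ?orbT.
  have := @crpp_straighten [seq (src g, rcons (cut g) (tgt g)) | g <- incident e]
    (src e) (s e) (tgt e).
  rewrite !big_map /=; apply.
  - move=> h; rewrite big_map -[RHS](@bal e h) -?Hl //; apply: eq_bigr => g _ /=.
    by rewrite last_rcons.
  - by apply: Hu; rewrite -Hl.
  - apply/allP => u /mapP[g fe ->] /=; have [fl dj] := inc g fe.
    have dj' : ~~ has (mem (src e :: rcons (s e) (tgt e))) (src g :: rcons (cut g) (tgt g)).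
      apply: contra dj => /hasP[z zg ze]; apply/hasP; exists z => //.
      exact: subM.
    by apply/andP; split; [exact: (subI g fl)|exact: dj'].
rewrite (K l) // /total; apply: eq_big_seq => u uP.
by rewrite !ifT // Hl mem_cat map_f ?orbT.
Qed.
End Invariance.

Let tri a b c p q : uniq [:: a; b; c; p; q] ->
  exists k, (cr a b p q + cr b c p q + cr a c p q + inn p a b c + inn q a b c = k.*2)%N.
Proof.
move/cr_triangle => H.
exists (cr a b p q + cr b c p q + cr a c p q + inn p a b c + inn q a b c)%N./2.
by rewrite even_halfK // !oddD !oddb H; case: (inn _ _ _ _); case: (inn _ _ _ _).
Qed.

Let tet v a b c d : uniq [:: v; a; b; c; d] ->
  exists k, (inn v a b c + inn v a b d + inn v a c d + inn v b c d = k.*2)%N.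
Proof.
move/inn_tetrahedron => H.
exists (inn v a b c + inn v a b d + inn v a c d + inn v b c d)%N./2.
by rewrite even_halfK // !oddD !oddb H.
Qed.

Let quad a b c d : uniq [:: a; b; c; d] ->
  exists k, (cr a b c d + cr a c b d + cr a d b c +
  (inn a b c d + inn b a c d + inn c a b d + inn d a b c) = k.*2.+1)%N.
Proof.
move/cr_inn_quadruple => H.
set x := (cr a b c d + _ + _ + _)%N.
exists x./2; rewrite -[LHS]odd_double_half.
by rewrite (_ : odd x) // /x !oddD !oddb.
Qed.

(** * Odd crossing parity of K5 and K3,3 *)

Definition K5_edges := [seq (i, j) | i <- iota 0 5, j <- iota i.+1 (4 - i)].
Definition K5_pairs := [seq u <- [seq (e, f) | e <- K5_edges, f <- K5_edges] |
  [&& u.1.1 < u.2.1, u.1.2 != u.2.1 & u.1.2 != u.2.2]]%N.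
Definition K33_edges := [seq (i, j) | i <- iota 0 3, j <- iota 3 3].
Definition K33_pairs := [seq u <- [seq (e, f) | e <- K33_edges, f <- K33_edges] |
  (u.1.1 < u.2.1) && (u.1.2 != u.2.2)]%N.

Section Complete.
Variables (v : nat -> I) (s : nat * nat -> seq I).
Local Notation src e := (v e.1).
Local Notation tgt e := (v e.2).

(** For straight edges, the crossing pairs are distributed over the five quadruples of vertices,
    each contributing an odd number by [quad]. The inside terms cancel by [tet], once for each
    vertex, so the total is odd. *)
Theorem K5_crossing : uniq [seq v i | i <- iota 0 5] ->
  (forall e, e \in K5_edges -> uniq (src e :: rcons (s e) (tgt e))) ->
  (forall u, u \in K5_pairs -> ~~ has (mem (src u.1 :: rcons (s u.1) (tgt u.1)))
     (src u.2 :: rcons (s u.2) (tgt u.2))) ->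
  exists2 u, u \in K5_pairs &
    crpp (src u.1) (rcons (s u.1) (tgt u.1)) (src u.2) (rcons (s u.2) (tgt u.2)).
Proof.
move=> uv Hu Hd; pose T u := crpp (src u.1) (rcons (s u.1) (tgt u.1)) (src u.2) (rcons (s u.2) (tgt u.2)).
case: (boolP (has T K5_pairs)) => [/hasP[u]|/hasPn nT]; first by exists u.
have : total K5_pairs (fun e => src e) (fun e => tgt e) s = false.
  by rewrite /total big_seq big1 // => u /nT /negbTE.
rewrite total_straight //; last 2 first.
- move=> e h; rewrite mem_cat => He.
  have {He} : e \in K5_edges by move: He; rewrite -mem_cat; apply: (allP (a := mem K5_edges)); vm_compute.
  rewrite /K5_edges /= !inE; repeat case/predU1P => [->|]; last move/eqP->;
  rewrite /incident /= !big_cons big_nil /=;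
  by case: (h (v 0%N)); case: (h (v 1%N)); case: (h (v 2%N)); case: (h (v 3%N)); case: (h (v 4%N)).
- move=> e He; apply: Hu; move: He; apply: (allP (a := mem K5_edges)); vm_compute. reflexivity.
rewrite /total big_addb_odd /K5_pairs /= !big_cons big_nil /= => H.
destruct_uniq uv.
have Q1 : uniq [:: v 0; v 1; v 2; v 3]%N by solve_uniq.
have Q2 : uniq [:: v 0; v 1; v 2; v 4]%N by solve_uniq.
have Q3 : uniq [:: v 0; v 1; v 3; v 4]%N by solve_uniq.
have Q4 : uniq [:: v 0; v 2; v 3; v 4]%N by solve_uniq.
have Q5 : uniq [:: v 1; v 2; v 3; v 4]%N by solve_uniq.
have F1 : uniq [:: v 0; v 1; v 2; v 3; v 4]%N by solve_uniq.
have F2 : uniq [:: v 1; v 0; v 2; v 3; v 4]%N by solve_uniq.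
have F3 : uniq [:: v 2; v 0; v 1; v 3; v 4]%N by solve_uniq.
have F4 : uniq [:: v 3; v 0; v 1; v 2; v 4]%N by solve_uniq.
have F5 : uniq [:: v 4; v 0; v 1; v 2; v 3]%N by solve_uniq.
have [?] := quad Q1; have [?] := quad Q2; have [?] := quad Q3.
have [?] := quad Q4; have [?] := quad Q5.
have [?] := tet F1; have [?] := tet F2; have [?] := tet F3.
have [?] := tet F4; have [?] := tet F5.
parity H.
Qed.

(** Sum [quad] over the nine quadruples with two vertices from each side. The inside terms cancel by
    [tet]; the unwanted crossings of a segment within one side with a segment within the other
    cancel by [tri], applied to the triangle 0 1 2. *)
Theorem K33_crossing : uniq [seq v i | i <- iota 0 6] ->
  (forall e, e \in K33_edges -> uniq (src e :: rcons (s e) (tgt e))) ->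
  (forall u, u \in K33_pairs -> ~~ has (mem (src u.1 :: rcons (s u.1) (tgt u.1)))
     (src u.2 :: rcons (s u.2) (tgt u.2))) ->
  exists2 u, u \in K33_pairs &
    crpp (src u.1) (rcons (s u.1) (tgt u.1)) (src u.2) (rcons (s u.2) (tgt u.2)).
Proof.
move=> uv Hu Hd.
pose T u := crpp (src u.1) (rcons (s u.1) (tgt u.1)) (src u.2) (rcons (s u.2) (tgt u.2)).
case: (boolP (has T K33_pairs)) => [/hasP[u]|/hasPn nT]; first by exists u.
have : total K33_pairs (fun e => src e) (fun e => tgt e) s = false.
  by rewrite /total big_seq big1 // => u /nT /negbTE.
rewrite total_straight //; last 2 first.
- move=> e h; rewrite mem_cat => He.
  have {He} : e \in K33_edges.
    by move: He; rewrite -mem_cat; apply: (allP (a := mem K33_edges)); vm_compute.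
  rewrite /K33_edges /= !inE; repeat case/predU1P => [->|]; last move/eqP->;
  rewrite /incident /= !big_cons big_nil /=;
  by case: (h (v 0%N)); case: (h (v 1%N)); case: (h (v 2%N)); case: (h (v 3%N));
    case: (h (v 4%N)); case: (h (v 5%N)).
- move=> e He; apply: Hu; move: He; apply: (allP (a := mem K33_edges)).
  by vm_compute.
rewrite /total big_addb_odd /K33_pairs /= !big_cons big_nil /= => H.
destruct_uniq uv.
have [?] := @quad (v 0%N) (v 1%N) (v 3%N) (v 4%N) ltac:(solve_uniq).
have [?] := @quad (v 0%N) (v 1%N) (v 3%N) (v 5%N) ltac:(solve_uniq).
have [?] := @quad (v 0%N) (v 1%N) (v 4%N) (v 5%N) ltac:(solve_uniq).
have [?] := @quad (v 0%N) (v 2%N) (v 3%N) (v 4%N) ltac:(solve_uniq).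
have [?] := @quad (v 0%N) (v 2%N) (v 3%N) (v 5%N) ltac:(solve_uniq).
have [?] := @quad (v 0%N) (v 2%N) (v 4%N) (v 5%N) ltac:(solve_uniq).
have [?] := @quad (v 1%N) (v 2%N) (v 3%N) (v 4%N) ltac:(solve_uniq).
have [?] := @quad (v 1%N) (v 2%N) (v 3%N) (v 5%N) ltac:(solve_uniq).
have [?] := @quad (v 1%N) (v 2%N) (v 4%N) (v 5%N) ltac:(solve_uniq).
have [?] := @tet (v 0%N) (v 1%N) (v 3%N) (v 4%N) (v 5%N) ltac:(solve_uniq).
have [?] := @tet (v 0%N) (v 2%N) (v 3%N) (v 4%N) (v 5%N) ltac:(solve_uniq).
have [?] := @tet (v 1%N) (v 0%N) (v 3%N) (v 4%N) (v 5%N) ltac:(solve_uniq).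
have [?] := @tet (v 1%N) (v 2%N) (v 3%N) (v 4%N) (v 5%N) ltac:(solve_uniq).
have [?] := @tet (v 2%N) (v 0%N) (v 3%N) (v 4%N) (v 5%N) ltac:(solve_uniq).
have [?] := @tet (v 2%N) (v 1%N) (v 3%N) (v 4%N) (v 5%N) ltac:(solve_uniq).
have [?] := @tet (v 3%N) (v 0%N) (v 1%N) (v 2%N) (v 4%N) ltac:(solve_uniq).
have [?] := @tet (v 3%N) (v 0%N) (v 1%N) (v 2%N) (v 5%N) ltac:(solve_uniq).
have [?] := @tet (v 4%N) (v 0%N) (v 1%N) (v 2%N) (v 3%N) ltac:(solve_uniq).
have [?] := @tet (v 4%N) (v 0%N) (v 1%N) (v 2%N) (v 5%N) ltac:(solve_uniq).
have [?] := @tet (v 5%N) (v 0%N) (v 1%N) (v 2%N) (v 3%N) ltac:(solve_uniq).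
have [?] := @tet (v 5%N) (v 0%N) (v 1%N) (v 2%N) (v 4%N) ltac:(solve_uniq).
have [?] := @tri (v 0%N) (v 1%N) (v 2%N) (v 3%N) (v 4%N) ltac:(solve_uniq).
have [?] := @tri (v 0%N) (v 1%N) (v 2%N) (v 3%N) (v 5%N) ltac:(solve_uniq).
have [?] := @tri (v 0%N) (v 1%N) (v 2%N) (v 4%N) (v 5%N) ltac:(solve_uniq).
parity H.
Qed.
End Complete.
End Generic.

(** * Crossings of connected compact sets *)

Local Open Scope classical_set_scope.

Inductive reach (T : Type) (A : set T) (r : T -> T -> Prop) (x : T) : T -> Prop :=
| reach_refl : A x -> reach A r x x
| reach_step y z : reach A r x y -> A z -> r y z -> reach A r x z.

Lemma reach_mem (T : Type) (A : set T) r (x y : T) : reach A r x y -> A x /\ A y.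
Proof. by elim => // y' z _ [Ax _] Az _. Qed.

Lemma reach_trans (T : Type) (A : set T) r (x y z : T) :
  reach A r x y -> reach A r y z -> reach A r x z.
Proof. by move=> xy; elim => // u v _ IH Av uv; apply: reach_step uv. Qed.

Lemma reach_sub (T : Type) (A B : set T) (r r' : T -> T -> Prop) (x y : T) :
  A `<=` B -> (forall u v, A u -> A v -> r u v -> r' u v) ->
  reach A r x y -> reach B r' x y.
Proof.
move=> AB rr; elim => [/AB|u v xu IH Av uv]; first exact: reach_refl.
apply: reach_step IH (AB _ Av) _; apply: rr => //.
by have [] := reach_mem xu.
Qed.

(** The points of [A] reachable from [x] are both open and closed in [A]. *)
Lemma connected_reach (T : topologicalType) (A : set T) (r : T -> T -> Prop) :
  connected A -> (forall x, A x -> \forall y \near x, r x y /\ r y x) ->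
  forall x y, A x -> A y -> reach A r x y.
Proof.
move=> cA nr x y Ax Ay; suff E : A `&` reach A r x = A by have [] : (A `&` reach A r x) y by rewrite E.
apply: cA; first by exists x; split => //; apply: reach_refl.
- exists (interior [set z | A z -> reach A r x z]); first exact: open_interior.
  apply/seteqP; split => z [Az xz]; split => //; last first.
    by move/interior_subset: xz => /(_ Az).
  rewrite /interior /=; apply: filterS (nr z Az) => w [zw _] Aw.
  by apply: reach_step zw.
- exists (~` interior [set z | A z -> ~ reach A r x z]).
    exact/open_closedC/open_interior.
  apply/seteqP; split => z [Az xz]; split => //.
    move=> /interior_subset /(_ Az); exact.
  apply: contrapT => nxz; apply: xz; rewrite /interior /=.
  apply: filterS (nr z Az) => w [_ wz] Aw xw; apply: nxz.
  by apply: reach_step wz.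
Qed.

Section Plane.
Variable R : realType.
Local Notation plane := (R * R)%type.
Implicit Types (K L : set plane) (x y z p q : plane).

(** Chains of every fineness replace paths: any connected set provides them, and they compose and
    pass to larger sets. *)
Definition links K x y := forall e : R, 0 < e ->
  reach K (fun a b => `|a - b| < e) x y.

Lemma connected_links K x y : connected K -> K x -> K y -> links K x y.
Proof.
move=> cK Kx Ky e e0; apply: connected_reach => // a Ka.
have := nbhsx_ballx a e e0; apply: filterS => b.
by rewrite ball_prod_normE /ball_ /= => ab; split=> //; rewrite distrC.
Qed.

Lemma compact_disjoint_dist K L : compact K -> compact L -> K `&` L = set0 ->
  exists2 e : R, 0 < e & forall x y, K x -> L y -> e <= `|x - y|.
Proof.
move=> cK cL KL.
have clL : closed L by apply: compact_closed => //; exact: norm_hausdorff.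
have oL : open (~` L) by exact: closed_openC.
have /compact_near_coveringP/(_ R (0^'+) (fun e x => ball x e `<=` ~` L)) := cK.
have H : forall x, K x -> \forall x' \near x & i \near 0^'+, ball x' i `<=` ~` L.
  move=> x Kx.
  have nLx : (~` L) x by move=> Lx; have : (K `&` L) x by []; rewrite KL.
  have /nbhs_ballP[e /= e0 xe] := open_nbhs_nbhs (conj oL nLx).
  exists (ball x (e / 2), [set t : R | 0 < t < e / 2]) => /=.
    split; first by apply: nbhsx_ballx; rewrite divr_gt0.
    near=> t; apply/andP; split; first by near: t; exact: nbhs_right_gt.
    by near: t; apply: nbhs_right_lt; rewrite divr_gt0.
  move=> [x' t] [/= xx' /andP[t0 te]] y x'y; apply: xe.
  rewrite [e]splitr; apply: ball_triangle xx' _.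
  by apply: le_ball x'y; exact: ltW.
move=> /(_ _ H) nK.
near (0 : R)^'+ => e.
have e0 : 0 < e by near: e; exact: nbhs_right_gt.
have Ke : forall x, K x -> ball x e `<=` ~` L by near: e; exact: nK.
exists e => // x y Kx Ly.
rewrite leNgt; apply/negP => xy; apply: (Ke x Kx y) Ly.
by rewrite ball_prod_normE.
Unshelve. all: by end_near. Qed.

Let ratio01 (u w : R) : (0 < u) (+) (0 < w) -> u - w != 0 /\ 0 <= u / (u - w) <= 1.
Proof.
move=> uw; have [[u0 w0]|[u0 w0]] : (0 < u /\ w <= 0) \/ (u <= 0 /\ 0 < w).
- by move: uw; case: (ltP 0 u) => u0; case: (ltP 0 w) => w0 //= _; [left|right].
- have D : 0 < u - w by lra.
  rewrite (gt_eqF D); split => //; apply/andP; split.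
    by apply: divr_ge0; lra.
  by rewrite ler_pdivrMr //; lra.
- have D : 0 < w - u by lra.
  have -> : u / (u - w) = (- u) / (w - u).
    by rewrite -[in RHS]opprB invrN mulrNN.
  split; first by rewrite lt_eqF //; lra.
  apply/andP; split; first by apply: divr_ge0; lra.
  by rewrite ler_pdivrMr //; lra.
Qed.

(** By Cramer's rule [l] and [m] are the parameters of the common point of the two segments, and
    neither [a] nor [c] is farther from it than the length of its own segment. *)
Lemma crosses_dist a b c d (ab ab' : R) : crosses a b c d ->
  `|a - b| < ab -> `|c - d| < ab' -> `|a - c| < ab + ab'.
Proof.
rewrite /crosses /ccw => /andP[/ratio01[D1 m01] /ratio01[D2 l01]].
set m := _ / _ in m01; set l := _ / _ in l01.
have D0 : det3 c d a - det3 c d b = - (det3 a b c - det3 a b d).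
  by rewrite /det3; ring.
have [E1 E2] : a.1 - c.1 = l * (a.1 - b.1) + m * (d.1 - c.1) /\
    a.2 - c.2 = l * (a.2 - b.2) + m * (d.2 - c.2).
  rewrite /l /m D0; move: D1; rewrite /det3 => D1.
  by split; field.
rewrite !prod_normE /= !gt_max => /andP[h1 h2] /andP[h3 h4].
have aux (x y : R) (t : R) : 0 <= t <= 1 -> `|t * x| <= `|x|.
  by move=> /andP[t0 t1]; rewrite normrM (ger0_norm t0) ler_piMl.
apply/andP; split; rewrite ?E1 ?E2; apply: le_lt_trans (ler_normD _ _) _;
  apply: ltrD; apply: le_lt_trans (aux _ 0 _ _) _ => //; by rewrite distrC.
Qed.

(** The points are shifted by [t] times distinct points of the moment curve. Each determinant is a
    polynomial in [t] whose coefficient of degree 2 is a nonzero Vandermonde product, so some small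
    [t] is a root of none of them. *)
Lemma generic_perturbation (I : finType) (f : I -> plane) (e : R) : 0 < e ->
  exists2 g : I -> plane, generic g & forall i, `|f i - g i| < e.
Proof.
move=> e0.
pose N : R := (#|I|%:R) ^+ 2 + 1.
have N0 : 0 < N by rewrite ltr_pwDr // exprn_ge0.
pose r (i : I) : R := (enum_rank i)%:R.
pose X : {poly R} := 'X.
pose px (i : I) : {poly R} := (f i).1%:P + r i *: 'X.
pose py (i : I) : {poly R} := (f i).2%:P + (r i ^+ 2) *: 'X.
pose D i j k := (px j - px i) * (py k - py i) - (py j - py i) * (px k - px i).
pose P := \prod_(t : I * I * I | uniq [:: t.1.1; t.1.2; t.2]) D t.1.1 t.1.2 t.2.
have rI : injective r.
  by move=> i j /eqP; rewrite eqr_nat => /eqP/ord_inj/enum_rank_inj.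
have P0 : P != 0.
  apply/prodf_neq0 => -[[i j] k] /=; rewrite !inE negb_or andbT => /andP[/andP[ij ik] jk].
  apply/eqP => /(congr1 (fun q : {poly R} => q`_2)); rewrite coef0 => /eqP.
  apply/negP.
  have -> : (D i j k)`_2 = (r j - r i) * (r k - r i) * (r k - r j).
    have -> : D i j k = ((f j).1 - (f i).1)%:P * ((f k).2 - (f i).2)%:P
        - ((f j).2 - (f i).2)%:P * ((f k).1 - (f i).1)%:P
       + (((f j).1 - (f i).1) * (r k ^+ 2 - r i ^+ 2) + (r j - r i) * ((f k).2 - (f i).2)
        - ((f j).2 - (f i).2) * (r k - r i) - (r j ^+ 2 - r i ^+ 2) * ((f k).1 - (f i).1)) *: 'X
       + ((r j - r i) * (r k - r i) * (r k - r j)) *: 'X^2.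
      rewrite /D /px /py -!mul_polyC !(rmorphB, rmorphD, rmorphM, rmorphXn) /=.
      by ring.
    by rewrite !coefE /= ; ring.
  by rewrite !mulf_neq0 // subr_eq0 (inj_eq rI) // eq_sym.
have [t [t0 te Pt]] : exists t : R, [/\ 0 < t, t < e / N & P.[t] != 0].
  (* These are [size P] distinct candidates, more than [P] has roots; [n.+2] keeps them strictly
     below [e / N]. *)
  pose s := [seq e / N / (n.+2)%:R | n <- iota 0 (size P)].
  have us : uniq s.
    rewrite map_inj_uniq ?iota_uniq // => a b.
    move/(mulfI (lt0r_neq0 (divr_gt0 e0 N0)))/invr_inj/eqP.
    by rewrite eqr_nat => /eqP[].
  have := max_poly_roots P0; move=> /(_ s).
  case: (boolP (all (root P) s)) => [_ /(_ isT us)|/allPn[t /mapP[n _ tE] nt] _].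
    by rewrite size_map size_iota ltnn.
  exists t; split=> //; first by rewrite tE !divr_gt0.
  rewrite tE ltr_pdivrMr // ltr_pMr ?divr_gt0 //.
  by rewrite ltr1n.
exists (fun i => ((f i).1 + t * r i, (f i).2 + t * r i ^+ 2)).
  move=> i j k u; apply: contraNneq Pt => d0.
  rewrite /P (bigD1 (i, j, k)) //= hornerM.
  suff -> : (D i j k).[t] = 0 by rewrite mul0r.
  rewrite -d0 /det3 /D /px /py !hornerE /=; ring.
have sub_add (a b : R) : a - (a + b) = - b by ring.
move=> i; rewrite prod_normE /= !sub_add !normrN.
have ri : 0 <= r i <= #|I|%:R.
  by rewrite ler0n ler_nat ltnW // ltn_ord.
have tN : t * N < e by rewrite -ltr_pdivlMr.
rewrite gt_max !ger0_norm ?mulr_ge0 ?exprn_ge0 //; try lra.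
have h2 : r i ^+ 2 <= N by rewrite /N; nra.
have h1 : r i <= N by rewrite /N; nra.
by apply/andP; split; nra.
Qed.

Lemma reach_seq (T : Type) (K : set T) (r : T -> T -> Prop) (x y : T) : reach K r x y ->
  exists2 s, path (fun a b => `[< [/\ K a, K b & r a b] >]) x s & last x s = y.
Proof.
elim=> [Kx|z t xz [s ps lz] Kt zt]; first by exists [::].
exists (rcons s t); last by rewrite last_rcons.
rewrite rcons_path ps lz; apply/asboolP; split => //.
by have [] := reach_mem xz.
Qed.

Lemma crpp_path (I : eqType) (f : I -> plane) (r r' : rel I) i s k t :
  path r i s -> path r' k t -> crpp f i s k t ->
  exists a b c d, [/\ r a b, r' c d & cr f a b c d].
Proof.
move=> + rt; elim: s i => [//|j s IH] i /= /andP[rij rs].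
have [|Hn] := boolP (crp f i j k t); last by rewrite addFb; apply: IH.
move=> H _; clear IH; elim: t k rt H => [//|l t IHt] k /= /andP[rkl rt].
have [H _|Hn] := boolP (cr f i j k l); last by rewrite addFb; apply: IHt.
by exists i, j, k, l.
Qed.

Definition forces_crossing (n : nat) (E : seq (nat * nat))
    (P : seq ((nat * nat) * (nat * nat))) :=
  forall (I : finType) (f : I -> plane), generic f ->
  forall (v : nat -> I) (s : nat * nat -> seq I), uniq [seq v i | i <- iota 0 n] ->
  (forall e, e \in E -> uniq (v e.1 :: rcons (s e) (v e.2))) ->
  (forall u, u \in P -> ~~ has (mem (v u.1.1 :: rcons (s u.1) (v u.1.2)))
     (v u.2.1 :: rcons (s u.2) (v u.2.2))) ->
  exists2 u, u \in P &
    crpp f (v u.1.1) (rcons (s u.1) (v u.1.2)) (v u.2.1) (rcons (s u.2) (v u.2.2)).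

Lemma links_meet n E P : forces_crossing n E P ->
  all (fun e => [&& e.1 < 6, e.2 < 6 & e.1 != e.2])%N E -> (n <= 6)%N ->
  all (fun u => [&& u.1 \in E, u.2 \in E, u.1.1 != u.2.1, u.1.1 != u.2.2,
    u.1.2 != u.2.1 & u.1.2 != u.2.2]) P ->
  forall (p : nat -> plane) (K : nat * nat -> set plane),
  (forall e, e \in E -> compact (K e) /\ links (K e) (p e.1) (p e.2)) ->
  exists2 u, u \in P & K u.1 `&` K u.2 !=set0.
Proof.
move=> fc /allP E6 n6 /allP PE p K cK; apply: contrapT => nex.
have [e e0 eP] : exists2 e : R, 0 < e & forall u, u \in P -> forall x y,
    K u.1 x -> K u.2 y -> e <= `|x - y|.
  have : {subset P <= P} by [].
  elim: {1 3}P => [|u Q IH] sub; first by exists 1.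
  have [w wQ|e e0 He] := IH; first by apply: sub; rewrite inE wQ orbT.
  have uP : u \in P by apply: sub; rewrite mem_head.
  have /and3P[u1 u2 _] := PE _ uP.
  have [e' e'0 He'] : exists2 e : R, 0 < e & forall x y, K u.1 x -> K u.2 y -> e <= `|x - y|.
    apply: compact_disjoint_dist; [exact: (cK _ u1).1|exact: (cK _ u2).1|].
    by apply: contrapT => /eqP/set0P ne; apply: nex; exists u.
  exists (Num.min e e'); first by rewrite lt_min e0.
  move=> w; rewrite inE => /predU1P[->|wQ] x y Kx Ky; rewrite ge_min.
    by rewrite He' ?orbT.
  by rewrite (He w).
(* Steps below [d] become steps below [3 d] after moving each point by less than [d]. Crossing steps
   then have starting points within [6 d], and moving these back costs [2 d] more, in all [8 d]. *)
pose d : R := e / 8%:R.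
have d0 : 0 < d by rewrite divr_gt0.
pose rr (e : nat * nat) (a b : plane) := `[< [/\ K e a, K e b & `|a - b| < d] >].
have ch : forall e : nat * nat, exists s : seq plane,
   e \in E -> path (rr e) (p e.1) s /\ last (p e.1) s = p e.2.
  move=> g; have [gE|_] := boolP (g \in E); last by exists [::].
  have [s ps ls] := reach_seq ((cK _ gE).2 d d0).
  by exists s.
have [S HS] := choice ch.
pose N := \max_(g <- E) size (S g).
(* Six vertices and [N] places for each chain. Short chains are padded by repeating their last
   point; the copies have different indices and are separated by the perturbation. *)
pose I := ('I_6 + ('I_6 * 'I_6) * 'I_N)%type.
pose f (i : I) : plane := match i with
  | inl i => p i
  | inr (i, j, t) => nth (p j) (S (nat_of_ord i, nat_of_ord j)) t end.
have [g gg fg] := generic_perturbation f d0.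
pose v (i : nat) : I := inl (inord i).
pose s (e : nat * nat) : seq I := [seq inr (inord e.1, inord e.2, t) | t <- enum 'I_N].
have vinj i j : (i < 6)%N -> (j < 6)%N -> v i = v j -> i = j.
  by move=> i6 j6 [] /(congr1 (@nat_of_ord _)); rewrite !inordK.
have sE h : h \in E -> [seq nth (p h.2) (S h) (nat_of_ord t) | t <- enum 'I_N] =
    S h ++ nseq (N - size (S h)) (p h.2).
  move=> hE; have SN : (size (S h) <= N)%N by rewrite /N; apply: leq_bigmax_seq.
  rewrite (map_comp (nth (p h.2) (S h)) (@nat_of_ord N)) val_enum_ord.
  apply: (@eq_from_nth _ (p h.2)) => [|i].
    by rewrite size_map size_iota size_cat size_nseq subnKC.
  rewrite size_map size_iota => iN; rewrite (nth_map 0%N) ?size_iota // nth_iota // add0n.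
  rewrite nth_cat nth_nseq if_same; case: ltnP => // Si.
  by rewrite nth_default.
have fpath h : h \in E -> path (relpre f (rr h)) (v h.1) (rcons (s h) (v h.2)).
  move=> hE; have /and3P[h1 h2 _] := E6 _ hE.
  have [ph lh] := HS _ hE.
  have [_ Kh2] := reach_mem ((cK _ hE).2 d d0).
  have rh : rr h (p h.2) (p h.2).
    by apply/asboolP; split => //; rewrite subrr normr0.
  rewrite -path_map /f /= inordK // map_rcons /= inordK // -map_comp.
  rewrite (eq_map (g := fun t : 'I_N => nth (p h.2) (S h) t)); last first.
    by move=> t /=; rewrite !inordK //; case: (h).
  rewrite sE // -cats1 -catA cat_path ph lh /=.
  by elim: (N - _)%N => [|k IH] /=; rewrite rh.
have [|||u uP] := fc _ g gg v s.
- rewrite map_inj_in_uniq ?iota_uniq // => i j.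
  by rewrite !mem_iota /= add0n => i6 j6; apply: vinj; apply: leq_trans n6.
- move=> h hE; have /and3P[h1 h2 h12] := E6 _ hE.
  rewrite /= mem_rcons inE negb_or rcons_uniq; apply/andP; split; apply/andP; split.
  + by apply: contra h12 => /eqP/vinj -> //.
  + by apply/mapP => -[].
  + by apply/mapP => -[].
  + by rewrite map_inj_uniq ?enum_uniq // => a b [].
- move=> u uP; have /and5P[u1 u2 n1 n2 /andP[n3 n4]] := PE _ uP.
  have /and3P[a1 a2 a3] := E6 _ u1; have /and3P[b1 b2 b3] := E6 _ u2.
  apply/hasPn => z; rewrite inE mem_rcons inE.
  case/or3P => [/eqP ->|/eqP ->|/mapP[t _ ->]] /=; rewrite inE mem_rcons inE.
  + rewrite !negb_or; apply/and3P; split; last by apply/mapP => -[].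
      by apply: contra n1 => /eqP /vinj ->.
    by apply: contra n3 => /eqP /vinj ->.
  + rewrite !negb_or; apply/and3P; split; last by apply/mapP => -[].
      by apply: contra n2 => /eqP /vinj ->.
    by apply: contra n4 => /eqP /vinj ->.
  + rewrite !negb_or; apply/and3P; split => //; apply/mapP => -[t' _ []].
    move=> /(congr1 (@nat_of_ord _)); rewrite !inordK // => E1 _ _.
    by rewrite E1 eqxx in n1.
have /and5P[u1 u2 _ _ _] := PE _ uP.
move=> /(crpp_path (fpath _ u1) (fpath _ u2))[a [b [c [d' []]]]].
move=> /asboolP[Ka Kb ab] /asboolP[Kc Kd cd] X.
have bound (x y : I) : `|f x - f y| < d -> `|g x - g y| < d + d + d.
  move=> xy; rewrite (_ : g x - g y = (f x - f y) + (g x - f x) + (f y - g y)); last first.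
    by ring.
  have := ler_normD (f x - f y + (g x - f x)) (f y - g y).
  have := ler_normD (f x - f y) (g x - f x).
  have := fg x; have := fg y; rewrite (distrC (f x)) => *.
  lra.
have := crosses_dist X (bound _ _ ab) (bound _ _ cd).
have := eP u uP _ _ Ka Kc.
have -> : f a - f c = (g a - g c) + (f a - g a) + (g c - f c) by ring.
move=> H1 H2.
have := ler_normD ((g a - g c) + (f a - g a)) (g c - f c).
have := ler_normD (g a - g c) (f a - g a).
have eE : e = d * 8%:R by rewrite /d; field.
have := fg a; have := fg c; rewrite (distrC (f c)) => *.
lra.
Qed.

Theorem K5_meet (p : nat -> plane) (K : nat * nat -> set plane) :
  (forall e, e \in K5_edges -> compact (K e) /\ links (K e) (p e.1) (p e.2)) ->
  exists2 u, u \in K5_pairs & K u.1 `&` K u.2 !=set0.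
Proof.
apply: (@links_meet 5); [|by vm_compute..].
by move=> I f gf v s; apply: K5_crossing.
Qed.

Theorem K33_meet (p : nat -> plane) (K : nat * nat -> set plane) :
  (forall e, e \in K33_edges -> compact (K e) /\ links (K e) (p e.1) (p e.2)) ->
  exists2 u, u \in K33_pairs & K u.1 `&` K u.2 !=set0.
Proof.
apply: (@links_meet 6); [|by vm_compute..].
by move=> I f gf v s; apply: K33_crossing.
Qed.
End Plane.

(** * Minors of outerplanar graphs *)

Section Plane.
Variable R : realType.
Local Notation plane := (R * R)%type.
Implicit Types (K L : set plane) (x y z : plane).

Lemma links_sub K L x y : K `<=` L -> links K x y -> links L x y.
Proof. by move=> KL Kxy e /Kxy; apply: reach_sub. Qed.

Lemma links_trans K y x z : links K x y -> links K y z -> links K x z.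
Proof. by move=> xy yz e e0; apply: reach_trans (xy e e0) (yz e e0). Qed.

Lemma links_refl K x : K x -> links K x x.
Proof. by move=> Kx e _; apply: reach_refl. Qed.

Definition seg x y : set plane := (fun t : R => x + t *: (y - x)) @` `[0, 1].

Let seg_cont x y : continuous (fun t : R => x + t *: (y - x)).
Proof.
move=> t; apply: cvgD; first exact: cvg_cst.
exact: scalel_continuous.
Qed.

Lemma seg_compact x y : compact (seg x y).
Proof.
apply: continuous_compact; first exact/continuous_subspaceT/seg_cont.
exact: segment_compact.
Qed.

Lemma seg_l x y : seg x y x.
Proof. by exists 0; rewrite ?scale0r ?addr0 //= in_itv /= lexx ler01. Qed.

Lemma seg_r x y : seg x y y.
Proof. by exists 1; [rewrite /= in_itv /= lexx ler01|rewrite scale1r addrC subrK]. Qed.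

Lemma seg_links x y : links (seg x y) x y.
Proof.
apply: connected_links; [|exact: seg_l|exact: seg_r].
apply: connected_continuous_connected; first exact: segment_connected.
exact/continuous_subspaceT/seg_cont.
Qed.

Lemma seg_ball c (e : R) x y : ball c e x -> ball c e y -> seg x y `<=` ball c e.
Proof.
rewrite ball_prod_normE /ball_ /= => cx cy z [t]; rewrite /= in_itv /= => /andP[t0 t1] <-.
have -> : c - (x + t *: (y - x)) = (1 - t) *: (c - x) + t *: (c - y).
  by rewrite !scalerBl !scalerBr !scale1r !opprD !opprK; apply/pair_equal_spec;
    split; rewrite /=; ring.
apply: le_lt_trans (ler_normD _ _) _; rewrite !normrZ !ger0_norm ?subr_ge0 //.
have [->|tn1] := eqVneq t 1; first by rewrite subrr mul0r add0r mul1r.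
have : 0 < 1 - t by rewrite subr_gt0 lt_neqAle tn1.
by move=> ?; nra.
Qed.

(** [links_meet] needs compact sets, and a face is open; a finite chain of segments inside it is
    compact. *)
Lemma open_reach_compact (D : set plane) x y :
  reach (~` D) (fun a b => seg a b `<=` ~` D) x y ->
  exists K, [/\ compact K, links K x y & K `<=` ~` D].
Proof.
elim=> [Dx|u v xu [K [cK lK KD]] Dv uv].
  exists [set x]; split; [exact: compact_set1|exact: links_refl|by move=> _ ->].
exists (K `|` seg u v); split.
- by apply: compactU => //; exact: seg_compact.
- apply: (links_trans (y := u)).
    by apply: links_sub lK => ? ?; left.
  by apply: links_sub (@seg_links u v) => ? ?; right.
- by move=> z [/KD|/uv].
Qed.

Lemma component_reach (D : set plane) c x y : closed D ->
  connected_component (~` D) c x -> connected_component (~` D) c y ->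
  reach (~` D) (fun a b => seg a b `<=` ~` D) x y.
Proof.
move=> cD cx cy.
apply: (@reach_sub _ (connected_component (~` D) c) _ (fun a b => seg a b `<=` ~` D)) => //.
  exact: connected_component_sub.
apply: (connected_reach (@component_connected _ _ _)) => // z /connected_component_sub Dz.
have oD : open (~` D) by exact: closed_openC.
have /nbhs_ballP[e /= e0 ze] := open_nbhs_nbhs (conj oD Dz).
have := nbhsx_ballx z e e0; apply: filterS => w zw; have zz : ball z e z by exact: ballxx.
by split; apply: subset_trans ze; apply: seg_ball.
Qed.

Lemma bigsetUP (I : eqType) (s : seq I) (P : pred I) (F : I -> set plane) z :
  (\big[setU/set0]_(i <- s | P i) F i) z <-> exists2 i, (i \in s) && P i & F i z.
Proof.
elim: s => [|i s IH]; first by rewrite big_nil; split => // -[].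
rewrite big_cons; split.
  case: ifP => Pi; last by case/IH => j /andP[js Pj] Fj; exists j => //; rewrite inE js orbT.
  case=> [Fi|/IH[j /andP[js Pj] Fj]]; first by exists i => //; rewrite mem_head.
  by exists j => //; rewrite inE js orbT.
case=> j /andP[]; rewrite inE => /predU1P[->|js] Pj Fj; first by rewrite Pj; left.
by case: ifP => _; [right|]; apply/IH; exists j => //; rewrite js.
Qed.

Lemma compact_bigsetU (I : Type) (s : seq I) (P : pred I) (F : I -> set plane) :
  (forall i, P i -> compact (F i)) -> compact (\big[setU/set0]_(i <- s | P i) F i).
Proof.
by move=> cF; elim/big_ind: _ => //; [exact: compact0|exact: compactU].
Qed.
End Plane.

Section OuterplanarMinors.
Variables (R : realType) (n : nat) (G : sgraph n).
Local Notation plane := (R * R)%type.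
Variables (p : 'I_n -> plane) (A : {set 'I_n} -> set plane).
Hypothesis drawn : is_drawing G p A.

Definition supp (W : {set 'I_n}) : set plane :=
  \big[setU/set0]_(v <- enum W) [set p v] `|`
  \big[setU/set0]_(e <- enum (edges G) | e \subset W) A e.

Lemma suppP W z : supp W z <-> (exists2 v, v \in W & z = p v) \/
  (exists2 e, (e \in edges G) && (e \subset W) & A e z).
Proof.
split.
  case=> [/bigsetUP[v]|/bigsetUP[e]]; rewrite ?andbT mem_enum.
    by move=> vW ->; left; exists v.
  by move=> eW Az; right; exists e.
case=> [[v vW ->]|[e eW Az]]; [left|right]; apply/bigsetUP.
  by exists v => //; rewrite mem_enum andbT.
by exists e => //; rewrite mem_enum.
Qed.

Lemma edgeP e : e \in edges G -> exists u v, u != v /\ e = [set u; v]%SET.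
Proof.
by move=> eG; have /forallP/(_ e) := edges_card2 G; rewrite eG => /cards2P[u [v]];
  exists u, v.
Qed.

Lemma edge_arc e : e \in edges G -> compact (A e) /\ connected (A e).
Proof.
case: drawn => _ arc _ _ eG; have [u [v [_ eE]]] := edgeP eG.
have /arc : adj G u v by rewrite /adj -eE.
rewrite -eE => -[g [cg _ _ _ ->]]; split.
  by apply: continuous_compact => //; exact: segment_compact.
by apply: connected_continuous_connected => //; exact: segment_connected.
Qed.

Lemma edge_ends u v : adj G u v -> A [set u; v]%SET (p u) /\ A [set u; v]%SET (p v).
Proof.
case: drawn => _ arc _ _ /arc [g [_ _ <- <- ->]].
by split; [exists 0|exists 1]; rewrite //= in_itv /= lexx ler01.
Qed.

Lemma supp_compact W : compact (supp W).
Proof.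
apply: compactU; first by apply: compact_bigsetU => v _; exact: compact_set1.
rewrite big_seq_cond; apply: compact_bigsetU => e /andP[].
by rewrite mem_enum => /edge_arc[].
Qed.

Lemma supp_vertex (W : {set 'I_n}) v : v \in W -> supp W (p v).
Proof. by move=> vW; apply/suppP; left; exists v. Qed.

Lemma supp_notin (W : {set 'I_n}) v : v \notin W -> ~ supp W (p v).
Proof.
case: drawn => pI _ Av _ vW /suppP[[u uW /pI vu]|[e /andP[eG eW] Ae]].
  by rewrite vu uW in vW.
by move: vW; rewrite (fintype.subsetP eW) //; exact: Av Ae.
Qed.

Lemma supp_sub (W W' : {set 'I_n}) : W \subset W' -> supp W `<=` supp W'.
Proof.
move=> WW z /suppP[[v vW ->]|[e /andP[eG eW] Ae]].
  by apply: supp_vertex; exact: (fintype.subsetP WW).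
by apply/suppP; right; exists e; rewrite // eG (fintype.subset_trans eW).
Qed.

Lemma supp_disjoint (W W' : {set 'I_n}) : ([disjoint W & W'])%B -> supp W `&` supp W' = set0.
Proof.
move=> dW; rewrite -subset0 => z [].
have nW v : v \in W -> v \in W' -> False.
  by move=> vW; rewrite (disjointFr dW).
case/suppP => [[v vW ->]|[e /andP[eG eW] Ae]].
  by move=> /(supp_notin _); apply; apply/negP; exact: nW.
case/suppP => [[v vW zv]|[f /andP[fG fW] Af]].
  by move: Ae; case: drawn => _ _ Av _; rewrite zv => /(Av _ _ eG)/(fintype.subsetP eW)/nW; apply.
case: drawn => _ _ Av AA; have ef : e != f.
  have [u [w [_ eE]]] := edgeP eG; apply/eqP => ef; apply: (nW u).
    by apply: (fintype.subsetP eW); rewrite eE set21.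
  by apply: (fintype.subsetP fW); rewrite -ef eE set21.
have [v _ vz] := AA e f eG fG ef z (conj Ae Af).
rewrite -vz in Ae Af; apply: (nW v).
  by apply: (fintype.subsetP eW); exact: Av Ae.
by apply: (fintype.subsetP fW); exact: Av Af.
Qed.

Lemma supp_links (W : {set 'I_n}) u v : conn_set (adj G) W -> u \in W -> v \in W ->
  links (supp W) (p u) (p v).
Proof.
move=> cW uW vW; have /connectP[s ps ->] := cW u v uW vW.
elim: s u uW ps => [|w s IH] u uW /=; first by move=> _; apply/links_refl/supp_vertex.
case/andP => /and3P[uw _ wW] ps; apply: links_trans (IH w wW ps).
have [Au Aw] := edge_ends uw.
have [_ cA] := edge_arc uw.
apply: links_sub (connected_links cA Au Aw) => z Az; apply/suppP; right.
exists [set u; w]%SET => //; rewrite [X in X && _]uw /=.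
by apply/fintype.subsetP => x; rewrite !inE => /orP[]/eqP->.
Qed.

Lemma supportE : drawing_support G p A = supp [set: 'I_n].
Proof.
apply/seteqP; split => z.
  case=> [[v _ <-]|[e eG Ae]]; first exact/supp_vertex.
  by apply/suppP; right; exists e => //; rewrite [X in X && _]eG finset.subsetT.
case/suppP => [[v _ ->]|[e /andP[eG _] Ae]]; first by left; exists v.
by right; exists e.
Qed.

Variable F : set plane.
Hypothesis face : is_outer_face (drawing_support G p A) F.
Hypothesis outer : forall v, closure F (p v).

(** From a fixed point of the face go inside it to a point close to [p v], then straight to [p v]
    within a ball that avoids everything drawn without [v]. Such a connection can meet only those
    parts of the drawing that contain [v]. *)
Lemma spokes : exists x : plane, forall v, exists K, [/\ compact K, links K x (p v) &
  forall W : {set 'I_n}, v \notin W -> K `&` supp W = set0].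
Proof.
case: face => -[c Dc FE] _; exists c => v.
have clS W : closed (supp W).
  by apply: compact_closed; [exact: norm_hausdorff|exact: supp_compact].
pose L := supp (~: [set v])%SET.
have nL : (~` L) (p v) by apply: supp_notin; rewrite finset.inE finset.in_set1 eqxx.
have oL : open (~` L) by apply: closed_openC; exact: clS.
have /nbhs_ballP[e /= e0 ze] := open_nbhs_nbhs (conj oL nL).
have [y [Fy yv]] := outer (nbhsx_ballx (p v) e e0).
have clD : closed (drawing_support G p A) by rewrite supportE; exact: clS.
rewrite FE in Fy.
have [K [cK lK KD]] := open_reach_compact
  (component_reach clD (connected_component_refl Dc) Fy).
exists (K `|` seg y (p v)); split.
- by apply: compactU => //; exact: seg_compact.
- apply: (links_trans (y := y)); first by apply: links_sub lK => ? ?; left.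
  by apply: links_sub (@seg_links _ y (p v)) => ? ?; right.
- move=> W vW; rewrite -subset0 => z [[/KD nz|sz] Wz].
    by apply: nz; rewrite supportE; apply: supp_sub Wz; exact: finset.subsetT.
  have : (~` L) z by apply: ze; apply: seg_ball sz => //; exact: ballxx.
  apply; apply: supp_sub Wz; apply/fintype.subsetP => w wW; rewrite !inE.
  by apply: contraNneq vW => <-.
Qed.
End OuterplanarMinors.

Section NoMinor.
Variables (R : realType) (n : nat) (G : sgraph n).
Local Notation plane := (R * R)%type.

(** The point [x] of the outer face is vertex 0 of K5 or K3,3, and branch set [i] is vertex [i.+1].
    An edge at 0 becomes a spoke, any other edge the drawing of the union of two branch sets; [meet]
    makes two independent ones intersect, while they are disjoint by construction. *)
Let no_minor (m : nat) (h : rel 'I_m.+1) (E : seq (nat * nat)) (P : seq ((nat * nat) * (nat * nat))) :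
  (forall (p : nat -> plane) (K : nat * nat -> set plane),
    (forall e, e \in E -> compact (K e) /\ links (K e) (p e.1) (p e.2)) ->
    exists2 u, u \in P & K u.1 `&` K u.2 !=set0) ->
  all (fun e => [&& e.1 < e.2, e.2 < m.+2 & (0 < e.1) ==> h (inord e.1.-1) (inord e.2.-1)])%N E ->
  all (fun u => [&& u.1 \in E, u.2 \in E, u.1.1 < u.2.1, u.1.2 != u.2.1 & u.1.2 != u.2.2])%N P ->
  outerplanar R G -> ~ minor h (adj G).
Proof.
move=> meet /allP PE /allP PP [p [A [drawn [F face outer]]]] [B [B0 cB dB tB]].
have symG : symmetric (adj G) by move=> u v; rewrite /adj finset.setUC.
have /choice[b Bb] : forall i : 'I_m.+1, exists v, v \in B i.
  by move=> i; have /finset.set0Pn[v vB] := B0 i; exists v.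
have [x spk] := spokes drawn face outer.
have [S HS] := choice spk.
pose p' k := if k is k'.+1 then p (b (inord k')) else x.
pose K (e : nat * nat) := if e.1 is i.+1 then supp G p A (B (inord i) :|: B (inord e.2.-1))%SET
  else S (b (inord e.2.-1)).
have [|u uP] := meet p' K.
  move=> [[|i] [|j]] /PE /andP[] //= _ /andP[jm hij].
    by have [cS lS _] := HS (b (inord j)).
  split; first exact: supp_compact.
  apply: supp_links => //; last 2 first.
  - by rewrite finset.inE Bb.
  - by rewrite finset.inE Bb orbT.
  by apply: conn_setU => //; exact: tB.
move=> /set0P/negP; apply; apply/eqP.
have /and5P[/PE /and3P[a1 a2 _] /PE /and3P[b1 b2 _] lt12 n1 n2] := PP _ uP.
(* As [u.1.1 < u.2.1], only the first edge of the pair can be a spoke. *)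
case: u uP a1 a2 b1 b2 lt12 n1 n2 => -[i j] [[|k] l] _ //= a1 a2 b1 b2 lt12 n1 n2.
have neq (s t : nat) : (0 < s < m.+2)%N -> (0 < t < m.+2)%N -> s != t ->
    (inord s.-1 : 'I_m.+1) != inord t.-1.
  case: s t => [|s] [|t] //= sm tm; apply: contra => /eqP /(congr1 (@nat_of_ord _)).
  by rewrite !inordK // => ->.
have dis (s t : nat) : (0 < s < m.+2)%N -> (0 < t < m.+2)%N -> s != t ->
    [disjoint B (inord s.-1) & B (inord t.-1)]%B.
  by move=> sm tm st; apply: dB; apply: neq.
rewrite {1}/K /=; case: i a1 lt12 => [|i] a1 lt12; rewrite /K /=.
  have [_ _] := HS (b (inord j.-1)); apply.
  rewrite finset.inE negb_or; apply/andP; split.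
    have D := dis j k.+1; rewrite (disjointFr (D _ _ _)) ?Bb //; lia.
  have D := dis j l; rewrite (disjointFr (D _ _ _)) ?Bb //; lia.
apply: supp_disjoint => //.
rewrite -finset.setI_eq0 finset.setIUl !finset.setIUr.
have D (s t : nat) : (0 < s < m.+2)%N -> (0 < t < m.+2)%N -> s != t ->
    (B (inord s.-1) :&: B (inord t.-1))%SET = finset.set0.
  by move=> sm tm st; apply/eqP; rewrite finset.setI_eq0; apply: dis.
rewrite (D i.+1 k.+1) ?(D i.+1 l) ?(D j k.+1) ?(D j l) ?finset.setU0 //; try lia.
Qed.

Theorem outerplanar_K4 : outerplanar R G -> ~ minor K4 (adj G).
Proof.
apply: (no_minor (@K5_meet R)); last by vm_compute.
by rewrite /K5_edges /= /K4 -!val_eqE /= !inordK.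
Qed.

Theorem outerplanar_K23 : outerplanar R G -> ~ minor K23 (adj G).
Proof.
apply: (no_minor (@K33_meet R)); last by vm_compute.
by rewrite /K33_edges /= /K23 !inordK.
Qed.
End NoMinor.

(** * Drawings on a parabola *)

Section ParabolaDrawing.
Variables (R : realType) (n : nat) (G : sgraph n) (pos : 'I_n -> nat).
Hypotheses (posI : injective pos) (nc : noncrossing (adj G) pos).
Local Notation plane := (R * R)%type.

Let x v : R := (pos v)%:R.
Let p v : plane := (x v, x v ^+ 2).
Let A (e : {set 'I_n}) : set plane :=
  [set z | exists u v, [/\ e = [set u; v]%SET, (pos u < pos v)%N & seg (p u) (p v) z]].

Let xI : injective x.
Proof. by move=> u v /eqP; rewrite /x eqr_nat => /eqP/posI. Qed.

Let pI : injective p. Proof. by move=> u v [/xI]. Qed.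

Let seg_coord (a b : plane) z : seg a b z <-> exists t : R, [/\ 0 <= t <= 1,
  z.1 = a.1 + t * (b.1 - a.1) & z.2 = a.2 + t * (b.2 - a.2)].
Proof.
split; first by case=> t; rewrite /= in_itv /= => t01 <-; exists t.
case=> t [t01 h1 h2]; exists t; first by rewrite /= in_itv.
by rewrite [RHS]surjective_pairing h1 h2.
Qed.

Let segP u v z : seg (p u) (p v) z -> (pos u < pos v)%N ->
  z.2 = (x u + x v) * z.1 - x u * x v /\ x u <= z.1 <= x v.
Proof.
move=> /seg_coord[t [/andP[t0 t1] -> ->]] uv.
have xuv : x u < x v by rewrite /x ltr_nat.
rewrite /p /=; split; first by ring.
by apply/andP; split; nra.
Qed.

Let seg_sym (a b : plane) : seg a b `<=` seg b a.
Proof.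
move=> z /seg_coord[t [/andP[t0 t1] h1 h2]]; apply/seg_coord; exists (1 - t).
by split; [apply/andP; split; lra|rewrite h1; ring|rewrite h2; ring].
Qed.

Let adj_pos u v : adj G u v -> pos u != pos v.
Proof.
move=> uv; have /forallP/(_ [set u; v]%SET)/implyP/(_ uv) := edges_card2 G.
by rewrite finset.cards2; case: (eqVneq u v) => [//|uv' _]; apply: contra uv' => /eqP/posI ->.
Qed.

Let A_seg u v : adj G u v -> A [set u; v]%SET = seg (p u) (p v).
Proof.
move=> /adj_pos uv; apply/seteqP; split => z.
  case=> u' [v' [E u'v' sz]].
  have ne : u' != v' by apply: contraTneq u'v' => ->; rewrite ltnn.
  have uE : u' \in [set u; v]%SET by rewrite E finset.set21.
  have vE : v' \in [set u; v]%SET by rewrite E finset.set22.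
  move: uE vE; rewrite !finset.in_set2.
  case/orP=> /eqP E1 /orP[]/eqP E2; subst u' v'; rewrite ?eqxx // in ne.
  by apply: seg_sym.
move=> sz; case: (ltngtP (pos u) (pos v)) uv => // uv _.
  by exists u, v.
by exists v, u; split; [rewrite finset.setUC| |apply: seg_sym].
Qed.

Let drawing : is_drawing G p A.
Proof.
have Edge e z : A e z -> exists u v, [/\ e = [set u; v]%SET, (pos u < pos v)%N,
    z.2 = (x u + x v) * z.1 - x u * x v & x u <= z.1 <= x v].
  by case=> u [v [-> uv /segP/(_ uv) [h1 h2]]]; exists u, v.
split.
- exact: pI.
- move=> u v uv; exists (fun t : R => p u + t *: (p v - p u)); split.
  + apply: continuous_subspaceT => t; apply: cvgD; first exact: cvg_cst.
    exact: scalel_continuous.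
  + move=> s t _ _ /addrI /eqP; rewrite -subr_eq0 -scalerBl scaler_eq0 !subr_eq0.
    case/orP => [/eqP //|/eqP/pI vu].
    by have := adj_pos uv; rewrite vu eqxx.
  + by rewrite scale0r addr0.
  + by rewrite scale1r addrC subrK.
  + exact: A_seg.
- move=> e w eG /Edge[u [v [-> uv /= E _]]].
  have /eqP : (x w - x u) * (x w - x v) = 0 by move: E; rewrite expr2 => E; nra.
  rewrite mulf_eq0 !subr_eq0 finset.in_set2 => /orP[]/eqP/xI ->; by rewrite eqxx ?orbT.
- move=> e f eG fG ef z [/Edge[u [v [eE uv Y1 /andP[l1 r1]]]] /Edge[u' [v' [fE uv' Y2 /andP[l2 r2]]]]].
  have euv : adj G u v by rewrite /adj -eE.
  have euv' : adj G u' v' by rewrite /adj -fE.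
  have onp w : z.1 = x w -> z.2 = x w ^+ 2 -> range p z.
    by move=> h1 h2; exists w => //; rewrite [RHS]surjective_pairing h1 h2.
  have cs : [\/ (pos v <= pos u')%N, (pos v' <= pos u)%N,
      (pos u <= pos u')%N && (pos v' <= pos v)%N | (pos u' <= pos u)%N && (pos v <= pos v')%N].
    have h1 := nc euv euv'; have h2 := nc euv' euv.
    case: (leqP (pos v) (pos u')) => c1; first exact: Or41.
    case: (leqP (pos v') (pos u)) => c2; first exact: Or42.
    case: (ltngtP (pos u) (pos u')) => c3; case: (ltngtP (pos v') (pos v)) => c4 /=;
      by [apply: Or43|apply: Or44|exfalso; apply: h1|exfalso; apply: h2].
  (* For nested chords, the difference of the two equations is a vanishing sum of two nonnegative
     products. Both products vanish, which forces the common point to be an end. *)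
  have nest (a b c d : 'I_n) : (pos a < pos b)%N -> (pos c < pos d)%N ->
      (pos a <= pos c)%N && (pos d <= pos b)%N -> ((a != c) || (b != d)) ->
      z.2 = (x a + x b) * z.1 - x a * x b -> z.2 = (x c + x d) * z.1 - x c * x d ->
      x c <= z.1 -> z.1 <= x d -> range p z.
    move=> ab cd /andP[ac db] ne E1 E2 lc ld.
    have acR : x a <= x c by rewrite /x ler_nat.
    have dbR : x d <= x b by rewrite /x ler_nat.
    have S : (z.1 - x a) * (x b - x d) + (x c - x a) * (x d - z.1) = 0.
      by move: E2; rewrite E1 => E; nra.
    have p1 : 0 <= (z.1 - x a) * (x b - x d) by apply: mulr_ge0; lra.
    have p2 : 0 <= (x c - x a) * (x d - z.1) by apply: mulr_ge0; lra.
    have /eqP : (z.1 - x a) * (x b - x d) = 0 by lra.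
    have /eqP : (x c - x a) * (x d - z.1) = 0 by lra.
    rewrite !mulf_eq0 !subr_eq0 => /orP[/eqP/xI ca|/eqP dz] /orP[/eqP za|/eqP/xI bd].
    + by apply: (onp a) => //; rewrite E1 za; ring.
    + by rewrite ca bd !eqxx in ne.
    + by apply: (onp a) => //; rewrite E1 za; ring.
    + by apply: (onp d); rewrite ?E2 -?dz //; ring.
  have ne : (u != u') || (v != v').
    by rewrite -negb_and; apply: contra ef => /andP[/eqP uu /eqP vv]; rewrite eE fE uu vv.
  case: cs => [c|c|c|c].
  + have cR : x v <= x u' by rewrite /x ler_nat.
    by apply: (onp v); [lra|rewrite Y1 (_ : z.1 = x v); [ring|lra]].
  + have cR : x v' <= x u by rewrite /x ler_nat.
    by apply: (onp u); [lra|rewrite Y1 (_ : z.1 = x u); [ring|lra]].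
  + exact: (nest u v u' v').
  + by apply: (nest u' v' u v) => //; rewrite (eq_sym u') (eq_sym v').
Qed.

Let below : set plane := [set z | z.2 < z.1 ^+ 2].

Let below_support : below `<=` ~` drawing_support G p A.
Proof.
move=> z zb [[v _ E]|[e eG [u [v [_ uv /segP/(_ uv)[E /andP[l r]]]]]]].
  by move: zb; rewrite /below /= -E /= ltxx.
by move: zb; rewrite /below /= E; nra.
Qed.

Let x0 : plane := (0, -1).

Let below_component : below `<=` connected_component (~` drawing_support G p A) x0.
Proof.
move=> z zb.
(* The curve keeps below the parabola: its depth [(1 - t) + t * (z.1 ^+ 2 - z.2)] interpolates
   between the depth 1 of [x0] and that of [z]. *)
pose g (t : R) : plane := (t * z.1, (t * z.1) * (t * z.1) - ((1 - t) + t * (z.1 ^+ 2 - z.2))).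
exists (g @` `[0, 1]).
  split.
  - by exists 0; rewrite /= ?in_itv /= ?lexx ?ler01 // /g /x0; congr (_, _); ring.
  - move=> w [t]; rewrite /= in_itv /= => /andP[t0 t1] <-; apply: below_support.
    rewrite /below /= /g /=; move: zb; rewrite /below /= => zb.
    have [->|tn0] := eqVneq t 0; first by lra.
    have : 0 < t by rewrite lt_neqAle eq_sym tn0.
    by move=> tp; nra.
  - apply: connected_continuous_connected; first exact: segment_connected.
    apply: continuous_subspaceT => t; rewrite /g.
    have c1 : (fun t : R => t * z.1) @ t --> t * z.1 by apply: cvgM; [exact: cvg_id|exact: cvg_cst].
    have c2 : (fun t : R => (t * z.1) * (t * z.1) - ((1 - t) + t * (z.1 ^+ 2 - z.2))) @ t -->
        (t * z.1) * (t * z.1) - ((1 - t) + t * (z.1 ^+ 2 - z.2)).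
      apply: cvgB; first exact: cvgM.
      apply: cvgD; first by apply: cvgB; [exact: cvg_cst|exact: cvg_id].
      by apply: cvgM; [exact: cvg_id|exact: cvg_cst].
    exact: (cvg_pair c1 c2).
- exists 1; first by rewrite /= in_itv /= lexx ler01.
  by rewrite [RHS]surjective_pairing /g; congr (_, _); ring.
Qed.

(** With straight edges between points of the parabola, the region below it is connected, unbounded
    and free of the drawing, and every vertex lies on its boundary. *)
Theorem noncrossing_outerplanar : outerplanar R G.
Proof.
exists p, A; split; first exact: drawing.
have b0 : below x0 by rewrite /below /x0 /= expr0n /= ltrN10.
exists (connected_component (~` drawing_support G p A) x0); first split.
- by exists x0 => //; apply: below_support.
- case=> M [_ HM]; pose N := Num.max M 0 + 1.
  have MN : M < N by rewrite /N ltr_pwDr // le_max lexx.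
  have HN : forall w : plane, connected_component (~` drawing_support G p A) x0 w -> `|w| <= N.
    exact: HM MN.
  have N0 : 0 < N by rewrite /N ltr_wpDl // le_max lexx orbT.
  have H : below (0, - (N + 1)) by rewrite /below /= expr0n /=; lra.
  have := HN _ (below_component H); rewrite prod_normE /= normr0 normrN ge_max => /andP[_].
  by rewrite ger0_norm; lra.
- move=> v B /nbhs_ballP[e /= e0 eB].
  exists (x v, x v ^+ 2 - e / 2); split.
    by apply: below_component; rewrite /below /=; have := divr_gt0 e0 (ltr0Sn R 1); lra.
  apply: eB; rewrite ball_prod_normE /ball_ /= prod_normE /= subrr normr0 gt_max e0 /=.
  by rewrite opprB addrC subrK ger0_norm; lra.
Qed.
End ParabolaDrawing.

Local Close Scope classical_set_scope.
Local Close Scope ring_scope.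

(** * Codes *)

Section Isomorphism.
Variable n : nat.
Implicit Types G H : sgraph n.

Lemma adj_sym G : symmetric (adj G).
Proof. by move=> u v; rewrite /adj finset.setUC. Qed.

Lemma edge_card G (e : {set 'I_n}) : e \in edges G -> #|e| = 2.
Proof. by move=> eG; have /forallP/(_ e)/implyP/(_ eG)/eqP := edges_card2 G. Qed.

Lemma adj_irr G : irreflexive (adj G).
Proof. by move=> u; apply/negP => /edge_card; rewrite cards2 eqxx. Qed.

Lemma isomorphicP G H : reflect (exists s : {perm 'I_n}, forall u v, adj H (s u) (s v) = adj G u v)
  (isomorphic G H).
Proof.
have im2 (s : {perm 'I_n}) u v : [set s x | x in [set u; v]]%SET = [set s u; s v]%SET.
  by rewrite imsetU1 imset_set1.
apply: (iffP existsP) => -[s].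
  move=> /eqP E; exists s => u v; rewrite /adj E -im2.
  by apply: mem_imset => A B; apply: imset_inj; exact: perm_inj.
move=> E; exists s; apply/eqP/setP => e; apply/idP/imsetP => [eH|[f fG ->]].
  have /cards2P[u [v [uv eE]]] : #|e| == 2 by rewrite (edge_card eH).
  exists [set (s^-1)%g u; (s^-1)%g v]%SET; last by rewrite im2 !permKV.
  by rewrite -[_ \in _]/(adj G _ _) -E !permKV /adj -eE.
have /cards2P[u [v [uv fE]]] : #|f| == 2 by rewrite (edge_card fG).
by rewrite fE im2 -[_ \in _]/(adj H _ _) E /adj -fE.
Qed.

Lemma isomorphic_refl : reflexive (@isomorphic n).
Proof. by move=> G; apply/isomorphicP; exists 1%g => u v; rewrite !perm1. Qed.

Lemma isomorphic_sym : symmetric (@isomorphic n).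
Proof.
have S G H : isomorphic G H -> isomorphic H G.
  move=> /isomorphicP[s E]; apply/isomorphicP; exists (s^-1)%g => u v.
  by rewrite -E !permKV.
by move=> G H; apply/idP/idP; apply: S.
Qed.

Lemma isomorphic_trans : transitive (@isomorphic n).
Proof.
move=> H G K /isomorphicP[s E] /isomorphicP[t F]; apply/isomorphicP.
by exists (s * t)%g => u v; rewrite !permM F E.
Qed.
End Isomorphism.

Section Codes.
Variable n : nat.
(* Position [i] of a code holds the number of vertices [v] whose first lower
   neighbour is [i], and whether the last of them has a second one. *)
Definition code := {ffun 'I_n -> 'I_n.+1 * bool}.
Implicit Types x y : code.

Definition cnt x (i : nat) : nat := if insub i is Some j then (x j).1 else 0.
Definition bit x (i : nat) : bool := if insub i is Some j then (x j).2 else false.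
Definition csum x (i : nat) := \sum_(j < i) cnt x j.
(** The partial sums satisfy [i <= csum x i] because the vertices numbered up to [i] have their
    first lower neighbour below [i]. A bit refers to the last vertex counted at its position, so the
    count there must be positive. *)
Definition valid x := [&& [forall i : 'I_n.+1, i <= csum x i], csum x n == n
  & [forall i, (x i).2 ==> (0 < (x i).1)]].

Lemma cnt_ord x (i : 'I_n) : cnt x i = (x i).1.
Proof. by rewrite /cnt valK. Qed.
Lemma bit_ord x (i : 'I_n) : bit x i = (x i).2.
Proof. by rewrite /bit valK. Qed.
Lemma code_ext x y : (forall i, i < n -> cnt x i = cnt y i /\ bit x i = bit y i) -> x = y.
Proof.
move=> E; apply/ffunP => i; have [] := E i (ltn_ord i).
by rewrite !cnt_ord !bit_ord; case: (x i) (y i) => a b [c d] /= /ord_inj -> ->.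
Qed.

Lemma validP x : valid x -> [/\ forall i, i <= n -> i <= csum x i, csum x n = n
  & forall i, bit x i -> 0 < cnt x i].
Proof.
case/and3P=> /forallP h1 /eqP h2 /forallP h3; split => //.
  by move=> i; rewrite -ltnS => i_n; apply: (h1 (Ordinal i_n)).
move=> i; rewrite /bit /cnt; case: insubP => // j _ _; exact/implyP.
Qed.

Section OfStaircase.
Variables (e : rel 'I_n) (num p : 'I_n -> nat) (link : 'I_n -> bool).
Hypothesis st : staircase e num p link.

Definition code_of : code := [ffun i : 'I_n => (inord #|[set v | p v == i]|, [exists v, (p v == i) && link v])].

Lemma num_card i : i <= n -> #|[set v | num v <= i]%SET| = i.
Proof.
have [numI num1 _ _ _] := st; move=> i_n.
have numn v : (num v).-1 < n by have := num1 v; rewrite card_ord; lia.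
pose g v := Ordinal (numn v).
have gI : injective g.
  move=> u v /(congr1 val) /= E; apply: numI.
  by have := num1 u; have := num1 v; move: E; lia.
have -> : [set v | num v <= i]%SET = (g @^-1: [set j : 'I_n | j < i])%SET.
  by apply/setP => v; rewrite !inE /=; have := num1 v; clear; lia.
rewrite card_preimset //.
have -> : [set j : 'I_n | j < i]%SET = [set widen_ord i_n j | j in 'I_i]%SET.
  apply/setP => j; rewrite inE; apply/idP/imsetP => [ji|[j' _ ->]] /=; last exact: ltn_ord.
  by exists (Ordinal ji) => //; apply: val_inj.
by rewrite card_imset ?card_ord // => a b /(congr1 val) /= /ord_inj.
Qed.

Lemma csum_code i : i <= n -> csum code_of i = #|[set v | p v < i]%SET|.
Proof.
elim: i => [|i IH] i_n.
  by rewrite /csum big_ord0; apply/esym/eqP; rewrite cards_eq0; apply/eqP/setP => v; rewrite !inE ltn0.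
rewrite /csum big_ord_recr /= -/(csum _ _) IH; last exact: ltnW.
rewrite (cnt_ord code_of (Ordinal i_n)) ffunE /= inordK; last first.
  by rewrite ltnS -[X in _ <= X]card_ord max_card.
rewrite -cardsUI [X in _ + X](_ : _ = 0) ?addn0.
  by apply: eq_card => v; rewrite !inE; clear; lia.
by apply/eqP; rewrite cards_eq0; apply/eqP/setP => v; rewrite !inE; apply/negbTE; case: ltngtP.
Qed.

(** Since [p] is monotone in [num], the vertices with [p v < i] are the first [csum code_of i] ones;
    so the code and the number of [v] determine [p v]. *)
Lemma parent_lt i v : i <= n -> (p v < i) = (num v <= csum code_of i).
Proof.
have [numI num1 pn mono _] := st; move=> i_n; rewrite csum_code //.
have vn : num v <= n by have := num1 v; rewrite card_ord => /andP[].
apply/idP/idP => [pi|].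
  rewrite -[X in X <= _](num_card vn); apply: subset_leq_card.
  apply/fintype.subsetP => w; rewrite !inE leq_eqVlt => /predU1P[/numI ->//|/mono].
  by move: pi; clear; lia.
apply: contraTT; rewrite -leqNgt -ltnNge => ip.
have v1 : (num v).-1 <= n by lia.
apply: (@leq_ltn_trans (num v).-1); last by have := num1 v; lia.
rewrite -[X in _ <= X](num_card v1); apply: subset_leq_card.
apply/fintype.subsetP => w; rewrite !inE => wi.
suff : num w < num v by lia.
rewrite ltnNge leq_eqVlt; apply/negP => /predU1P[/numI vw|/mono].
  by move: ip; rewrite vw; lia.
by move: ip wi; clear; lia.
Qed.

Lemma parent_bound v : p v < n.
Proof. by have [_ num1 pn _ _] := st; have := num1 v; have := pn v; rewrite card_ord; lia. Qed.

(** By monotonicity any vertex after a linked one has a larger [p]. So only the last vertex with a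
    given [p] can be linked, and one bit per position records this. *)
Lemma link_code v : link v = bit code_of (p v) && (num v == csum code_of (p v).+1).
Proof.
have [numI num1 pn mono _] := st.
have last_link w : link w -> num w = csum code_of (p w).+1.
  move=> lw; have pw := parent_bound w; apply/eqP; rewrite eqn_leq.
  rewrite -parent_lt // ltnSn csum_code //=.
  have wn : num w <= n by have := num1 w; rewrite card_ord => /andP[].
  rewrite -[X in _ <= X](num_card wn); apply: subset_leq_card.
  apply/fintype.subsetP => u; rewrite !inE => uw; rewrite leqNgt; apply/negP => /mono.
  by rewrite lw; move: uw; clear; lia.
rewrite (bit_ord code_of (Ordinal (parent_bound v))) ffunE /=.
apply/idP/andP => [lv|[/existsP[w /andP[/eqP pw lw]] /eqP nv]].
  by rewrite -last_link //; split => //; apply/existsP; exists v; rewrite eqxx.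
suff <- : w = v by [].
by apply: numI; rewrite nv last_link // pw.
Qed.

Lemma code_valid : valid code_of.
Proof.
have [numI num1 pn mono _] := st.
apply/and3P; split.
- apply/forallP => i; have i_n : i <= n by rewrite -ltnS.
  rewrite csum_code // -[X in X <= _](num_card i_n); apply: subset_leq_card.
  by apply/fintype.subsetP => v; rewrite !inE; apply: leq_trans.
- rewrite csum_code // (_ : [set v | _]%SET = finset.setT) ?cardsT ?card_ord //.
  by apply/setP => v; rewrite !inE parent_bound.
- apply/forallP => i; rewrite ffunE /=; apply/implyP => /existsP[v /andP[pv _]].
  rewrite inordK; last by rewrite ltnS -[X in _ <= X]card_ord max_card.
  by apply/card_gt0P; exists v; rewrite inE.
Qed.
End OfStaircase.

(** Match the vertices by their numbers: the code gives [p] and [link], and these give the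
    adjacency. *)
Theorem code_of_inj (G H : sgraph n) num p link num' p' link' :
  staircase (adj G) num p link -> staircase (adj H) num' p' link' ->
  code_of p link = code_of p' link' -> isomorphic G H.
Proof.
move=> sG sH E.
have [numI num1 pn mono adjG] := sG; have [numI' num1' pn' mono' adjH] := sH.
have ex v : exists w, num' w = num v.
  have nv : num v <= n by have := num1 v; rewrite card_ord => /andP[].
  have [v0 vn] : 0 < num v /\ (num v).-1 <= n by have := num1 v; lia.
  have : ~~ ([set w | num' w <= num v] \subset [set w | num' w <= (num v).-1])%SET.
    apply/negP => /subset_leq_card; rewrite (num_card sH) // (num_card sH) //.
    by lia.
  by case/subsetPn => w; rewrite !inE => h1 h2; exists w; lia.
have [s sE] := choice ex.
have sI : injective s by move=> u v uv; apply: numI; rewrite -!sE uv.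
have pE v : p' (s v) = p v.
  have lt i : i <= n -> (p v < i) = (p' (s v) < i).
    by move=> i_n; rewrite (parent_lt sG) // (parent_lt sH) // sE E.
  have h1 := parent_bound sG v; have h2 := parent_bound sH (s v).
  by have := lt _ h1; have := lt _ h2; lia.
have lE v : link' (s v) = link v by rewrite (link_code sG) (link_code sH) pE sE E.
have key u v : num v < num u -> adj H (s u) (s v) = adj G u v.
  by move=> vu; rewrite adjG // adjH ?sE // pE lE.
apply/isomorphicP; exists (perm sI) => u v; rewrite !permE.
case: (ltngtP (num v) (num u)) => [|uv|/numI ->]; first exact: key.
  by rewrite adj_sym key // adj_sym.
by rewrite !adj_irr.
Qed.
End Codes.

(** * Outerplanar graphs from codes *)

Section Chords.
Variables (n : nat) (x : code n).
Hypothesis vx : valid x.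

(* Not truncated for [i <= n.+1]: these are the heights of a Lukasiewicz path,
   which starts at 1 and reaches 0 for the first time at [n.+1]. *)
Definition hgt i := (csum x i).+1 - i.

(* [i] is joined to the first later return to each of the levels from [hgt i] to
   [(hgt i.+1).-1] and, if its bit is set, to the first descent below [hgt i].
   Hence the chords at [i] give back [cnt x i] and [bit x i]. *)
Definition chord i j := [&& i.+1 < j, j <= n.+1,
  [forall t : 'I_n.+2, (i < t < j) ==> (hgt j < hgt t)] &
  (hgt i <= hgt j) || bit x i && (hgt i == (hgt j).+1)].

Lemma chordP i j : reflect [/\ i.+1 < j, j <= n.+1, forall t, i < t < j -> hgt j < hgt t &
  hgt i <= hgt j \/ bit x i /\ hgt i = (hgt j).+1] (chord i j).
Proof.
apply: (iffP and4P) => -[h1 h2 h3 h4]; split => //.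
- move=> t /[dup] tij /andP[_ tj]; have tn : t < n.+2 by lia.
  by have /forallP/(_ (Ordinal tn))/implyP := h3; apply.
- by case/orP: h4 => [|/andP[b /eqP]]; [left|right].
- by apply/forallP => t; apply/implyP; apply: h3.
- by case: h4 => [->//|[-> ->]]; rewrite eqxx orbT.
Qed.

Lemma csumS i : csum x i.+1 = csum x i + cnt x i.
Proof. by rewrite /csum big_ord_recr. Qed.

Lemma cnt_ge i : n <= i -> cnt x i = 0.
Proof. by move=> ni; rewrite /cnt insubF // ltnNge ni. Qed.

Lemma csum_ge i : i <= n -> i <= csum x i.
Proof. by have [h _ _] := validP vx; apply: h. Qed.

Lemma hgt0 : hgt 0 = 1. Proof. by rewrite /hgt /csum big_ord0. Qed.

Lemma hgt_pos i : i <= n -> 0 < hgt i.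
Proof. by move=> /csum_ge; rewrite /hgt; lia. Qed.

Lemma hgt_last : hgt n.+1 = 0.
Proof. by have [_ h _] := validP vx; rewrite /hgt csumS h cnt_ge //; lia. Qed.

Lemma hgtS i : i <= n -> (hgt i.+1).+1 = hgt i + cnt x i.
Proof. by move=> /csum_ge; rewrite /hgt csumS; lia. Qed.

Lemma chord_noncrossing i j i' j' : chord i j -> chord i' j' -> i < i' -> i' < j -> j < j' -> False.
Proof.
move=> /chordP[_ _ h _] /chordP[_ _ h' c'] ii' i'j jj'.
have h1 := h i'; have h2 := h' j; case: c' => [|[_]]; lia.
Qed.

(** Going back from [i], the search ends at 0 at the latest, because [hgt 0] is 1. *)
Lemma prev_low i j : 0 < i -> hgt j < hgt i -> 0 < hgt j ->
  exists2 q, q < i & hgt q <= hgt j /\ forall t, q < t <= i -> hgt j < hgt t.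
Proof.
move=> i0 hi hj; elim: i i0 hi => // i IH _ hi.
have [le|gt] := leqP (hgt i) (hgt j).
  exists i => //; split => // t ti; have -> : t = i.+1 by lia.
  exact: hi.
have i0 : 0 < i by case: i {IH hi} gt => //; rewrite hgt0; lia.
have [q qi [hq qt]] := IH i0 gt; exists q; first lia.
split => // t /andP[qt' ti]; case: (ltngtP t i.+1) => [ti'|ti'|-> //]; last lia.
by apply: qt; lia.
Qed.

(** Heights drop by at most 1 per step, so no level is skipped on the way down to 0 at [n.+1]. *)
Lemma next_level i l : i <= n -> l < hgt i ->
  exists2 j, i < j <= n.+1 & hgt j = l /\ forall t, i <= t < j -> l < hgt t.
Proof.
move=> i_n; have [k kE] : exists k, k = n - i by exists (n - i).
elim: k i i_n kE => [|k IH] i i_n kE li.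
  have iE : i = n by lia.
  exists n.+1; first lia.
  have := hgtS (leqnn n); rewrite hgt_last cnt_ge // addn0 -iE => h1.
  by split => [|t ti]; [lia|have -> : t = i by lia].
have [le|gt] := leqP (hgt i.+1) l.
  exists i.+1; first lia.
  have := hgtS i_n => h1; split => [|t ti]; first by lia.
  by have -> : t = i by lia.
have [|||j ij [hj jt]] := IH i.+1; [lia|lia|exact: gt|].
exists j; first lia.
split => // t /andP[it tj]; case: (ltngtP t i) => [ti|ti|-> //]; first lia.
by apply: jt; lia.
Qed.

(** Needed because the number of level chords is [(cnt x i).-1], which does not tell 0 from 1. *)
Lemma cnt0_chord i : i < n -> (cnt x i == 0) <-> exists q, chord q i.+1.
Proof.
move=> i_n; have hS := hgtS (ltnW i_n); split.
  move=> /eqP c0; have p1 := hgt_pos i_n.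
  have i0 : 0 < i.
    by case: i hS c0 p1 {i_n} => // ; rewrite hgt0 => h1 h2; rewrite h2 in h1; lia.
  have [||q qi [hq qt]] := @prev_low i i.+1 i0; [lia|by []|].
  exists q; apply/chordP; split; [lia|lia| |by left].
  by move=> t ti; apply: qt; lia.
case=> q /chordP[h1 _ /(_ i) h2 _].
by have {}h2 : hgt i.+1 < hgt i by [apply: h2; lia]; apply/eqP; lia.
Qed.

(** Recognises the chords that come from a bit by the set of chords alone, without knowing heights:
    a descending chord ends at [n.+1], or a chord from further left ends at the same place. *)
Lemma chord_bit i j : chord i j ->
  (hgt j < hgt i) <-> (j = n.+1 \/ exists2 q, q < i & chord q j).
Proof.
move=> /chordP[h1 h2 h3 h4]; split.
  move=> hji; case: (ltngtP j n.+1) => [jn|jn|->]; [right|lia|by left].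
  have p1 := hgt_pos (jn : j <= n).
  have i0 : 0 < i by case: (i) hji => //; rewrite hgt0; lia.
  have [q qi [hq qt]] := prev_low i0 hji p1.
  exists q => //; apply/chordP; split; [lia|lia| |by left].
  move=> t ti; case: (leqP t i) => it; first by apply: qt; lia.
  by apply: h3; lia.
case=> [->|[q qi /chordP[_ _ q3 _]]]; last by apply: q3; lia.
by rewrite hgt_last; apply: hgt_pos; lia.
Qed.

Definition level_chords i := [seq j <- iota 0 n.+2 | chord i j && (hgt i <= hgt j)].

Lemma size_level_chords i : i < n -> size (level_chords i) = (cnt x i).-1.
Proof.
move=> i_n; have hS := hgtS (ltnW i_n).
rewrite -(size_map hgt) -[RHS](size_iota (hgt i)); apply: perm_size.
apply: uniq_perm; rewrite ?iota_uniq //.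
  rewrite map_inj_in_uniq ?filter_uniq ?iota_uniq // => j j'.
  rewrite !mem_filter => /andP[/andP[/chordP[a1 a2 a3 a4] _] _] /andP[/andP[/chordP[b1 b2 b3 b4] _] _].
  by move=> E; case: (ltngtP j j') => // jj; [have := b3 j|have := a3 j']; lia.
move=> l; rewrite mem_iota; apply/mapP/andP.
  case=> j; rewrite mem_filter => /andP[/andP[/chordP[a1 a2 a3 a4] ij] _] ->.
  by split => //; have := a3 i.+1; lia.
move=> [l1 l2]; have [||j ij [hj jt]] := @next_level i.+1 l; [lia|lia|].
exists j => //; rewrite mem_filter hj l1 andbT mem_iota; apply/andP; split; last lia.
apply/chordP; split; rewrite ?hj; [lia|lia| |by left].
by move=> t ti; apply: jt; lia.
Qed.

Lemma bit_chord i : i < n -> bit x i <-> exists2 j, chord i j & hgt j < hgt i.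
Proof.
move=> i_n; have hS := hgtS (ltnW i_n); split; last first.
  by case=> j /chordP[_ _ _ [|[]//]]; lia.
move=> b; have [_ _ /(_ _ b) c0] := validP vx; have p1 := hgt_pos (ltnW i_n).
have [||j ij [hj jt]] := @next_level i.+1 (hgt i).-1; [lia|lia|].
exists j; last lia.
apply/chordP; split; [lia|lia| |by right; split; lia].
by move=> t ti; rewrite hj; apply: jt; lia.
Qed.
End Chords.

(** By [chord_bit] the two codes agree on which chords descend. The others at [i], with
    [cnt0_chord], give the count, and a descending one gives the bit. *)
Lemma chord_inj n (x y : code n) : valid x -> valid y -> chord x =2 chord y -> x = y.
Proof.
move=> vx vy E.
have B i j : chord x i j -> (hgt x j < hgt x i) = (hgt y j < hgt y i).
  move=> xij; have yij : chord y i j by rewrite -E.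
  apply/idP/idP.
    move/(chord_bit vx xij) => H; apply/(chord_bit vy yij).
    by case: H => [->|[q qi qj]]; [left|right; exists q; rewrite // -E].
  move/(chord_bit vy yij) => H; apply/(chord_bit vx xij).
  by case: H => [->|[q qi qj]]; [left|right; exists q; rewrite // E].
apply: code_ext => i i_n; split.
  have z : (cnt x i == 0) = (cnt y i == 0).
    apply/idP/idP.
      by move/(cnt0_chord vx i_n) => [q qi]; apply/(cnt0_chord vy i_n); exists q; rewrite -E.
    by move/(cnt0_chord vy i_n) => [q qi]; apply/(cnt0_chord vx i_n); exists q; rewrite E.
  have := size_level_chords vx i_n; have := size_level_chords vy i_n.
  have -> : level_chords x i = level_chords y i.
    apply: eq_filter => j; rewrite E; case yij : (chord y i j) => //=.
    by rewrite leqNgt B ?E // -leqNgt.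
  by move: z; move: (size _); lia.
apply/idP/idP.
  move/(bit_chord vx i_n) => [j ij hj]; apply/(bit_chord vy i_n); exists j; rewrite -?E //.
  by rewrite -B.
move/(bit_chord vy i_n) => [j ij hj]; apply/(bit_chord vx i_n); exists j; rewrite ?E //.
by rewrite B // E.
Qed.

Section MkGraph.
Variables (n : nat) (r : rel 'I_n).
Definition mk_edges := [set e : {set 'I_n} | [exists u, exists v, [&& u != v, r u v & e == [set u; v]]]]%SET.

Lemma mk_edges_card2 : [forall e in mk_edges, #|e| == 2].
Proof.
apply/forallP => e; apply/implyP; rewrite inE => /existsP[u /existsP[v /and3P[uv _ /eqP ->]]].
by rewrite cards2 uv.
Qed.

Definition mk_graph : sgraph n := SGraph mk_edges_card2.

Lemma adj_mk u v : adj mk_graph u v = (u != v) && (r u v || r v u).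
Proof.
rewrite /adj inE; apply/existsP/andP => [[a /existsP[b /and3P[ab rab /eqP E]]]|[uv ruv]].
  have ua : u \in [set a; b]%SET by rewrite -E set21.
  have va : v \in [set a; b]%SET by rewrite -E set22.
  have uv : u != v.
    by apply: contraTneq ab => uv; have := cards2 a b; rewrite -E uv cards2 eqxx; case: (a != b).
  split => //; move: ua va uv; rewrite !in_set2 => /orP[]/eqP-> /orP[]/eqP->; by rewrite ?eqxx ?rab ?orbT.
case/orP: ruv => [ruv|rvu].
  by exists u; apply/existsP; exists v; rewrite uv ruv eqxx.
by exists v; apply/existsP; exists u; rewrite eq_sym uv rvu finset.setUC eqxx.
Qed.
End MkGraph.

(** * Rigid graphs: a cycle with chords and pendant vertices *)

Section Core.
Variable k : nat.
Local Notation K := k.+3.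
Implicit Types x y : code k.

(** The cycle has one vertex more than the path has positions, so that a possible chord from 0 to
    [k.+1] differs from the closing edge. *)
Definition darc x i j := [|| j == i.+1, (i == 0) && (j == K.-1) | chord x i j].
Definition cadj x i j := (i < j) && darc x i j || (j < i) && darc x j i.

Lemma cadj_sym x i j : cadj x i j = cadj x j i.
Proof. by rewrite /cadj orbC. Qed.

Lemma cadj_noncrossing x a b c d : valid x -> cadj x a b -> cadj x c d ->
  a < c -> c < b -> b < d -> d < K -> False.
Proof.
move=> vx ab cd ac cb bd dK; move: ab cd; rewrite /cadj /darc.
case/orP => /andP[ab']; last lia.
case/or3P => [|/andP[]|ab]; [lia|lia|].
case/orP => /andP[cd']; last lia.
case/or3P => [|/andP[]|cd]; [lia|lia|].
exact: (chord_noncrossing vx ab cd ac cb bd).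
Qed.

(* If [t i.+2 <> i.+2], the arc of the cycle from there on stays on one side of the
   chord from [i.+1] to [t i.+2] and cannot come back to 0. *)
Lemma core_rigid x y (t : nat -> nat) : valid y ->
  (forall i, i < K -> t i < K) -> (forall i j, i < K -> j < K -> t i = t j -> i = j) ->
  (forall a, a < K -> exists2 i, i < K & t i = a) ->
  (forall i j, i < K -> j < K -> cadj y (t i) (t j) = cadj x i j) ->
  t 0 = 0 -> t 1 = 1 -> forall i, i < K -> t i = i.
Proof.
move=> vy tK tI tS tE t0 t1; elim/ltn_ind => -[|[|i]] IH iK //.
have ti : t i.+1 = i.+1 by apply: IH; lia.
have fixed j : j <= i.+1 -> t j = j by move=> ji; apply: IH; lia.
set b := t i.+2; have bK : b < K by apply: tK.
have bne j : j <= i.+1 -> b != j.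
  by move=> ji; apply/eqP => bj; have := tI i.+2 j iK; rewrite (fixed j ji) => H; have := H _ bj; lia.
have ib : i.+1 < b by rewrite ltnNge; apply/negP => /bne; rewrite eqxx.
case: (ltngtP b i.+2) => // [bi|bi]; first lia.
exfalso.
have ch : cadj y i.+1 b by rewrite -ti /b tE //; [rewrite /cadj ltnSn /darc eqxx|lia].
have iK2 : i.+2 < K by lia.
have [s sK ts] := tS _ iK2.
have si : i.+2 < s.
  rewrite ltnNge leq_eqVlt; apply/negP => /orP[/eqP sE|sl].
    by rewrite sE in ts; move: bi; rewrite /b ts ltnn.
  by rewrite (fixed s) in ts; lia.
have inside r : s <= r -> r < K -> i.+1 < t r < b.
  elim: r => [|r IHr] sr rK; first lia.
  move: sr; rewrite leq_eqVlt => /predU1P[<-|sr]; first by rewrite ts bi ltnSn.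
  have /andP[h1 h2] := IHr sr (ltnW rK).
  have e : cadj y (t r) (t r.+1) by rewrite tE //; [rewrite /cadj ltnSn /darc eqxx|lia].
  have n1 : t r.+1 != i.+1 by apply/eqP => E; have := tI r.+1 i.+1 rK; rewrite E ti => /(_ _ erefl); lia.
  have n2 : t r.+1 != b by apply/eqP => E; have := tI r.+1 i.+2 rK iK E; lia.
  case: (ltngtP (t r.+1) i.+1) n1 => // c1 _.
    by exfalso; rewrite cadj_sym in e; apply: (cadj_noncrossing vy e ch).
  case: (ltngtP (t r.+1) b) n2 => // c2 _.
  by exfalso; apply: (cadj_noncrossing vy ch e) => //; apply: tK.
have /andP[h1 h2] : i.+1 < t K.-1 < b by apply: inside => //=; lia.
have e : cadj y 0 (t K.-1).
  by rewrite -[X in cadj y X]t0 tE //; rewrite /cadj /darc /= ?eqxx ?orbT.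
by apply: (cadj_noncrossing vy e ch) => //; lia.
Qed.

Lemma chord_cadj x i j : valid x -> i < j -> chord x i j = [&& i.+1 < j, ~~ ((i == 0) && (j == K.-1)), j < K & cadj x i j].
Proof.
move=> vx ij; rewrite /cadj ij /darc /= [j < i]ltnNge (ltnW ij) /= orbF.
apply/idP/and4P => [|[h1 h2 h3]]; last by case/or3P => //; [lia|rewrite (negbTE h2)].
move=> /[dup] c /(chordP vx)[h1 h2 _ _]; rewrite c !orbT h1; split => //=; [|lia].
by apply/negP => /andP[_ /eqP]; lia.
Qed.

Section Graph.
Variables (n : nat) (Kn : K <= n) (x : code k) (Y : {set 'I_K}).
Hypotheses (vx : valid x) (cY : #|Y| = n - K).

Definition att (v : nat) : nat := nth 0 [seq nat_of_ord w | w <- enum Y] (v - K).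

Definition drel (u v : nat) := (u < v) && (if v < K then darc x u v else (u < K) && (u == att v)).

Definition code_graph : sgraph n := mk_graph (fun u v : 'I_n => drel u v).

Lemma adj_code u v : adj code_graph u v = drel u v || drel v u.
Proof.
rewrite adj_mk; case: (eqVneq u v) => //= ->; by rewrite /drel ltnn.
Qed.

Let sY : size [seq nat_of_ord w | w <- enum Y] = n - K.
Proof. by rewrite size_map -cardE cY. Qed.

Lemma att_in v : K <= v < n -> exists2 w : 'I_K, w \in Y & att v = w.
Proof.
move=> vn; have : att v \in [seq nat_of_ord w | w <- enum Y] by rewrite mem_nth // sY; lia.
by case/mapP => y; rewrite mem_enum => yY ->; exists y.
Qed.

Lemma att_lt v : K <= v < n -> att v < K.
Proof. by case/att_in => y _ ->. Qed.

Lemma att_inj u v : K <= u < n -> K <= v < n -> att u = att v -> u = v.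
Proof.
move=> un vn /eqP; rewrite nth_uniq ?sY; [|lia|lia|].
  by move=> /eqP; lia.
by rewrite map_inj_uniq ?enum_uniq //; exact: ord_inj.
Qed.

Lemma att_surj (y : 'I_K) : y \in Y -> exists2 v, K <= v < n & att v = y.
Proof.
move=> yY; have yE : nat_of_ord y \in [seq nat_of_ord w | w <- enum Y] by rewrite map_f ?mem_enum.
exists (K + index (nat_of_ord y) [seq nat_of_ord w | w <- enum Y]).
  by move: yE; rewrite -index_mem sY; lia.
by rewrite /att addKn nth_index.
Qed.

Lemma adj_core (u v : 'I_n) : u < K -> v < K -> adj code_graph u v = cadj x u v.
Proof. by move=> uK vK; rewrite adj_code /drel uK vK. Qed.

Lemma adj_leaf (u v : 'I_n) : K <= v -> adj code_graph u v = (u == att v :> nat).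
Proof.
move=> Kv; rewrite adj_code /drel [v < K]ltnNge Kv /=.
have al : att v < K by apply: att_lt; rewrite Kv ltn_ord.
apply/orP/eqP => [[/and3P[_ _ /eqP //]|/andP[vu]]|uE].
  by rewrite ifN // -leqNgt (leq_trans Kv) // ltnW.
by left; rewrite uE al eqxx (leq_trans al Kv).
Qed.

Definition cpos (v : 'I_n) := if v < K then v.*2 else (att v).*2.+1.

Theorem code_graph_outerplanar (R : realType) : outerplanar R code_graph.
Proof.
apply: (@noncrossing_outerplanar R n code_graph cpos).
  move=> u v; rewrite /cpos; case: ltnP => uK; case: ltnP => vK E; apply: ord_inj; try lia.
  by apply: att_inj; rewrite ?uK ?vK ?ltn_ord //; lia.
move=> u v w z uv wz h1 h2 h3.
have leaf (a b : 'I_n) : K <= b -> adj code_graph a b -> cpos b = (cpos a).+1.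
  move=> Kb; rewrite adj_leaf // => /eqP ab.
  have al : att b < K by apply: att_lt; rewrite Kb ltn_ord.
  by rewrite /cpos ab al ltnNge Kb.
case: (leqP K u) => uK; first by have := leaf v u uK; rewrite adj_sym => /(_ uv); lia.
case: (leqP K v) => vK; first by have := leaf u v vK uv; lia.
case: (leqP K w) => wK; first by have := leaf z w wK; rewrite adj_sym => /(_ wz); lia.
case: (leqP K z) => zK; first by have := leaf w z zK wz; lia.
move: h1 h2 h3; rewrite /cpos uK vK wK zK !ltn_double => h1 h2 h3.
rewrite adj_core // in uv; rewrite adj_core // in wz.
exact: (cadj_noncrossing vx uv wz).
Qed.

(** Pendant vertices have a single neighbour, so isomorphisms preserve the cycle vertices. *)
Lemma core_degree (u : 'I_n) : u < K ->
  exists a b : 'I_n, [/\ a != b, adj code_graph u a & adj code_graph u b].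
Proof.
move=> uK; have nx (i : nat) : i < K -> i < n by lia.
have C (i : nat) (iK : i < K) : cadj x u i -> exists2 a : 'I_n, nat_of_ord a = i & adj code_graph u a.
  by move=> ui; exists (Ordinal (nx i iK)); rewrite // adj_core.
have [||a aE ua] := C (if u.+1 < K then u.+1 else 0).
- by case: ifP.
- rewrite /cadj /darc; case: (ltnP u.+1 K) => uK'; first by rewrite ltnSn eqxx.
  by have -> : nat_of_ord u = K.-1 by [lia]; rewrite /= eqxx.
have [||b bE ub] := C (if (nat_of_ord u == 0) then K.-1 else u.-1).
- by case: ifP => // _; lia.
- rewrite /cadj /darc; case: eqP => u0; first by rewrite u0 /= eqxx.
  by apply/orP; right; apply/andP; split; [lia|apply/or3P; apply: Or31; apply/eqP; lia].
exists a, b; split => //; apply/eqP => /(congr1 val) /=; rewrite aE bE.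
by case: ifP; case: eqP; lia.
Qed.
End Graph.

(** Degrees keep the cycle vertices apart from the pendant ones, and [core_rigid] makes [s] the
    identity on the former. Then the chords agree, hence the codes, and a cycle vertex carries a
    pendant vertex in both graphs or in neither. *)
Lemma code_graph_rigid n (Kn : K <= n) x y (X Y : {set 'I_K}) (s : {perm 'I_n}) :
  valid x -> valid y -> #|X| = n - K -> #|Y| = n - K ->
  (forall u v, adj (code_graph n y Y) (s u) (s v) = adj (code_graph n x X) u v) ->
  (forall u : 'I_n, u < 2 -> s u = u) -> x = y /\ X = Y.
Proof.
move=> vx vy cX cY sE s01.
have leaf_core z (Z : {set 'I_K}) (u : 'I_n) : valid z -> #|Z| = n - K -> K <= u ->
    ~ exists a b : 'I_n, [/\ a != b, adj (code_graph n z Z) u a & adj (code_graph n z Z) u b].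
  move=> vz cZ Ku [a [b [ab]]]; rewrite adj_sym (adj_leaf Kn vz cZ) // => /eqP aE.
  rewrite adj_sym (adj_leaf Kn vz cZ) // => /eqP bE; move: ab; apply/negP; rewrite negbK.
  by apply/eqP/ord_inj; rewrite aE bE.
have core u : (s u < K) = (u < K).
  apply/idP/idP => uK; rewrite ltnNge; apply/negP => Ku.
    have [a [b [ab ua ub]]] := core_degree Kn vy cY uK.
    apply: (leaf_core x X u vx cX Ku); exists (s^-1 a)%g, (s^-1 b)%g.
    by rewrite (inj_eq perm_inj) ab -!sE !permKV.
  have [a [b [ab ua ub]]] := core_degree Kn vx cX uK.
  apply: (leaf_core y Y (s u) vy cY Ku); exists (s a), (s b).
  by rewrite (inj_eq perm_inj) ab !sE.
have n0 : 0 < n by lia.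
pose o i : 'I_n := insubd (Ordinal n0) i.
have oE i : i < K -> nat_of_ord (o i) = i by move=> iK; rewrite val_insubd ifT //; lia.
have oV (u : 'I_n) : o u = u by apply: ord_inj; rewrite val_insubd ltn_ord.
pose t i := nat_of_ord (s (o i)).
have tid : forall i, i < K -> t i = i.
  apply: (core_rigid (x := x) vy).
  - by move=> i iK; rewrite /t core oE.
  - by move=> i j iK jK /ord_inj/perm_inj /(congr1 (@nat_of_ord _)); rewrite !oE.
  - move=> a aK; exists (s^-1 (o a))%g; last by rewrite /t oV permKV oE.
    by rewrite -core permKV oE.
  - move=> i j iK jK; rewrite /t -(adj_core y Y) ?core ?oE // sE adj_core ?oE //.
  - by rewrite /t s01 oE.
  - by rewrite /t s01 oE.
have sid (u : 'I_n) : u < K -> s u = u.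
  by move=> uK; apply: ord_inj; have := tid _ uK; rewrite /t oV.
have cE i j : i < K -> j < K -> cadj x i j = cadj y i j.
  move=> iK jK; rewrite -[in LHS](oE i iK) -[in LHS](oE j jK) -(adj_core x X) ?oE // -sE.
  by rewrite !sid ?oE // adj_core ?oE.
split.
  apply: chord_inj => // i j; case: (ltnP i j) => ij; last first.
    by apply/idP/idP => /chordP; [case/(_ vx)|case/(_ vy)]; lia.
  rewrite !chord_cadj //; case: (ltnP j K) => jK; rewrite ?andbF //.
  by rewrite cE //; apply: ltn_trans jK.
have sub z w (Z W : {set 'I_K}) (r : {perm 'I_n}) : valid z -> valid w ->
    #|Z| = n - K -> #|W| = n - K ->
    (forall u v, adj (code_graph n w W) (r u) (r v) = adj (code_graph n z Z) u v) ->
    (forall u : 'I_n, u < K -> r u = u) -> (forall u : 'I_n, (r u < K) = (u < K)) -> Z \subset W.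
  move=> vz vw cZ cW rE rid rc; apply/fintype.subsetP => v vZ.
  have [l /andP[Kl ln] lv] := att_surj Kn vz cZ vZ.
  pose l' := Ordinal ln; have vn : v < n by apply: leq_trans Kn.
  pose v' := Ordinal vn.
  have e : adj (code_graph n z Z) v' l' by rewrite (adj_leaf Kn vz cZ) //= lv.
  have Kr : K <= r l' by rewrite leqNgt rc -leqNgt.
  have v'K : v' < K by exact: (ltn_ord v).
  move: e; rewrite -rE (rid v' v'K) (adj_leaf Kn vw cW) //= => /eqP vE.
  have [|w' w'W] := att_in Kn vw cW (v := r l'); first by rewrite Kr ltn_ord.
  by rewrite -vE => /ord_inj ->.
apply/eqP; rewrite finset.eqEsubset (sub x y X Y s) //=.
apply: (sub y x Y X (s^-1)%g) => //.
- by move=> u v; rewrite -sE !permKV.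
- by move=> u uK; apply: (@perm_inj _ s); rewrite permKV sid.
- by move=> u; rewrite -core permKV.
Qed.
End Core.

(** * Counting *)

Definition ncodes n := #|[set x : code n | valid x]%SET|.

Section Concatenation.
Variables k m : nat.
Definition code_cat (x : code k) (y : code m) : code (k + m) := [ffun i => match fintype.split i with
  | inl j => (inord (x j).1, (x j).2) | inr j => (inord (y j).1, (y j).2) end].

Lemma cnt_cat x y i : cnt (code_cat x y) i = if i < k then cnt x i else cnt y (i - k).
Proof.
case: (ltnP i (k + m)) => im; last first.
  by rewrite /cnt !insubF ?if_same //; lia.
rewrite (cnt_ord (code_cat x y) (Ordinal im)) ffunE /fintype.split /=.
case: ltnP => ik /=.
  by rewrite inordK ?(cnt_ord x (Ordinal ik)) //; have := ltn_ord (x (Ordinal ik)).1; lia.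
have jm : i - k < m by lia.
rewrite (cnt_ord y (Ordinal jm)) (_ : Ordinal _ = Ordinal jm); last exact: val_inj.
by rewrite inordK //; have := ltn_ord (y (Ordinal jm)).1; lia.
Qed.

Lemma bit_cat x y i : bit (code_cat x y) i = if i < k then bit x i else bit y (i - k).
Proof.
case: (ltnP i (k + m)) => im; last first.
  by rewrite /bit !insubF ?if_same //; lia.
rewrite (bit_ord (code_cat x y) (Ordinal im)) ffunE /fintype.split /=.
case: ltnP => ik /=; first by rewrite (bit_ord x (Ordinal ik)).
have jm : i - k < m by lia.
by rewrite (bit_ord y (Ordinal jm)) (_ : Ordinal _ = Ordinal jm); last exact: val_inj.
Qed.

Lemma csum_cat x y i : csum (code_cat x y) i = if i <= k then csum x i else csum x k + csum y (i - k).
Proof.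
elim: i => [|i IH]; first by rewrite /csum !big_ord0.
rewrite csumS cnt_cat IH; case: (ltngtP i k) => ik /=.
- by rewrite csumS.
- by rewrite subSn ?csumS ?addnA // ltnW.
- by rewrite ik subSnn subnn csumS {3}/csum big_ord0.
Qed.

Lemma code_cat_valid x y : valid x -> valid y -> valid (code_cat x y).
Proof.
move=> /validP[x1 x2 x3] /validP[y1 y2 y3]; apply/and3P; split.
- apply/forallP => i; rewrite csum_cat; case: (leqP i k) => ik; first exact: x1.
  by have := y1 (i - k); rewrite x2; have := ltn_ord i; lia.
- rewrite csum_cat x2 addKn y2; case: leqP => // km.
  have m0 : m = 0%N by lia.
  by rewrite m0 addn0 x2.
- apply/forallP => i; rewrite -bit_ord -cnt_ord bit_cat cnt_cat.
  by case: ifP => _; apply/implyP; [apply: x3|apply: y3].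
Qed.

Lemma ncodes_super : ncodes k * ncodes m <= ncodes (k + m).
Proof.
rewrite /ncodes -cardsX.
rewrite -(card_in_imset (f := fun p => code_cat p.1 p.2)).
  apply: subset_leq_card; apply/fintype.subsetP => z /imsetP[[x y]]; rewrite !inE /= => /andP[vx vy] ->.
  exact: code_cat_valid.
move=> [x y] [x' y'] _ _ /= E; congr (_, _); apply: code_ext => i im.
  have := cnt_cat x y i; have := bit_cat x y i; rewrite E cnt_cat bit_cat im => -> ->.
  by [].
have := cnt_cat x y (k + i); have := bit_cat x y (k + i).
by rewrite E cnt_cat bit_cat ltnNge leq_addr /= addKn => -> ->.
Qed.
End Concatenation.

Lemma ncodes_gt0 n : 0 < ncodes n.
Proof.
apply/card_gt0P; exists [ffun i : 'I_n => (inord 1, false)]; rewrite inE.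
case: n => [|n].
  apply/and3P; split; [|by rewrite /csum big_ord0|by apply/forallP => -[]].
  by apply/forallP => i; rewrite ord1.
set x := [ffun _ => _] : code n.+1.
have c1 i : i <= n.+1 -> csum x i = i.
  elim: i => [|i IH] i_n; first by rewrite /csum big_ord0.
  rewrite csumS IH ?(ltnW i_n) // (cnt_ord x (Ordinal i_n)) ffunE /= inordK //.
  by rewrite addn1.
apply/and3P; split; last by apply/forallP => i; rewrite ffunE.
  by apply/forallP => i; rewrite c1 // -ltnS.
by rewrite c1.
Qed.

Lemma bin_leq_exp n k : 'C(n, k) <= 2 ^ n.
Proof.
rewrite -{1}(card_ord n) -card_draws.
apply: leq_trans (max_card _) _.
by rewrite -cardsT -powersetT card_powerset cardsT card_ord.
Qed.

(** There are ['C(2n, n)] sequences of [n] naturals with sum at most [n], at most 4^n, and 2^n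
    choices of the bits. *)
Lemma ncodes_leq n : ncodes n <= 8 ^ n.
Proof.
pose g (x : code n) : (n.-tuple 'I_n.+1 * {ffun 'I_n -> bool}) := ([tuple (x i).1 | i < n], [ffun i => (x i).2]).
have gI : injective g.
  move=> x y [] /eq_in_map Et Eb; apply/ffunP => i.
  rewrite [LHS]surjective_pairing [RHS]surjective_pairing Et ?mem_enum //.
  by move/ffunP/(_ i): Eb; rewrite !ffunE => ->.
rewrite /ncodes -(card_imset _ gI).
have sub : [set g x | x in [set x | valid x]]%SET \subset
    finset.setX [set t : n.-tuple 'I_n.+1 | \sum_(i <- t) i <= n]%SET [set: {ffun 'I_n -> bool}]%SET.
  apply/fintype.subsetP => z /imsetP[x]; rewrite inE => /validP[_ xn _] ->.
  rewrite !inE andbT /= big_map big_enum /= -[X in _ <= X]xn /csum leq_eqVlt; apply/orP; left.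
  by apply/eqP; apply: eq_bigr => i _; rewrite cnt_ord.
apply: leq_trans (subset_leq_card sub) _.
rewrite cardsX card_partial_ord_partitions cardsT card_ffun card_ord card_bool.
rewrite (_ : 8 = 2 ^ 2 * 2) // expnMn -expnM mul2n -addnn.
by rewrite leq_mul2r bin_leq_exp orbT.
Qed.

(** The binomial coefficient is the product of the quotients [(N - j) / (d - j)] for [j < d], each
    at least [q]. *)
Lemma bin_geq_exp q d N : 0 < q -> q * d <= N -> q ^ d <= 'C(N, d).
Proof.
move=> q0; suff H : q * d <= N -> q ^ d * d`! <= N ^_ d.
  by move=> /H; rewrite -bin_ffact leq_pmul2r ?fact_gt0.
elim: d N => [|d IH] [|N] H; rewrite ?ffactn0 ?expn0 //; first by lia.
rewrite ffactnS expnS factS /= mulnACA; apply: leq_mul => //; apply: IH; nia.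
Qed.

(** * Bounds for the numbers of isomorphism classes *)

Section Classes.
Variables (R : realType) (n : nat).
Local Notation U := (unlabeled_outerplanar R n).
Local Notation D := ([set G : sgraph n | `[< outerplanar R G >]]%SET).

Definition class_of (G : sgraph n) : {set sgraph n} := [set H in D | isomorphic G H]%SET.

Lemma class_in G : outerplanar R G -> class_of G \in U.
Proof. by move=> oG; apply: imset_f; rewrite inE; apply/asboolP. Qed.

Lemma class_mem G : outerplanar R G -> G \in class_of G.
Proof. by move=> oG; rewrite !inE isomorphic_refl andbT; apply/asboolP. Qed.

Lemma classE C G : C \in U -> G \in C -> outerplanar R G /\ C = class_of G.
Proof.
case/imsetP => H _ ->; rewrite !inE => /andP[/asboolP oG HG]; split => //.
apply/setP => K; rewrite !inE; congr (_ && _).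
apply/idP/idP; apply: isomorphic_trans => //.
by rewrite isomorphic_sym.
Qed.

Lemma outerplanar_code (G : sgraph n) : outerplanar R G -> chromatic_number G != 3 ->
  exists x, valid x /\ exists num p link, staircase (adj G) num p link /\ code_of p link = x.
Proof.
move=> oG chi.
have nK4 := outerplanar_K4 oG; have nK23 := outerplanar_K23 oG.
have [c Hc] := three_colorable (@adj_sym n G) (@adj_irr n G) nK4.
have c3 : colorable G 3.
  apply/existsP; exists [ffun v => c v]; apply/forallP => u; apply/forallP => v.
  by apply/implyP; rewrite !ffunE; apply: Hc.
have [chi2 cchi] : chromatic_number G <= 2 /\ colorable G (chromatic_number G).
  move: chi; rewrite /chromatic_number; case: ex_minnP => m cm mm m3; split => //.
  by have := mm _ c3; lia.
have [d Hd] : exists d : 'I_n -> bool, forall u v, adj G u v -> d u != d v.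
  case/existsP: cchi => d dP; exists (fun v => nat_of_ord (d v) == 0%N) => u v uv.
  have /forallP/(_ u)/forallP/(_ v)/implyP/(_ uv) := dP.
  have := ltn_ord (d u); have := ltn_ord (d v); rewrite -(inj_eq val_inj) /=.
  by move: chi2; clear; lia.
have [pos posI nc] := noncrossing_order (@adj_sym n G) (@adj_irr n G) nK4 nK23.
have st := bipartite_staircase (@adj_sym n G) posI nc Hd.
exists (code_of (par pos (@adj_sym n G)) (link pos (@adj_sym n G))); split; first exact: code_valid st.
by eexists; eexists; eexists; split; first exact: st.
Qed.

(** A code is chosen for each class; by [code_of_inj] classes with the same code contain isomorphic
    graphs, hence coincide. *)
Lemma few_bipartite :
  #|[set C in U | [exists G in C, chromatic_number G != 3]]%SET| <= ncodes n.
Proof.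
set B := [set C in U | _]%SET.
have ex (C : {set sgraph n}) : exists x : code n, C \in B -> valid x /\
    exists (G : sgraph n) num p link, [/\ G \in C, staircase (adj G) num p link & code_of p link = x].
  case: (boolP (C \in B)) => CB; last by exists [ffun=> (ord0, false)].
  move: CB; rewrite inE => /andP[CU /exists_inP[G GC chi]].
  have [oG _] := classE CU GC.
  have [x [vx [num [p [link [st cx]]]]]] := outerplanar_code oG chi.
  by exists x => _; split => //; exists G, num, p, link.
have [g gP] := choice ex.
rewrite -(card_in_imset (f := g)).
  apply: subset_leq_card; apply/fintype.subsetP => x /imsetP[C CB ->]; rewrite inE.
  by have [] := gP C CB.
move=> C C' CB CB' E.
have [_ [G [num [p [link [GC st cE]]]]]] := gP C CB.
have [_ [G' [num' [p' [link' [GC' st' cE']]]]]] := gP C' CB'.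
have iso : isomorphic G G' by apply: (code_of_inj st st'); rewrite cE cE'.
move: CB CB'; rewrite !inE => /andP[CU _] /andP[CU' _].
have [oG ->] := classE CU GC; have [oG' ->] := classE CU' GC'.
have /(classE (class_in oG))[_ //] : G' \in class_of G.
by rewrite !inE iso andbT; apply/asboolP.
Qed.

Lemma many_outerplanar k : k.+3 <= n -> ncodes k * 'C(k.+3, n - k.+3) <= #|U| * n ^ 2.
Proof.
move=> kn; pose P := finset.setX [set x : code k | valid x]%SET [set Y : {set 'I_k.+3} | #|Y| == n - k.+3]%SET.
have cP : #|P| = (ncodes k * 'C(k.+3, n - k.+3))%N.
  by rewrite cardsX card_draws card_ord.
pose gr (d : code k * {set 'I_k.+3}) := code_graph n d.1 d.2.
have oP d : d \in P -> outerplanar R (gr d).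
  by rewrite !inE => /andP[vd /eqP cd]; apply: code_graph_outerplanar.
rewrite -cP -sum1_card.
rewrite (partition_big (fun d => class_of (gr d)) (mem U)) /=; last by move=> d /oP; apply: class_in.
apply: leq_trans (_ : \sum_(C in U) n ^ 2 <= _); last by rewrite sum_nat_const.
apply: leq_sum => C CU; rewrite sum1_card.
have n0 : 0 < n by lia.
have n1 : 1 < n by lia.
have nE (u : nat) (un : u < 2) : u < n by lia.
set F := [set d in P | class_of (gr d) == C]%SET.
have -> : #|[pred d in P | class_of (gr d) == C]| = #|F| by apply: eq_card => d; rewrite !inE.
have [->|F0] := eqVneq F finset.set0; first by rewrite cards0.
have [d0] := finset.set0Pn _ F0; rewrite inE => /andP[d0P /eqP d0C].
have ex d : exists s : {perm 'I_n}, d \in F -> forall u v, adj (gr d0) (s u) (s v) = adj (gr d) u v.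
  case: (boolP (d \in F)) => dF; last by exists 1%g.
  move: dF; rewrite inE => /andP[dP /eqP dC].
  have : gr d0 \in class_of (gr d) by rewrite dC -d0C; apply: class_mem; apply: oP.
  by rewrite inE => /andP[_ /isomorphicP[s sE]]; exists s.
have [s sP] := choice ex.
(* If [h d = h d'], then [s d] followed by the inverse of [s d'] is an isomorphism fixing the
   vertices 0 and 1, and rigidity gives [d = d']. So a class arises from at most [n ^ 2] pairs. *)
pose h d := (s d (Ordinal n0), s d (Ordinal n1)).
rewrite -(card_in_imset (f := h)); last first.
  move=> d d' dF d'F [E0 E1].
  have sE : forall u v, adj (gr d') ((s d * (s d')^-1)%g u) ((s d * (s d')^-1)%g v) = adj (gr d) u v.
    by move=> u v; rewrite !permM -(sP d' d'F) !permKV sP.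
  have s01 (u : 'I_n) : u < 2 -> (s d * (s d')^-1)%g u = u.
    move=> u2; apply: (@perm_inj _ (s d')); rewrite permM permKV.
    case: u u2 => [[|[|u]] un] //= _.
      by rewrite (_ : Ordinal un = Ordinal n0) //; apply: val_inj.
    by rewrite (_ : Ordinal un = Ordinal n1) //; apply: val_inj.
  move: dF d'F; rewrite !inE => /andP[/andP[vd /eqP cd] _] /andP[/andP[vd' /eqP cd'] _].
  have [e1 e2] := code_graph_rigid kn vd vd' cd cd' sE s01.
  by rewrite [LHS]surjective_pairing [RHS]surjective_pairing e1 e2.
apply: leq_trans (max_card _) _.
by rewrite card_prod card_ord expnS expn1.
Qed.
End Classes.

(** * Exponential growth of supermultiplicative sequences *)

Local Open Scope ring_scope.

Lemma bernoulli_sub (R : realFieldType) (a : R) n : 0 <= a <= 1 -> 1 - n%:R * a <= (1 - a) ^+ n.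
Proof.
move=> /andP[a0 a1]; elim: n => [|n IH]; first by rewrite mul0r subr0 expr0.
rewrite exprS; apply: le_trans (_ : (1 - a) * (1 - n%:R * a) <= _); last first.
  by rewrite ler_wpM2l // subr_ge0.
by rewrite -natr1; have n0 : 0 <= n%:R :> R by []; nra.
Qed.

Section Growth.
Variables (R : realType) (f : nat -> nat).
Hypotheses (f_super : forall k m, (f k * f m <= f (k + m))%N) (f_gt0 : forall n, (0 < f n)%N)
  (f_leq : forall n, (f n <= 8 ^ n)%N).

Lemma super_exp m q s : (f m ^ q * f s <= f (q * m + s))%N.
Proof.
elim: q => [|q IH]; first by rewrite expn0 mul1n.
rewrite expnS mulSn -mulnA -addnA; apply: leq_trans (f_super _ _).
by rewrite leq_mul2l IH orbT.
Qed.

(** [L] is the supremum of the roots f(m)^(1/m). Take [z] above [L] by 1/200 of it, and [y] in [S]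
    above [L - L / 200]. Powers of [f m] bound [f] from below along multiples of [m]; the remainder
    [n %% m] costs at most [8 ^+ m]. *)
Lemma growth_rate : exists y z : R, exists m : nat,
  [/\ 0 < y <= z, y <= 8, 99 / 100 * z <= y,
     forall n, (f n)%:R <= z ^+ n & forall n, y ^+ n <= 8 ^+ m * (f n)%:R].
Proof.
pose S : set R := fun y => 0 <= y /\ exists m, (0 < m)%N /\ y ^+ m <= (f m)%:R.
have S8 y : S y -> y <= 8.
  case=> y0 [m [m0 ym]]; rewrite leNgt; apply/negP => y8.
  have : 8 ^+ m < y ^+ m :> R by rewrite ltrXn2r // ?nnegrE // -lt0n.
  apply/negP; rewrite -leNgt; apply: le_trans ym _.
  by rewrite -natrX ler_nat f_leq.
have S1 : S 1 by split => //; exists 1%N; rewrite expr1 ler1n.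
have hS : has_sup S by split; [exists 1|exists 8 => y; exact: S8].
pose L := sup S.
have L1 : 1 <= L by apply: ub_le_sup => //; exists 8 => y; exact: S8.
have L8 : L <= 8 by apply: ge_sup; [exists 1|move=> y; exact: S8].
have e0 : 0 < L / 200 by rewrite divr_gt0 //; lra.
have [y Sy yL] := sup_adherent e0 hS.
have [y0 [m [m0 ym]]] := Sy.
have yle : y <= L by apply: ub_le_sup => //; exists 8 => w; exact: S8.
exists y, (L * (201 / 200)), m; rewrite -/L in yL.
split; try lra.
- move=> n; case: n => [|n]; first by have := f_leq 0; rewrite !expr0 -(ler_nat R).
  rewrite leNgt; apply/negP => zf.
  have zL : L * (201 / 200) <= L.
    apply: ub_le_sup; first by exists 8 => w; exact: S8.
    by split; [lra|exists n.+1; split; rewrite // ltW].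
  by lra.
- move=> n; rewrite [in y ^+ n](divn_eq n m) exprD.
  have h1 : y ^+ (n %/ m * m) <= ((f m) ^ (n %/ m))%N%:R.
    by rewrite mulnC exprM natrX; apply: lerXn2r; rewrite ?nnegrE ?exprn_ge0.
  have h2 : y ^+ (n %% m) <= 8 ^+ m.
    apply: (@le_trans _ _ (8 ^+ (n %% m))).
      by apply: lerXn2r; rewrite ?nnegrE //; exact: S8.
    by apply: ler_weXn2l; rewrite ?ler1n // ltnW // ltn_pmod.
  have h3 : ((f m) ^ (n %/ m) <= f n)%N.
    rewrite [X in (_ <= f X)%N](divn_eq n m); apply: leq_trans (super_exp m _ _).
    by rewrite -[X in (X <= _)%N]muln1 leq_mul2l f_gt0 orbT.
  rewrite mulrC; apply: ler_pM; rewrite ?exprn_ge0 //.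
  by apply: le_trans h1 _; rewrite ler_nat.
Qed.

Lemma growth_ratio : exists m : nat, forall n d, (3 <= n)%N -> d = (n %/ 32)%N ->
  (f n)%:R <= (3 / 2) ^+ d.+1 * 8 ^+ m * 8 ^+ (d + 3) * (f (n - 3 - d))%:R :> R.
Proof.
have [y [z [m [/andP[y0 yz] y8 zy fz fy]]]] := growth_rate.
exists m; move=> n d n3 dE; have z0 : 0 < z by lra.
have n32 := divn_eq n 32; rewrite -dE in n32.
have nE : n = (n - 3 - d + (d + 3))%N by rewrite n32 /=; lia.
(* By Bernoulli (99/100)^32 is at least 68/100, which exceeds 2/3. *)
have step : 2 / 3 * z ^+ 32 <= y ^+ 32.
  have b : 1 - 32%:R * (1 / 100) <= (1 - 1 / 100) ^+ 32 :> R.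
    by apply: bernoulli_sub; lra.
  have zy32 : (99 / 100 * z) ^+ 32 <= y ^+ 32.
    by apply: lerXn2r; rewrite ?nnegrE //; lra.
  apply: le_trans zy32; rewrite exprMn; apply: ler_wpM2r; first by rewrite exprn_ge0 // ltW.
  by apply: le_trans (_ : 1 - 32%:R * (1 / 100) <= _); [lra|rewrite (_ : 99 / 100 = 1 - 1 / 100) //; lra].
have e32 : (n %% 32 <= 32)%N by rewrite ltnW // ltn_pmod.
(* The incomplete last block loses no more than a full one; this accounts for the exponent
   [d.+1]. *)
have last_step : 2 / 3 * z ^+ (n %% 32) <= y ^+ (n %% 32).
  have -> : y ^+ (n %% 32) = z ^+ (n %% 32) * (y / z) ^+ (n %% 32).
    by rewrite -exprMn mulrCA mulfV ?mulr1 // gt_eqF.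
  rewrite mulrC; apply: ler_wpM2l; first by rewrite exprn_ge0 // ltW.
  apply: le_trans (_ : (y / z) ^+ 32 <= _).
    by rewrite expr_div_n ler_pdivlMr ?exprn_gt0.
  apply: ler_wiXn2l => //; first by rewrite divr_ge0 // ltW.
  by rewrite ler_pdivrMr // mul1r.
have zn : (2 / 3) ^+ d.+1 * z ^+ n <= y ^+ n.
  have nX (t : R) : t ^+ n = (t ^+ 32) ^+ d * t ^+ (n %% 32).
    by rewrite [in LHS]n32 mulnC exprD exprM.
  rewrite !nX exprSr.
  rewrite [X in X <= _](_ : _ = (2 / 3 * z ^+ 32) ^+ d * (2 / 3 * z ^+ (n %% 32))); last first.
    by rewrite mulrACA -(exprMn d (2 / 3) (z ^+ 32)).
  apply: ler_pM => //; rewrite ?exprn_ge0 ?mulr_ge0 ?exprn_ge0 //; try lra.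
  apply: lerXn2r; rewrite ?nnegrE ?mulr_ge0 ?exprn_ge0 //; try lra.
apply: le_trans (fz n) _.
have -> : z ^+ n = (3 / 2) ^+ d.+1 * ((2 / 3) ^+ d.+1 * z ^+ n).
  by rewrite mulrA -exprMn (_ : 3 / 2 * (2 / 3) = 1 :> R) ?expr1n ?mul1r //; lra.
rewrite -!mulrA; apply: ler_wpM2l; first by rewrite exprn_ge0 //; lra.
apply: le_trans zn _; rewrite {1}nE exprD mulrC [in X in _ <= X]mulrCA.
apply: ler_pM; rewrite ?exprn_ge0 //; try lra.
  by apply: lerXn2r; rewrite ?nnegrE //; lra.
Qed.
End Growth.

(** * The final estimate *)

(** Absorbs the factor [n ^ 2]. The constant 5 works because (d+1)^2 (2/3)^d is largest at d = 4,
    where it equals 400/81. *)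
Lemma square_exp d : ((d.+1) ^ 2 * 2 ^ d <= 5 * 3 ^ d)%N.
Proof.
have [|] := ltnP d 5; first by case: d => [|[|[|[|[|]]]]].
elim: d => // d IH; rewrite leq_eqVlt => /predU1P[<- //|d5].
have := IH d5; rewrite !expnS !expn0 !muln1 => H; nia.
Qed.

Theorem theorem5 (R : realType) :
  exists C r : R, [/\ 0 < C, 0 < r, r < 1 &
    forall n : nat,
      prob_outerplanar R (fun G : sgraph n => chromatic_number G != 3%N)
        <= C * r ^+ n].
Proof.
have [m Hm] := growth_ratio R ncodes_super ncodes_gt0 ncodes_leq.
(* The factors [3 / 2 * 8 ^+ m * 8 ^+ 3] come from [growth_ratio], [32 ^+ 2] from [n <= 32 * d.+1],
   and 5 from [square_exp]. The choice of [r] makes [r ^+ 32] at least 3/4 by Bernoulli, and the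
   extra 4/3 covers the remainder [n %% 32] as well as [n < 3]. *)
pose C0 : R := 3 / 2 * 8 ^+ m * 8 ^+ 3 * 32 ^+ 2 * 5.
pose r : R := 1 - 1 / 128.
have C1 : 1 <= C0.
  have : 1 <= 8 ^+ m :> R by rewrite exprn_ege1 // ler1n.
  by rewrite /C0; move: (8 ^+ m) => q q1; lra.
have r32 : 3 / 4 <= r ^+ 32.
  by apply: le_trans (bernoulli_sub 32 _); lra.
have r0 : 0 < r by rewrite /r; lra.
have r1 : r <= 1 by rewrite /r; lra.
exists (C0 * (4 / 3)), r; split; [lra|lra|rewrite /r; lra|move=> n].
set U := unlabeled_outerplanar R n.
rewrite /prob_outerplanar -/U; set B := [set C in U | _]%SET.
have BU : (#|B| <= #|U|)%N.
  by apply: subset_leq_card; apply/fintype.subsetP => C; rewrite inE => /andP[].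
have Bn : (#|B| <= ncodes n)%N := few_bipartite R n.
have [n3|n3] := ltnP n 3.
  apply: (@le_trans _ _ 1).
    have [U0|U0] := posnP #|U|; first by rewrite U0 invr0 mulr0.
    by rewrite ler_pdivrMr ?ltr0n // mul1r ler_nat.
  have rn : 3 / 4 <= r ^+ n.
    apply: le_trans r32 _; apply: ler_wiXn2l => //; first exact: ltW.
    by apply: leq_trans (ltnW n3) _.
  by nra.
pose d := (n %/ 32)%N; have n32 := divn_eq n 32; rewrite -/d in n32.
have e32 : (n %% 32 < 32)%N by rewrite ltn_pmod.
pose k := (n - 3 - d)%N.
have kE : k.+3 = (n - d)%N by rewrite /k; lia.
have many : (ncodes k * 31 ^ d <= #|U| * n ^ 2)%N.
  apply: leq_trans (_ : ncodes k * 'C(k.+3, n - k.+3) <= _)%N; last first.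
    by apply: many_outerplanar; rewrite kE leq_subr.
  rewrite leq_mul2l; apply/orP; right.
  have -> : (n - k.+3)%N = d by rewrite kE subKn //; lia.
  by apply: bin_geq_exp => //; rewrite kE; lia.
have U0 : (0 < #|U|)%N.
  have : (0 < #|U| * n ^ 2)%N by apply: leq_trans many; rewrite muln_gt0 ncodes_gt0 expn_gt0.
  by rewrite muln_gt0 => /andP[].
rewrite ler_pdivrMr ?ltr0n //.
apply: le_trans (_ : (ncodes n)%:R <= _); first by rewrite ler_nat.
apply: le_trans (Hm n d n3 erefl) _; rewrite -/k.
have manyR : (ncodes k)%:R * 31 ^+ d <= #|U|%:R * n%:R ^+ 2 :> R.
  by rewrite -!natrX -!natrM ler_nat.
have nd : n%:R ^+ 2 <= 32 ^+ 2 * d.+1%:R ^+ 2 :> R.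
  rewrite -exprMn -natrM -!natrX ler_nat leq_exp2r // n32; lia.
have sq : d.+1%:R ^+ 2 * 2 ^+ d <= 5 * 3 ^+ d :> R.
  by have := square_exp d; rewrite -(ler_nat R) !natrM !natrX.
have rn : (3 / 4) ^+ d <= 4 / 3 * r ^+ n.
  have rE : r ^+ n = (r ^+ 32) ^+ d * r ^+ (n %% 32) by rewrite [in LHS]n32 mulnC exprD exprM.
  have h1 : (3 / 4) ^+ d <= (r ^+ 32) ^+ d by apply: lerXn2r; rewrite ?nnegrE ?exprn_ge0 //; lra.
  have h2 : 3 / 4 <= r ^+ (n %% 32).
    by apply: le_trans r32 _; apply: ler_wiXn2l => //; [exact: ltW|exact: ltnW].
  have h3 : 0 <= (3 / 4) ^+ d :> R by rewrite exprn_ge0 //; lra.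
  by rewrite rE; nra.
have uE : #|U|%:R > 0 :> R by rewrite ltr0n.
(* It remains to compare 12^d n^2 with 31^d. *)
have p31 : 0 < 31 ^+ d :> R by rewrite exprn_gt0.
rewrite -(ler_pM2r p31) -[X in X <= _]mulrA.
apply: le_trans (_ : (3 / 2) ^+ d.+1 * 8 ^+ m * 8 ^+ (d + 3) * (#|U|%:R * (32 ^+ 2 * d.+1%:R ^+ 2)) <= _).
  apply: ler_wpM2l; first by rewrite !mulr_ge0 ?exprn_ge0 //; lra.
  by apply: le_trans manyR _; apply: ler_wpM2l; rewrite // ltW.
(* The square turns 12^d into at most 5 * 18^d, and 18 is below 31 * 3/4. *)
have key : (12 : R) ^+ d * d.+1%:R ^+ 2 <= 5 * (31 ^+ d * (4 / 3 * r ^+ n)).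
  apply: le_trans (_ : 5 * (31 ^+ d * (3 / 4) ^+ d) <= _); last first.
    by rewrite !ler_wpM2l // ?ltW.
  have E1 : (12 : R) ^+ d = 6 ^+ d * 2 ^+ d by rewrite -exprMn; congr (_ ^+ _); lra.
  have E2 : (31 : R) ^+ d * (3 / 4) ^+ d = (31 / 4) ^+ d * 3 ^+ d.
    by rewrite -!exprMn; congr (_ ^+ _); lra.
  rewrite E1 E2 -[X in X <= _]mulrA [2 ^+ d * _]mulrC [X in _ <= X]mulrCA.
  apply: ler_pM sq; rewrite ?mulr_ge0 ?exprn_ge0 //.
  by apply: lerXn2r; rewrite ?nnegrE //; lra.
have E : (3 / 2) ^+ d.+1 * 8 ^+ m * 8 ^+ (d + 3) = (3 / 2 * 8 ^+ m * 8 ^+ 3) * 12 ^+ d :> R.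
  have -> : (12 : R) = 3 / 2 * 8 by lra.
  by rewrite exprS exprD (exprMn d (3 / 2) 8); ring.
rewrite E.
apply: le_trans (_ : (3 / 2 * 8 ^+ m * 8 ^+ 3) * (#|U|%:R * 32 ^+ 2) * (5 * (31 ^+ d * (4 / 3 * r ^+ n))) <= _).
  rewrite [X in X <= _](_ : _ = (3 / 2 * 8 ^+ m * 8 ^+ 3) * (#|U|%:R * 32 ^+ 2) * (12 ^+ d * d.+1%:R ^+ 2)); last by ring.
  apply: ler_wpM2l => //; rewrite !mulr_ge0 ?exprn_ge0 //; lra.
by rewrite /C0 le_eqVlt; apply/orP; left; apply/eqP; ring.
Qed.
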